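(* Let $1\le p<\infty$, let $m,n$ be positive integers, $\Omega\subset\mathbf{R}^m$ a bounded polytope domain, $T>0$, $\lambda,\varepsilon,\delta>0$, $\mathbf{g}\in L^2(\Omega,\mathbf{R}^n)$, and let $\mathbf{V}^h$, $\tau=T/L$, $W_\pm$ be as in the context. For each fixed $k\ge1$, suppose $\mathbf{u}_h^{k-1}\in\mathbf{V}^h$ is known. Then there exists a unique $\mathbf{u}_h^k\in\mathbf{V}^h$ such that $$\bigl(\partial_t\mathbf{u}_h^k,\mathbf{v}_h\bigr)+(\mathcal{B}_h^k,\nabla\mathbf{v}_h)+\lambda(\mathbf{u}_h^k-\mathbf{g},\mathbf{v}_h)+\tfrac1\delta(W_+'(\mathbf{u}_h^k),\mathbf{v}_h)=\tfrac1\delta(W_-'(\mathbf{u}_h^{k-1}),\mathbf{v}_h)\quad\forall\mathbf{v}_h\in\mathbf{V}^h,$$ where $\mathcal{B}_h^k=[b_p(\varepsilon)+|\nabla\mathbf{u}_h^k|_\varepsilon^{p-2}]\nabla\mathbf{u}_h^k$ and $\partial_t\mathbf{u}_h^k=(\mathbf{u}_h^k-\mathbf{u}_h^{k-1})/\tau$. Moreover, given a starting value $\mathbf{u}_h^0\in\mathbf{V}^h$, the resulting sequence $\{\mathbf{u}_h^k\}_{k=0}^L$ satisfies $$\frac{\tau}{2}\sum_{k=1}^\ell\|\partial_t\mathbf{u}_h^k\|_{L^2(\Omega)}^2+J_{p,\lambda}^{\varepsilon,\delta}(\mathbf{u}_h^\ell)\le J_{p,\lambda}^{\varepsilon,\delta}(\mathbf{u}_h^0)\qquad\text{for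 }1\le\ell\le L.$$
   Context: Fix $\alpha>0$; $b_p(\varepsilon)=\varepsilon^\alpha$; $a_p(\varepsilon)=0$ if $p\ge2$, $a_p(\varepsilon)=\varepsilon$ if $1\le p<2$; $|\nabla\mathbf{v}|_\varepsilon=\sqrt{|\nabla\mathbf{v}|^2+a_p(\varepsilon)^2}$ (Frobenius norm). $F(\mathbf{v})=\frac14(|\mathbf{v}|^2-1)^2$ on $\mathbf{R}^n$, and $F=W_+-W_-$ with $W_\pm:\mathbf{R}^n\to\mathbf{R}$ convex and differentiable (e.g. $W_+(\mathbf{v})=\frac{|\mathbf{v}|^4}{4}$, $W_-(\mathbf{v})=\frac{|\mathbf{v}|^2}{2}-\frac14$); $W_\pm'$ denotes the gradient. $(\cdot,\cdot)$ is the $L^2(\Omega)$ inner product. $\mathcal{T}_h$ is a (quasi-uniform) triangulation of $\Omega$ with mesh size $0<h<1$, $r\ge1$ an integer, $P_r(K)$ the polynomials of degree $\le r$ on $K$, and $\mathbf{V}^h=\{\mathbf{v}_h\in C(\overline\Omega,\mathbf{R}^n)\cap H^1(\Omega,\mathbf{R}^n):\mathbf{v}_h|_K\in[P_r(K)]^n\ \forall K\in\mathcal{T}_h\}$. $L\ge1$ is an integer and $\tau=T/L$. The energy is $$J_{p,\lambda}^{\varepsilon,\delta}(\mathbf{v})=\int_\Omega\Bigl\{\frac{b_p(\varepsilon)}{2}|\nabla\mathbf{v}|^2+\frac1p|\nabla\mathbf{v}|_\varepsilon^p+\frac1\delta F(\mathbf{v})+\frac\lambda2|\mathbf{v}-\mathbf{g}|^2\Bigr\}dx.$$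 *)

(* Defs.v *)
From HB Require Import structures.
From mathcomp Require Import all_boot all_order all_algebra.
From mathcomp Require Import all_classical all_reals all_analysis.
(* The notations of mpoly clash with those of MathComp-Analysis. *)
From mathcomp Require mpoly.
Import (canonicals, coercions) mpoly.

Set Implicit Arguments.
Unset Strict Implicit.
Unset Printing Implicit Defensive.

Import Order.TTheory GRing.Theory Num.Theory.
Import numFieldNormedType.Exports.

Local Open Scope classical_set_scope.
Local Open Scope ring_scope.

(* The product sigma-algebra on 'rV[R]_m, i.e. the Borel sigma-algebra of R^m. *)

Definition rv_cylinders (R : realType) (m : nat) : set (set 'rV[R]_m) :=
  [set A | exists (i : 'I_m) (B : set (measurableTypeR R)),
     measurable B /\ A = (fun x : 'rV[R]_m => x 0 i) @^-1` B].

Fact rv_display : measure_display. Proof. exact: default_measure_display. Qed.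

Section rv_measurable.
Variables (R : realType) (m : nat).

Let rv_measurable0 : <<s @rv_cylinders R m >> set0.
Proof. exact: sigma_algebra0. Qed.

Let rv_measurableC A :
  <<s @rv_cylinders R m >> A -> <<s @rv_cylinders R m >> (~` A).
Proof. exact: sigma_algebraC. Qed.

Let rv_measurable_bigcup (F : (set 'rV[R]_m)^nat) :
  (forall i, <<s @rv_cylinders R m >> (F i)) ->
  <<s @rv_cylinders R m >> (\bigcup_i (F i)).
Proof. exact: sigma_algebra_bigcup. Qed.

HB.instance Definition _ := @isMeasurable.Build rv_display 'rV[R]_m
  <<s @rv_cylinders R m >> rv_measurable0 rv_measurableC rv_measurable_bigcup.

End rv_measurable.

(* Lebesgue measure on R^m: iterated product of the one-dimensional Lebesgue
   measure, transported along R * R^m -> R^(1 + m). *)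

Definition rv_cons (R : realType) (m : nat)
    (z : measurableTypeR R * 'rV[R]_m) : 'rV[R]_m.+1 :=
  row_mx (z.1 : R)%:M z.2.

Section rv_cons.
Variables (R : realType) (m : nat).

Lemma measurable_rv_coord (i : 'I_m) :
  measurable_fun [set: 'rV[R]_m] (fun x => x 0 i : measurableTypeR R).
Proof.
move=> _ B mB; rewrite setTI; apply: sub_sigma_algebra.
by exists i, B.
Qed.

Lemma measurable_fun_rvP d (T : measurableType d) (f : T -> 'rV[R]_m) :
  (forall i, measurable_fun [set: T] (fun t => f t 0 i : measurableTypeR R)) ->
  measurable_fun [set: T] f.
Proof.
move=> mf; apply: (@measurability _ _ _ _ _ _ (@rv_cylinders R m)) => //.
move=> _ [_ [i [B [mB ->]]] <-].
exact: mf.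
Qed.

End rv_cons.

Lemma measurable_rv_cons (R : realType) (m : nat) :
  measurable_fun [set: measurableTypeR R * 'rV[R]_m] (@rv_cons R m).
Proof.
apply: measurable_fun_rvP => i; case: (split_ordP (i : 'I_(1 + m))) => j ->.
  rewrite (_ : (fun _ => _) = fst)//; apply/funext => z.
  by apply: (etrans (row_mxEl _ _ _ _)); rewrite mxE (ord1 j) eqxx mulr1n.
rewrite (_ : (fun _ => _) = (fun x : 'rV[R]_m => x 0 j) \o snd).
  by apply: measurableT_comp => //; exact: measurable_rv_coord.
by apply/funext => z; exact: row_mxEr.
Qed.

Lemma prod_sigma_finite d1 d2 (T1 : measurableType d1) (T2 : measurableType d2)
    (R : realType) (m1 : {sigma_finite_measure set T1 -> \bar R})
    (m2 : {sigma_finite_measure set T2 -> \bar R}) :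
  sigma_finite setT (m1 \x m2)%E.
Proof.
have /sigma_finiteP[F [TF ndF Foo]] := sigma_finiteT m1.
have /sigma_finiteP[G [TG ndG Goo]] := sigma_finiteT m2.
exists (fun n => F n `*` G n).
  rewrite -setXTT TF TG predeqE => -[x y]; split.
    move=> [/= [n _ Fnx] [k _ Gky]]; exists (maxn n k) => //; split.
    - by move: x Fnx; exact/subsetPset/ndF/leq_maxl.
    - by move: y Gky; exact/subsetPset/ndG/leq_maxr.
  by move=> [n _ []/= ? ?]; split; exists n.
move=> k; have [? ?] := Foo k; have [? ?] := Goo k.
split; first exact: measurableX.
by rewrite product_measure1E// lte_mul_pinfty// ge0_fin_numE.
Qed.

Section lebesgue_cons.
Variables (R : realType) (m : nat).
Variable mu : {sigma_finite_measure set 'rV[R]_m -> \bar R}.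

Definition lebesgue_cons : set 'rV[R]_m.+1 -> \bar R :=
  pushforward (lebesgue_measure \x mu)%E (@rv_cons R m).

Let lebesgue_cons0 : lebesgue_cons set0 = 0%E.
Proof. by rewrite /lebesgue_cons /pushforward preimage_set0 measure0. Qed.

Let lebesgue_cons_ge0 A : (0 <= lebesgue_cons A)%E.
Proof. by rewrite /lebesgue_cons /pushforward; exact: measure_ge0. Qed.

Let lebesgue_cons_sigma_additive : semi_sigma_additive lebesgue_cons.
Proof.
have mpre A : measurable A -> measurable (@rv_cons R m @^-1` A).
  by move=> mA; rewrite -[X in measurable X]setTI; exact: measurable_rv_cons.
move=> F mF tF mUF; rewrite /lebesgue_cons /pushforward preimage_bigcup.
apply: measure_semi_sigma_additive.
- by move=> n; exact: mpre.
- apply/trivIsetP => /= i j _ _ ij; rewrite -preimage_setI.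
  by move/trivIsetP : tF => /(_ _ _ _ _ ij) ->//; rewrite preimage_set0.
- by rewrite -preimage_bigcup; exact: mpre.
Qed.

HB.instance Definition _ := isMeasure.Build _ _ _ lebesgue_cons
  lebesgue_cons0 lebesgue_cons_ge0 lebesgue_cons_sigma_additive.

Let lebesgue_cons_sigma_finite : sigma_finite setT lebesgue_cons.
Proof.
have [F TF Foo] := prod_sigma_finite (@lebesgue_measure R) mu.
pose uncons (x : 'rV[R]_m.+1) : measurableTypeR R * 'rV[R]_m :=
  ((lsubmx (x : 'rV_(1 + m))) 0 0, rsubmx (x : 'rV_(1 + m))).
have consK z : uncons (rv_cons z) = z.
  by case: z => a b; rewrite /uncons /rv_cons row_mxKl row_mxKr !mxE mulr1n.
have muncons : measurable_fun setT uncons.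
  apply: measurable_fun_pair.
    under eq_fun do rewrite mxE.
    exact: measurable_rv_coord.
  apply: measurable_fun_rvP => i.
  under eq_fun do rewrite mxE.
  exact: measurable_rv_coord.
exists (fun k => uncons @^-1` F k).
  by rewrite -preimage_bigcup -TF preimage_setT.
move=> k; have [mFk Fkoo] := Foo k; split.
  by rewrite -[X in measurable X]setTI; exact: muncons.
rewrite /lebesgue_cons /pushforward -comp_preimage.
by rewrite (_ : uncons \o _ = id)//; apply/funext => z; exact: consK.
Qed.

HB.instance Definition _ := @Measure_isSigmaFinite.Build _ _ _ lebesgue_cons
  lebesgue_cons_sigma_finite.

End lebesgue_cons.

Fixpoint lebesgue_rv (R : realType) (m : nat) :
    {sigma_finite_measure set 'rV[R]_m -> \bar R} :=
  match m return {sigma_finite_measure set 'rV[R]_m -> \bar R} with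
  | 0 => dirac (0 : 'rV[R]_0)
  | m'.+1 => lebesgue_cons (lebesgue_rv R m')
  end.

(* Euclidean (for row vectors) and Frobenius inner product and norm; the
   library norm on matrices is the maximum norm. *)

Definition mxdot (R : realType) (a b : nat) (A B : 'M[R]_(a, b)) : R :=
  \sum_i \sum_j A i j * B i j.

Definition fnorm (R : realType) (a b : nat) (A : 'M[R]_(a, b)) : R :=
  Num.sqrt (mxdot A A).

Section domains_and_meshes.
Variables (R : realType) (m : nat).
Implicit Types Omega P : set 'rV[R]_m.

Definition face (k : nat) (A : 'M[R]_(k, m)) (I : {set 'I_k}) : set 'rV[R]_m :=
  [set c *m A | c in [set c : 'rV[R]_k |
     [/\ forall i, 0 <= c 0 i, \sum_i c 0 i = 1 &
         forall i, i \notin I -> c 0 i = 0]]].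

(* convex hull of the rows of A *)
Definition conv_hull (k : nat) (A : 'M[R]_(k, m)) : set 'rV[R]_m :=
  [set c *m A | c in [set c : 'rV[R]_k |
     (forall i, 0 <= c 0 i) /\ \sum_i c 0 i = 1]].

Definition affinely_independent (k : nat) (A : 'M[R]_(k, m)) : bool :=
  row_free (row_mx (const_mx 1 : 'cV[R]_k) A).

(* not necessarily convex *)
Definition polytope P : Prop :=
  exists (N : nat) (k : 'I_N -> nat) (A : forall i, 'M[R]_(k i, m)),
    P = \bigcup_(i in [set: 'I_N]) conv_hull (A i).

Definition bounded_polytope_domain Omega : Prop :=
  [/\ Omega !=set0, open Omega, connected Omega, bounded_set Omega &
      exists2 P, polytope P & Omega = P°].

Definition diam (A : set 'rV[R]_m) : R :=
  sup [set fnorm (z.1 - z.2) | z in A `*` A].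

(* A mesh is a sequence of m-simplices, each given by the matrix whose rows are
   its m + 1 vertices. *)
Implicit Type Th : seq 'M[R]_(m.+1, m).

Definition triangulation Omega Th : Prop :=
  [/\ closure Omega = \bigcup_(K in [set` Th]) conv_hull K,
      {in Th, forall K, affinely_independent K} &
      {in Th &, forall K K', exists I I' : {set 'I_m.+1},
         conv_hull K `&` conv_hull K' = face K I /\
         conv_hull K `&` conv_hull K' = face K' I'}].

Definition mesh_size Th : R := \big[Num.max/0]_(K <- Th) diam (conv_hull K).

Definition quasi_uniform (kappa : R) Th : Prop :=
  {in Th, forall K, exists x : 'rV[R]_m,
     [set y | fnorm (y - x) <= kappa * mesh_size Th] `<=` conv_hull K}.

End domains_and_meshes.

Section function_spaces.
Variables (R : realType) (m : nat).
Implicit Types Omega : set 'rV[R]_m.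

Definition L2 Omega (a b : nat) (f : 'rV[R]_m -> 'M[R]_(a, b)) : Prop :=
  forall i j, measurable_fun Omega (fun x => f x i j) /\
    (lebesgue_rv R m).-integrable Omega (fun x => (f x i j ^+ 2)%:E).

Definition L2dot Omega (a b : nat) (f g : 'rV[R]_m -> 'M[R]_(a, b)) : R :=
  \int[lebesgue_rv R m]_(x in Omega) mxdot (f x) (g x).

Definition L2norm Omega (a b : nat) (f : 'rV[R]_m -> 'M[R]_(a, b)) : R :=
  Num.sqrt (L2dot Omega f f).

Definition partial (j : 'I_m) (f : 'rV[R]_m -> R) : 'rV[R]_m -> R :=
  fun x => 'D_(delta_mx 0 j) f x.

Definition gradient (f : 'rV[R]_m -> R) (x : 'rV[R]_m) : 'rV[R]_m :=
  \row_j partial j f x.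

Definition smooth (f : 'rV[R]_m -> R) : Prop :=
  forall s : seq 'I_m, continuous (foldr partial f s) /\
    forall (j : 'I_m) x, derivable (foldr partial f s) x (delta_mx 0 j).

Definition test_function Omega (phi : 'rV[R]_m -> R) : Prop :=
  [/\ smooth phi, compact (closure [set x | phi x != 0]) &
      closure [set x | phi x != 0] `<=` Omega].

Definition weak_gradient Omega (n : nat) (v : 'rV[R]_m -> 'rV[R]_n)
    (G : 'rV[R]_m -> 'M[R]_(n, m)) : Prop :=
  L2 Omega G /\
  forall phi, test_function Omega phi -> forall i j,
    \int[lebesgue_rv R m]_(x in Omega) (v x 0 i * partial j phi x) =
    - \int[lebesgue_rv R m]_(x in Omega) (G x i j * phi x).

Definition H1 Omega (n : nat) (v : 'rV[R]_m -> 'rV[R]_n) : Prop :=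
  L2 Omega v /\ exists G, weak_gradient Omega v G.

(* a representative of the weak gradient; the latter is unique up to a null
   set *)
Definition grad Omega (n : nat) (v : 'rV[R]_m -> 'rV[R]_n) :
    'rV[R]_m -> 'M[R]_(n, m) :=
  xget (fun=> 0) [set G | weak_gradient Omega v G].

(* The values of v outside closure Omega are irrelevant. *)
Definition fe_space Omega (Th : seq 'M[R]_(m.+1, m)) (r n : nat) :
    set ('rV[R]_m -> 'rV[R]_n) :=
  [set v | [/\ {within closure Omega, continuous v}, H1 Omega v &
     {in Th, forall K, forall i : 'I_n,
        exists2 q : mpoly.mpoly m R, (mpoly.msize q <= r.+1)%N &
          forall x, conv_hull K x -> v x 0 i = mpoly.meval (fun j => x 0 j) q}]].

End function_spaces.

Section flow.
Variables (R : realType) (m n : nat) (Omega : set 'rV[R]_m).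
Variables (p alpha eps delta lambda tau : R).
Variable g : 'rV[R]_m -> 'rV[R]_n.
Implicit Types u v : 'rV[R]_m -> 'rV[R]_n.

Definition b_coef : R := eps `^ alpha.

Definition a_coef : R := if 2 <= p then 0 else eps.

Definition reg_norm (A : 'M[R]_(n, m)) : R :=
  Num.sqrt (fnorm A ^+ 2 + a_coef ^+ 2).

Definition potential (y : 'rV[R]_n) : R := (fnorm y ^+ 2 - 1) ^+ 2 / 4.

Definition energy v : R :=
  \int[lebesgue_rv R m]_(x in Omega)
    (b_coef / 2 * fnorm (grad Omega v x) ^+ 2
     + p^-1 * reg_norm (grad Omega v x) `^ p
     + delta^-1 * potential (v x)
     + lambda / 2 * fnorm (v x - g x) ^+ 2).

Definition flux u : 'rV[R]_m -> 'M[R]_(n, m) :=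
  fun x => (b_coef + reg_norm (grad Omega u x) `^ (p - 2)) *: grad Omega u x.

Definition dt u_prev u : 'rV[R]_m -> 'rV[R]_n :=
  fun x => tau^-1 *: (u x - u_prev x).

Definition scheme (Vh : set ('rV[R]_m -> 'rV[R]_n)) (Wp Wm : 'rV[R]_n -> R)
    u_prev u : Prop :=
  forall v, Vh v ->
    L2dot Omega (dt u_prev u) v
    + L2dot Omega (flux u) (grad Omega v)
    + lambda * L2dot Omega (fun x => u x - g x) v
    + delta^-1 * L2dot Omega (fun x => gradient Wp (u x)) v
    = delta^-1 * L2dot Omega (fun x => gradient Wm (u_prev x)) v.

End flow.

(* Main.v *)
(* A weak gradient of a finite element function coincides almost everywhere
   with the classical gradient of its polynomial pieces (integration by parts
   against product bump functions and a pi-lambda argument on boxes), and the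
   simplex boundaries are null sets.  Hence all integrands are bounded up to the
   L^2 datum g, and gradients are linear off a null set.  The scheme is then the
   Euler-Lagrange equation of a strongly convex functional on a finite
   dimensional space: its minimizer is the unique solution.  Testing with the
   increment and using the convexity of the gradient terms and of W_+ and W_-
   gives the energy decay. *)
Require Import Defs.
From HB Require Import structures.
From mathcomp Require Import all_boot all_order all_algebra.
From mathcomp Require Import all_classical all_reals all_analysis.
From mathcomp Require Import measurable_realfun.
From mathcomp Require mpoly.
From mathcomp Require Import ring lra.
Import (canonicals, coercions) mpoly.
Import Order.TTheory GRing.Theory Num.Theory.
Import numFieldNormedType.Exports.

Set Implicit Arguments.
Unset Strict Implicit.
Unset Printing Implicit Defensive.

Local Open Scope classical_set_scope.
Local Open Scope ring_scope.

(** The scheme is stated with [grad], a representative of the weak gradient selected by choice: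
    nothing is known about it at a given point, and [grad] of a sum need not be the sum of the
    [grad]s. Every integral is therefore moved to an open set of full measure in [Omega], the union
    of the pieces of a [core], where the classical gradient [cgrad] exists and is determined by the
    function. Linearity of the real-valued integral has to be paid for by integrability of each
    term, while $g$ is merely $L^2$; the weight $1+\sum_i|g_i|$ dominates the step derivative and
    its difference quotients. The power $|\nabla v|_\varepsilon^{p-2}$ changes behaviour at $p=2$.
    Instead of differentiating it, the tangent inequality of a convex function is written at both
    ends of a segment: it traps a difference quotient between two values of the derivative, which
    yields limits, dominations and the integrability of the densities. Elements of [Vh] are
    functions on the whole space that matter only on the closure of [Omega], so finite dimension
    takes the form of a maximal $L^2$-orthonormal family spanning up to equality on that closure. *)

(** * Lebesgue measure on row vectors: translations, boxes, hyperplanes *)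

(** The translated measure has the same value on half-open intervals, and these determine Lebesgue
    measure. *)
Lemma lebesgue_measure_translate (R : realType) (a : R) (A : set R) :
  measurable A ->
  lebesgue_measure ((fun x : measurableTypeR R => x + a : measurableTypeR R) @^-1` A)
  = lebesgue_measure A.
Proof.
move=> mA.
have mt : measurable_fun [set: measurableTypeR R]
    (fun x : measurableTypeR R => x + a : measurableTypeR R).
  exact: measurable_funD.
pose t : {mfun (measurableTypeR R) >-> (measurableTypeR R)} := HB.pack
  (fun x : measurableTypeR R => x + a : measurableTypeR R)
  (isMeasurableFun.Build _ _ _ _ _ mt).
rewrite -[LHS]/(pushforward lebesgue_measure t A).
apply/esym/lebesgue_measure_unique => //= _ [[b c]] _ <-.
rewrite /pushforward/=.
rewrite (_ : _ @^-1` _ = `]b - a, c - a]%classic); last first.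
  by apply/seteqP; split => x /=; rewrite !in_itv/= ltrBlDr lerBrDr.
rewrite !lebesgue_measure_itv/= !lte_fin ltrD2r; case: ifPn => // _.
by congr (_%:E); ring.
Qed.

Lemma measurable_rv_translate (R : realType) (m : nat) (a : 'rV[R]_m) :
  measurable_fun [set: 'rV[R]_m] (fun x => x + a).
Proof.
apply: measurable_fun_rvP => i; under eq_fun do rewrite mxE.
by apply: measurable_funD => //; exact: measurable_rv_coord.
Qed.

(** Induction on the dimension: a translation acts separately on the first coordinate and on the
    rest, so both measures agree on measurable rectangles, and the product measure is unique. *)
Lemma lebesgue_rv_translate (R : realType) (m : nat) (a : 'rV[R]_m)
  (A : set 'rV[R]_m) : measurable A ->
  lebesgue_rv R m ((fun x => x + a) @^-1` A) = lebesgue_rv R m A.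
Proof.
elim: m a A => [|m IH] a A mA.
  congr (lebesgue_rv R 0 _); apply/seteqP; split => x /=;
    by rewrite (_ : x + a = x)//; apply/rowP => -[].
pose a0 : R := lsubmx (a : 'rV_(1 + m)) 0 0.
pose a1 : 'rV[R]_m := rsubmx (a : 'rV_(1 + m)).
have mt0 : measurable_fun [set: measurableTypeR R]
    (fun x : measurableTypeR R => x + a0 : measurableTypeR R).
  exact: measurable_funD.
pose tf (z : measurableTypeR R * 'rV[R]_m) : measurableTypeR R * 'rV[R]_m :=
  (z.1 + a0, z.2 + a1).
have mt : measurable_fun setT tf.
  apply: measurable_fun_pair.
    exact: (measurableT_comp mt0).
  by apply: (measurableT_comp (measurable_rv_translate a1)).
pose t : {mfun (measurableTypeR R * 'rV[R]_m)%type >-> (measurableTypeR R * 'rV[R]_m)%type} :=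
  HB.pack tf (isMeasurableFun.Build _ _ _ _ _ mt).
rewrite /= /lebesgue_cons /pushforward.
have mA' : measurable (@rv_cons R m @^-1` A).
  by rewrite -[X in measurable X]setTI; exact: measurable_rv_cons.
rewrite (_ : _ @^-1` _ = t @^-1` (@rv_cons R m @^-1` A)); last first.
  have htf z : rv_cons z + a = rv_cons (tf z).
    rewrite {1}(_ : a = row_mx a0%:M a1); last first.
      by rewrite -[LHS](@hsubmxK _ _ 1 m); congr (@row_mx _ 1 1 m); exact: mx11_scalar.
    by rewrite /rv_cons [LHS](@add_row_mx _ 1 1 m) -raddfD.
  by apply/seteqP; split => z /=; rewrite htf.
rewrite -[LHS]/(pushforward (lebesgue_measure \x lebesgue_rv R m)%E t _).
apply/esym/product_measure_unique => // B C mB mC.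
rewrite /= /pushforward (_ : t @^-1` _ =
  ((fun x : measurableTypeR R => x + a0 : measurableTypeR R) @^-1` B)
  `*` ((fun x => x + a1) @^-1` C)); last first.
  by apply/seteqP; split => -[x y].
rewrite product_measure1E.
- by congr (_ * _)%E; [exact: lebesgue_measure_translate|exact: IH].
- by rewrite -[X in measurable X]setTI; exact: mt0.
- by rewrite -[X in measurable X]setTI; exact: measurable_rv_translate.
Qed.

Lemma measurable_rv_box (R : realType) (m : nat) (J : 'I_m -> set R) :
  (forall i, measurable (J i)) ->
  measurable [set x : 'rV[R]_m | forall i, J i (x 0 i)].
Proof.
move=> mJ; rewrite (_ : [set _ | _] = \bigcap_(i in [set: 'I_m])
   ((fun x : 'rV[R]_m => x 0 i) @^-1` J i)); last first.
  by apply/seteqP; split => x /= xJ i; [move=> _|]; exact: xJ.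
apply: fin_bigcap_measurable => // i _.
by rewrite -[X in measurable X]setTI; exact: (measurable_rv_coord i measurableT (mJ i)).
Qed.

Definition rv_cube (R : realType) (m : nat) (M : R) : set 'rV[R]_m :=
  [set x | forall i, `[- M, M]%classic (x 0 i)].
Arguments rv_cube {R} m M.

Lemma measurable_rv_cube (R : realType) (m : nat) (M : R) :
  measurable (rv_cube m M).
Proof. exact: (@measurable_rv_box R m (fun=> `[- M, M]%classic)). Qed.

Lemma lebesgue_rv_cube_lty (R : realType) (m : nat) (M : R) :
  (lebesgue_rv R m (rv_cube m M) < +oo)%E.
Proof.
elim: m => [|m IH].
  by rewrite /= diracE; case: (_ \in _); rewrite /= ltry.
rewrite /= /lebesgue_cons /pushforward.
rewrite (_ : _ @^-1` _ = `[- M, M]%classic `*` rv_cube m M); last first.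
  apply/seteqP; split => -[x y]; rewrite /rv_cons /=.
    move=> h; split => [|i].
      by have := h (@lshift 1 m 0); rewrite (row_mxEl x%:M y) mxE mulr1n.
    by have := h (rshift 1 i); rewrite (row_mxEr x%:M y).
  move=> [hx hy] i; case: (split_ordP (i : 'I_(1 + m))) => j ->.
    by rewrite (row_mxEl x%:M y) ord1 mxE mulr1n.
  by rewrite (row_mxEr x%:M y).
rewrite product_measure1E//; last exact: measurable_rv_cube.
have h : lebesgue_measure (`[- M, M]%classic : set R) \is a fin_num.
  by rewrite lebesgue_measure_itv/=; case: ifP.
by rewrite lte_mul_pinfty.
Qed.

Section boxes.
Variables (R : realType) (m : nat).
Implicit Types (l u : 'I_m -> R) (U : set 'rV[R]_m).

Definition open_box l u : set 'rV[R]_m := [set x | forall i, l i < x 0 i < u i].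

Definition closed_box l u : set 'rV[R]_m := [set x | forall i, l i <= x 0 i <= u i].

Lemma compact_closed_box l u : compact (closed_box l u).
Proof.
rewrite (_ : closed_box _ _ = [set x | forall i, `[l i, u i]%classic (x 0 i)]).
  by apply: (@rV_compact R m (fun i => `[l i, u i]%classic)) => i; exact: segment_compact.
by apply/seteqP; split => x /= h i; have := h i; rewrite /= in_itv.
Qed.

Lemma measurable_open_box l u : measurable (open_box l u).
Proof.
rewrite (_ : open_box _ _ = [set x | forall i, `]l i, u i[%classic (x 0 i)]).
  by apply: (@measurable_rv_box R m (fun i => `]l i, u i[%classic)) => i; exact: measurable_itv.
by apply/seteqP; split => x /= h i; have := h i; rewrite /= in_itv.
Qed.

(** A pair encodes a box by its rational centre and an index [k], the half-width being $1/(k+1)$.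
    The codes are countable, so unions over them preserve measurable sets and null sets. *)
Definition rat_lo (p : 'rV[rat]_m * nat) (i : 'I_m) : R := ratr (p.1 0 i) - p.2.+1%:R^-1.

Definition rat_hi (p : 'rV[rat]_m * nat) (i : 'I_m) : R := ratr (p.1 0 i) + p.2.+1%:R^-1.

(** The closed box, not only the open one, is placed inside [U]: the bump functions of the box are
    then supported in [U]. *)
Lemma open_rat_box U x : open U -> U x ->
  exists2 p, open_box (rat_lo p) (rat_hi p) x &
             closed_box (rat_lo p) (rat_hi p) `<=` U.
Proof.
move=> oU Ux.
have /nbhs_ballP[e /= e0 xeU] : nbhs x U by exact: open_nbhs_nbhs.
(* Half of the radius: in each coordinate a point of the box is within $1/(k+1)$ of the centre, and
   the centre is within $1/(k+1)$ of [x]. *)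
have [k ke] : exists k : nat, k.+1%:R^-1 < e / 2.
  have := @near_infty_natSinv_lt R (PosNum (divr_gt0 e0 (ltr0n R 2))).
  by case => k _ /(_ k (leqnn _)) ?; exists k.
have k0 : 0 < k.+1%:R^-1 :> R by rewrite invr_gt0.
have hc i : exists q : rat, `|ratr q - x 0 i| < k.+1%:R^-1.
  have : x 0 i - k.+1%:R^-1 < x 0 i + k.+1%:R^-1.
    by rewrite ltrBlDr -addrA ltrDl addr_gt0.
  move=> /rat_in_itvoo[q]; rewrite in_itv/= => /andP[q1 q2].
  by exists q; rewrite ltr_distl q1.
have /choice[q hq] := hc.
exists (\row_i q i, k).
  by move=> i; rewrite /rat_lo /rat_hi/= mxE -ltr_distl distrC.
move=> y hy; apply: xeU; rewrite mx_norm_ball /ball_/=.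
rewrite [ltLHS]mx_normrE; apply/bigmax_ltP; split => // -[i j] _ /=.
rewrite ord1 !mxE; have := hy j; rewrite /rat_lo /rat_hi/= mxE -ler_distl => yj.
have -> : x 0 j - y 0 j = - (ratr (q j) - x 0 j) - (y 0 j - ratr (q j)) by ring.
rewrite (le_lt_trans (ler_normB _ _))// normrN [ltRHS]splitr.
exact: ltrD (lt_trans (hq j) ke) (le_lt_trans yj ke).
Qed.

(** The sigma-algebra is generated by cylinders, so an open set has to be exhibited as a countable
    union of rational boxes. *)
Lemma open_measurable_rv U : open U -> measurable U.
Proof.
move=> oU.
pose F p := if `[< closed_box (rat_lo p) (rat_hi p) `<=` U >] then
  open_box (rat_lo p) (rat_hi p) else set0.
rewrite (_ : U = \bigcup_(p in [set: 'rV[rat]_m * nat]) F p).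
  apply: countable_bigcupT_measurable; first exact: countableP.
  by move=> p; rewrite /F; case: ifPn => // _; exact: measurable_open_box.
apply/seteqP; split => [x Ux|x [p _]].
  have [p xp pU] := open_rat_box oU Ux.
  by exists p => //; rewrite /F; case: asboolP.
rewrite /F; case: asboolP => // pU xp; apply: pU => i.
by have /andP[? ?] := xp i; rewrite !ltW.
Qed.

End boxes.

Lemma bounded_lebesgue_rv_lty (R : realType) (m : nat) (A : set 'rV[R]_m) :
  measurable A -> bounded_set A -> (lebesgue_rv R m A < +oo)%E.
Proof.
move=> mA [M [_ hM]]; apply: le_lt_trans (lebesgue_rv_cube_lty m (`|M| + 1)).
apply: le_measure; rewrite ?inE//; first exact: measurable_rv_cube.
move=> x Ax i /=; rewrite in_itv/= -ler_norml.
apply: le_trans (hM (`|M| + 1) _ x Ax); last by rewrite ltr_pwDr// ler_norm.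
by rewrite [leRHS]/Num.norm/= mx_normrE; apply/bigmax_geP; right; exists (0, i).
Qed.

Lemma measurable_rv_sum (R : realType) (m : nat) (b : 'I_m -> R) :
  measurable_fun [set: 'rV[R]_m] (fun x => \sum_j x 0 j * b j).
Proof.
apply: measurable_sum => j; apply: measurable_funM => //.
exact: measurable_rv_coord.
Qed.

(* Infinitely many disjoint translates of a bounded piece of the hyperplane fit
   in a cube. *)
Lemma hyperplane_null (R : realType) (m : nat) (b : 'I_m -> R) (c : R) :
  (exists j, b j != 0) ->
  lebesgue_rv R m [set x : 'rV[R]_m | \sum_j x 0 j * b j = c] = 0%E.
Proof.
move=> [j0 b0]; set H := [set _ | _].
have mf := @measurable_rv_sum R m b.
have mH : measurable H.
  rewrite (_ : H = (fun x : 'rV[R]_m => \sum_j x 0 j * b j) @^-1` [set c])//.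
  by rewrite -[X in measurable X]setTI; exact: mf.
have mHM M : measurable (H `&` rv_cube m M).
  by apply: measurableI => //; exact: measurable_rv_cube.
suff HM (M : nat) : lebesgue_rv R m (H `&` rv_cube m M%:R) = 0%E.
  apply/eqP; rewrite -measure_le0.
  have sH : H `<=` \bigcup_(M : nat) (H `&` rv_cube m M%:R).
    move=> x Hx; exists (Num.truncn `|x|).+1 => //; split => // i /=.
    rewrite in_itv/= -ler_norml; apply: (@le_trans _ _ `|x|); last first.
      exact/ltW/truncnS_gt.
    rewrite [leRHS]/Num.norm/= mx_normrE.
    by apply/bigmax_geP; right; exists (0, i).
  have mHM' (M : nat) : measurable (H `&` rv_cube m M%:R) by exact: mHM.
  rewrite (le_trans (measure_sigma_subadditive (lebesgue_rv R m) mHM' mH sH))//.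
  by rewrite eseries0// => i _ _; exact: HM.
(* Shifts by the distinct numbers $1/(k+1)$ along a coordinate where [b] is nonzero change the
   linear form by distinct amounts, so the pieces are disjoint; being at most 1, they stay in the
   cube of half-side $M+1$. *)
pose e : 'rV[R]_m := delta_mx 0 j0.
pose t (k : nat) : R := k.+1%:R^-1.
pose F k := (fun x => x + (- t k) *: e) @^-1` (H `&` rv_cube m M%:R).
have mF k : measurable (F k).
  by rewrite /F -[X in measurable X]setTI; exact: measurable_rv_translate.
have FE k : lebesgue_rv R m (F k) = lebesgue_rv R m (H `&` rv_cube m M%:R).
  exact: lebesgue_rv_translate.
have sE (x : 'rV[R]_m) (s : R) : \sum_j (x + s *: e) 0 j * b j = (\sum_j x 0 j * b j) + s * b j0.
  rewrite (eq_bigr (fun j => x 0 j * b j + s * (e 0 j * b j))); last first.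
    by move=> j _; rewrite !mxE mulrDl mulrA.
  rewrite big_split/= -mulr_sumr; congr (_ + _ * _).
  rewrite (bigD1 j0)//= big1 ?addr0 ?mxE ?eqxx ?mul1r// => j jj0.
  by rewrite mxE (negbTE jj0) andbF mul0r.
have tF : trivIset setT F.
  apply/trivIsetP => i j _ _ ij; rewrite -subset0 => x [[/= + _] [/= + _]].
  rewrite /H /= !sE => <- /eqP; rewrite -subr_eq0 opprD addrACA subrr add0r -mulrBl.
  rewrite mulf_eq0 (negbTE b0) orbF subr_eq0 eqr_opp => /eqP/invr_inj/eqP.
  by rewrite eqr_nat eqSS => /eqP ji; move: ij; rewrite ji eqxx.
have sF k : F k `<=` rv_cube m (M%:R + 1).
  move=> x [_ /= h] i; have := h i; rewrite /= !in_itv/= !mxE -!ler_norml.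
  set d := (_ && _) => hi.
  have -> : x 0 i = (x 0 i + - t k * d%:R) + t k * d%:R by rewrite mulNr subrK.
  rewrite (le_trans (ler_normD _ _))// lerD// normrM.
  have tk : `|t k| <= 1.
    by rewrite /t ger0_norm ?invr_ge0// invf_le1// ler1n.
  by case: d {hi}; rewrite ?normr1 ?normr0 ?mulr1 ?mulr0.
apply/eqP; apply: contraT => A0.
have {}A0 : (0 < lebesgue_rv R m (H `&` rv_cube m M%:R))%E.
  by rewrite lt_neqAle eq_sym A0 measure_ge0.
have Cfin := @lebesgue_rv_cube_lty R m (M%:R + 1).
have bnd n : (n%:R%:E * lebesgue_rv R m (H `&` rv_cube m M%:R) <=
    lebesgue_rv R m (rv_cube m (M%:R + 1)))%E.
  rewrite (_ : (_ * _)%E = lebesgue_rv R m (\big[setU/set0]_(i < n) F i)); last first.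
    rewrite measure_bigsetU// (eq_bigr _ (fun (i : 'I_n) _ => FE i)).
    by rewrite sumr_const card_ord mule_natl.
  apply: le_measure; rewrite ?inE; first exact: bigsetU_measurable.
    exact: measurable_rv_cube.
  by move=> x; rewrite -bigcup_mkord => -[i _ /sF].
have Afin : lebesgue_rv R m (H `&` rv_cube m M%:R) \is a fin_num.
  rewrite ge0_fin_numE//; apply: le_lt_trans Cfin.
  by have := bnd 1%N; rewrite mul1e.
have Cf : lebesgue_rv R m (rv_cube m (M%:R + 1)) \is a fin_num.
  by rewrite ge0_fin_numE.
move: A0 bnd; rewrite -(fineK Afin) -(fineK Cf); set a := fine _; set C := fine _.
rewrite lte_fin => a0 /(_ (Num.truncn (C / a)).+1); rewrite -EFinM lee_fin.
by rewrite -ler_pdivlMr// leNgt Num.Theory.truncnS_gt.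
Qed.

(** * Directional derivatives as limits of sequences, and the integral of a derivative *)

Lemma continuous_measurable_rv (R : realType) (m : nat) (f : 'rV[R]_m -> R) :
  continuous f -> measurable_fun [set: 'rV[R]_m] f.
Proof.
move=> cf; apply: (measurability _ (RGenOInfty.measurableE R)).
move=> _ [_ [x ->] <-]; rewrite setTI; apply: open_measurable_rv.
by apply: open_comp => // y _; exact: cf.
Qed.

Lemma cvg_harmonic_dnbhs (R : realType) : (fun k : nat => k.+1%:R^-1 : R) @ \oo --> 0^'.
Proof.
move=> A; rewrite /dnbhs /within /= => /cvg_harmonic.
by rewrite !near_simpl; apply: filterS => k /=; apply; rewrite invr_eq0.
Qed.

(** Derivatives enter through quotients with steps $1/(k+1)$, because measurability of limits and
    dominated convergence are statements about sequences. *)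
Lemma cvg_derive_seq (R : realType) (V : normedModType R) (f : V -> R) (x v : V) :
  derivable f x v ->
  (fun k : nat => k.+1%:R * (f (x + k.+1%:R^-1 *: v) - f x)) @ \oo --> 'D_v f x.
Proof.
move=> df; have := cvg_comp _ _ (@cvg_harmonic_dnbhs R) df.
apply: cvg_trans; apply: near_eq_cvg; apply: nearW => k /=.
by rewrite invrK (addrC x).
Qed.

Lemma measurable_derive_rv (R : realType) (m : nat) (f : 'rV[R]_m -> R) (v : 'rV[R]_m) :
  measurable_fun setT f -> (forall x, derivable f x v) ->
  measurable_fun setT (fun x => 'D_v f x).
Proof.
move=> mf df.
pose h k x : R := k.+1%:R * (f (x + k.+1%:R^-1 *: v) - f x).
apply: (@measurable_fun_cvg _ _ _ _ h) => [k|x _]; last exact: cvg_derive_seq.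
apply: measurable_funM => //; apply: measurable_funB => //.
by apply: (measurableT_comp mf); exact: measurable_rv_translate.
Qed.

Lemma is_derive_line (R : realType) (V : normedModType R) (f : V -> R) (x v : V) (s : R) :
  derivable f (x + s *: v) v ->
  is_derive s 1 (fun h => f (x + h *: v)) ('D_v f (x + s *: v)).
Proof.
move=> df.
have E : (fun h : R => h^-1 *: (((fun h => f (x + h *: v)) \o shift s) (h *: 1) - f (x + s *: v)))
  = (fun h : R => h^-1 *: ((f \o shift (x + s *: v)) (h *: v) - f (x + s *: v))).
  apply/funext => h /=; congr (_ *: (f _ - _)).
  by rewrite [h%:A]mulr1 scalerDl addrCA.
split; first by rewrite /derivable E.
by rewrite /derive E.
Qed.

Lemma derive_lipschitz (R : realType) (V : normedModType R) (f : V -> R) (x v : V) (C t : R) :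
  (forall y, derivable f y v) -> (forall y, `|'D_v f y| <= C) ->
  `|f (x + t *: v) - f x| <= C * `|t|.
Proof.
move=> df hC.
pose phi h := f (x + h *: v).
have dphi (h : R) : is_derive h 1 phi ('D_v f (x + h *: v)) by exact: is_derive_line.
have cphi a b : {within `[a, b], continuous phi}.
  apply: derivable_within_continuous => h _.
  by have [] := dphi h.
have key a b : a <= b -> `|phi b - phi a| <= C * `|b - a|.
  move=> ab; have [c _ ->] := MVT_segment ab (fun h _ => dphi h) (cphi a b).
  by rewrite normrM ler_wpM2r.
have E : f x = phi 0 by rewrite /phi scale0r addr0.
rewrite E -/(phi t); case: (leP 0 t) => t0.
  by have := key 0 t t0; rewrite subr0.
by rewrite distrC (le_trans (key t 0 (ltW t0)))// sub0r normrN.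
Qed.

Lemma Rintegral_translate (R : realType) (m : nat) (f : 'rV[R]_m -> R) (a : 'rV[R]_m) :
  measurable_fun setT f ->
  (lebesgue_rv R m).-integrable setT (EFin \o (fun x => f (x + a))) ->
  \int[lebesgue_rv R m]_x f (x + a) = \int[lebesgue_rv R m]_x f x.
Proof.
move=> mf intf; congr fine.
have := @integral_pushforward _ _ _ _ R _ (measurable_rv_translate a) (lebesgue_rv R m)
  setT (EFin \o f) ((measurable_EFinP _ _).2 mf).
rewrite preimage_setT => /(_ intf measurableT) <-.
apply: eq_measure_integral; first exact: measurable_rv_translate.
by move=> mt A mA _; rewrite -[RHS](lebesgue_rv_translate a mA).
Qed.

Lemma bounded_cube_integrable (R : realType) (m : nat) (f : 'rV[R]_m -> R) (C M : R) :
  measurable_fun setT f -> (forall x, `|f x| <= C) ->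
  (forall x, ~ rv_cube m M x -> f x = 0) ->
  (lebesgue_rv R m).-integrable setT (EFin \o f).
Proof.
move=> mf hC f0.
have -> : EFin \o f = (EFin \o f) \_ (rv_cube m M).
  apply/funext => x; rewrite patchE; case: ifPn => //.
  by rewrite notin_setE /= => /f0 ->.
apply/integrable_restrict => //; first exact: measurable_rv_cube.
rewrite setTI; apply: measurable_bounded_integrable.
- exact: measurable_rv_cube.
- exact: lebesgue_rv_cube_lty.
- exact: measurable_funTS.
- by exists C; split; [exact: num_real|move=> N CN x _ /=; rewrite (le_trans (hC x))// ltW].
Qed.

(** Translation invariance gives every difference quotient the integral zero. The mean value theorem
    bounds the quotients by [C], and they are supported in one common cube, so dominated convergence
    applies. *)
Lemma Rintegral_derive0 (R : realType) (m : nat) (f : 'rV[R]_m -> R) (v : 'rV[R]_m) (C M : R) :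
  measurable_fun setT f -> (forall x, derivable f x v) ->
  (forall x, `|f x| <= C) -> (forall x, `|'D_v f x| <= C) ->
  (forall x, ~ rv_cube m M x -> f x = 0) ->
  \int[lebesgue_rv R m]_x 'D_v f x = 0.
Proof.
move=> mf df hC hD f0.
pose mu := lebesgue_rv R m.
pose h k x : R := k.+1%:R * (f (x + k.+1%:R^-1 *: v) - f x).
(* All shifts $v/(k+1)$ have norm at most $|v|$, so this cube carries every quotient. *)
pose M' := M + `|v|.
have cubeS x : ~ rv_cube m M' x -> ~ rv_cube m M x.
  apply: contra_not => xM i; have := xM i; rewrite /= !in_itv/= -!ler_norml => xi.
  by rewrite (le_trans xi)// lerDl.
have cubeT k x : ~ rv_cube m M' x -> ~ rv_cube m M (x + k.+1%:R^-1 *: v).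
  apply: contra_not => xM i; have := xM i; rewrite /= !in_itv/= !mxE -!ler_norml => xi.
  have -> : x 0 i = (x 0 i + k.+1%:R^-1 * v 0 i) + - (k.+1%:R^-1 * v 0 i) by rewrite addrK.
  rewrite (le_trans (ler_normD _ _))// lerD// normrN normrM.
  rewrite -[leRHS]mul1r ler_pM//.
    by rewrite ger0_norm ?invr_ge0// invf_le1// ler1n.
  by rewrite [leRHS]/Num.norm/= mx_normrE; apply/bigmax_geP; right; exists (0, i).
have mh k : measurable_fun setT (h k).
  apply: measurable_funM => //; apply: measurable_funB => //.
  by apply: (measurableT_comp mf); exact: measurable_rv_translate.
have hh k x : `|h k x| <= C.
  rewrite /h normrM ger0_norm//.
  rewrite -ler_pdivlMl ?ltr0n// (le_trans (@derive_lipschitz _ _ f x v C _ df hD))//.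
  by rewrite mulrC ger0_norm ?invr_ge0.
have h0 k x : ~ rv_cube m M' x -> h k x = 0.
  by move=> xM; rewrite /h !f0 ?subr0 ?mulr0//; [exact: cubeS|exact: cubeT].
have inth k : \int[mu]_x h k x = 0.
  rewrite /h RintegralZl//; last first.
    apply: (@bounded_cube_integrable _ _ _ (C + C) M').
    - apply: measurable_funB => //.
      by apply: (measurableT_comp mf); exact: measurable_rv_translate.
    - by move=> x; rewrite (le_trans (ler_normB _ _))// lerD.
    - by move=> x xM; rewrite !f0 ?subr0//; [exact: cubeS|exact: cubeT].
  have it : mu.-integrable setT (EFin \o (fun x => f (x + k.+1%:R^-1 *: v))).
    apply: (@bounded_cube_integrable _ _ _ C M') => //.
      by apply: (measurableT_comp mf); exact: measurable_rv_translate.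
    by move=> x xM; rewrite !f0//; exact: cubeT.
  rewrite RintegralB//; last first.
    by apply: (@bounded_cube_integrable _ _ _ C M).
  by rewrite (Rintegral_translate mf it) subrr mulr0.
pose g : 'rV[R]_m -> \bar R := (cst C%:E) \_ (rv_cube m M').
have ig : mu.-integrable setT g.
  apply/integrable_restrict => //; first exact: measurable_rv_cube.
  rewrite setTI; apply: (@measurable_bounded_integrable _ _ _ mu (cst C)) => //.
  - exact: measurable_rv_cube.
  - exact: lebesgue_rv_cube_lty.
  - exact: bounded_cst.
have [] := @dominated_convergence _ _ _ mu setT measurableT
  (fun k => EFin \o h k) (EFin \o (fun x => 'D_v f x)) g.
- by move=> k; exact/measurable_EFinP.
- by apply/measurable_EFinP; exact: measurable_derive_rv.
- by apply: aeW => x _; apply: cvg_EFin; [exact: nearW|exact: cvg_derive_seq].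
- exact: ig.
- apply: aeW => x k _; rewrite /g patchE; case: ifPn => /=.
    by rewrite lee_fin => _; exact: hh.
  by rewrite notin_setE => /h0 ->; rewrite normr0.
move=> iD _ hc; rewrite /Rintegral.
suff -> : (\int[mu]_x ('D_v f x)%:E)%E = 0%E by [].
apply: (cvg_unique _ hc) => //.
rewrite (_ : [sequence _]_n = cst 0%E); first exact: cvg_cst.
apply/funext => k /=.
rewrite -[LHS]fineK; last first.
  apply: integrable_fin_num => //; apply: (@bounded_cube_integrable _ _ _ C M') => //.
  exact: h0.
by rewrite -[fine _]/(\int[mu]_x h k x) inth.
Qed.

(** * Smooth bump functions on boxes *)

Section flat_function.
Variable R : realType.

(** The function $t^{-k}e^{-1/t}$ continued by 0. The index makes the family stable under
    differentiation up to linear combinations: the derivative at index $k$ involves the indices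
    $k+1$ and $k+2$. *)
Definition flat (k : nat) (t : R) : R :=
  if 0 < t then t^-1 ^+ k * expR (- t^-1) else 0.

(** Keeping the term $u^{k+1}/(k+1)!$ of the exponential at $u=1/t$ leaves one spare factor $t$,
    which is what differentiability at 0 requires. *)
Lemma flat_le_lin k t : `|flat k t| <= k.+1`!%:R * `|t|.
Proof.
rewrite /flat; case: ifPn => t0; last by rewrite normr0 mulr_ge0.
have p0 : 0 <= t^-1 ^+ k * expR (- t^-1).
  by rewrite mulr_ge0 ?expR_ge0// exprn_ge0// invr_ge0 ltW.
rewrite (ger0_norm p0) (gtr0_norm t0) expRN ler_pdivrMr ?expR_gt0//.
have ti : 0 <= t^-1 by rewrite invr_ge0 ltW.
have := @expR_ge1Dxn R t^-1 k ti.
set E := expR _ => h.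
have h' : t^-1 ^+ k.+1 / k.+1`!%:R <= E.
  by apply: le_trans h; rewrite lerDr.
have -> : t^-1 ^+ k = k.+1`!%:R * t * (t^-1 ^+ k.+1 / k.+1`!%:R).
  have f0 : k.+1`!%:R != 0 :> R by rewrite pnatr_eq0 -lt0n fact_gt0.
  by rewrite exprS; field; rewrite f0 gt_eqF.
by rewrite ler_wpM2l// mulr_ge0// ltW.
Qed.

Lemma flat_ge0 k t : 0 <= flat k t.
Proof.
rewrite /flat; case: ifPn => // t0.
by rewrite mulr_ge0 ?expR_ge0// exprn_ge0// invr_ge0 ltW.
Qed.

Lemma flat0_le1 t : flat 0 t <= 1.
Proof.
rewrite /flat; case: ifPn => // t0.
by rewrite mul1r expR_le1 oppr_le0 invr_ge0 ltW.
Qed.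

Lemma flat0_cvg t : (fun k : nat => flat 0 (k.+1%:R * t)) @ \oo --> ((0 < t)%R%:R : R).
Proof.
case: (ltP 0 t) => t0; last first.
  rewrite (_ : (fun _ => _) = cst 0); first exact: cvg_cst.
  by apply/funext => k /=; rewrite /flat ltNge mulr_ge0_le0.
rewrite (_ : (fun _ => _) = (fun k : nat => expR (- (k.+1%:R^-1 * t^-1)))); last first.
  by apply/funext => k /=; rewrite /flat mulr_gt0// mul1r invfM.
have c : {for (0 : R), continuous (fun x : R => expR (- (x * t^-1)))}.
  apply: (@continuous_comp _ _ _ (fun x : R => - (x * t^-1)) expR); last exact: continuous_expR.
  by apply: continuousN; apply: mulrr_continuous.
have := cvg_comp _ _ (@cvg_harmonic R) c.
by rewrite mul0r oppr0 expR0.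
Qed.

(** At 0 the difference quotient of index $k$ is the function of index $k+1$, and the linear bound
    sends it to 0. For $t>0$ this is the product rule, and for $t<0$ the function is locally
    zero. *)
Lemma is_derive_flat (k : nat) (t : R) :
  is_derive t 1 (flat k) (- k%:R * flat k.+1 t + flat k.+2 t).
Proof.
case: (ltrgtP t 0) => [t0|t0|->].
- have -> : - k%:R * flat k.+1 t + flat k.+2 t = 0.
    by rewrite /flat ltNge (ltW t0)/= mulr0 addr0.
  apply: (@near_eq_is_derive _ _ _ (cst (0 : R))).
  near=> s; rewrite /flat ltNge (_ : s <= 0)//; apply/ltW.
  by near: s; exact: lt_nbhsl.
- apply: (@near_eq_is_derive _ _ _ (fun s : R => s^-1 ^+ k * expR (- s^-1))).
    near=> s; rewrite /flat (_ : 0 < s)//.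
    by near: s; exact: lt_nbhsr.
  have tn0 : t != 0 by rewrite gt_eqF.
  have dV : is_derive t 1 (fun s : R => s^-1) (- t ^- 2).
    have := @is_deriveV R id t 1 1 tn0 (is_derive_id _ _).
    by rewrite [_ *: _]mulr1.
  have dN : is_derive t 1 (fun s : R => - s^-1) (t ^- 2).
    by have := @is_deriveN _ _ _ _ _ _ _ dV; rewrite opprK.
  have dE := @is_derive1_comp R expR (fun s : R => - s^-1) t _ _ (is_derive_expR (- t^-1)) dN.
  have dX := @is_deriveX _ _ (fun s : R => s^-1) k t 1 _ dV.
  have := @is_deriveM _ _ _ _ _ _ _ _ dX dE.
  rewrite (_ : _ * _ = fun s : R => s^-1 ^+ k * expR (- s^-1)); last first.
    by apply/funext => s; rewrite !fctE.
  move=> /is_derive_eq; apply.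
  rewrite /flat t0 !fctE /= /GRing.scale/=.
  set E := expR _; rewrite -!exprVn; move: (t^-1) E => u E.
  case: k {dX} => [|k]; rewrite /= ?exprS.
    by rewrite !mulr0n; ring.
  by ring.
- have -> : - k%:R * flat k.+1 0 + flat k.+2 0 = 0.
    by rewrite /flat ltxx mulr0 addr0.
  have cv : (fun h : R => h^-1 *: ((flat k \o shift 0) (h *: 1) - flat k 0)) @ 0^' --> (0 : R).
    apply/cvgrPdist_le => e e0.
    have C0 : 0 < (k.+2`!%:R : R) by rewrite ltr0n fact_gt0.
    near=> h.
    rewrite sub0r normrN {2}/flat ltxx subr0 /= [h%:A]mulr1 addr0 /GRing.scale/=.
    have h0 : h != 0 by near: h; exact: nbhs_dnbhs_neq.
    have -> : h^-1 * flat k h = flat k.+1 h.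
      by rewrite /flat; case: ifPn => _; rewrite ?mulr0// mulrA -exprS.
    rewrite (le_trans (flat_le_lin _ _))// -ler_pdivlMl//.
    near: h; apply: nbhs_dnbhs.
    exists (k.+2`!%:R^-1 * e) => /=; first by rewrite mulr_gt0// invr_gt0.
    by move=> y /=; rewrite sub0r normrN => /ltW.
  split; first by apply/cvg_ex; exists 0.
  exact/cvg_lim.
Unshelve. all: by end_near. Qed.

End flat_function.

Lemma is_derive_lineP (R : realType) (V : normedModType R) (f : V -> R) (x v : V) (d : R) :
  is_derive (0 : R) (1 : R) (fun h => f (x + h *: v)) d -> is_derive x v f d.
Proof.
move=> [df dE].
have E : (fun h : R => h^-1 *: (((fun h => f (x + h *: v)) \o shift 0) (h *: 1) - f (x + 0 *: v)))
  = (fun h : R => h^-1 *: ((f \o shift x) (h *: v) - f x)).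
  apply/funext => h /=; rewrite [h%:A]mulr1 addr0 scale0r addr0.
  by rewrite (addrC x).
split; first by move: df; rewrite /derivable E.
by move: dE; rewrite /derive E.
Qed.

Section bump.
Variables (R : realType) (m : nat).
Implicit Types (f : 'rV[R]_m -> R) (x : 'rV[R]_m).

(* An algebra of functions stable under partial derivatives. *)
Inductive smooth_algebra : ('rV[R]_m -> R) -> Prop :=
| smooth_algebra_cst c : smooth_algebra (fun=> c)
| smooth_algebra_coord i : smooth_algebra (fun x => x 0 i)
| smooth_algebra_flat k a b i : smooth_algebra (fun x => flat k (a * x 0 i + b))
| smooth_algebraD f g : smooth_algebra f -> smooth_algebra g ->
    smooth_algebra (fun x => f x + g x)
| smooth_algebraM f g : smooth_algebra f -> smooth_algebra g ->
    smooth_algebra (fun x => f x * g x).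

Lemma smooth_algebra_continuous f : smooth_algebra f -> continuous f.
Proof.
elim => [c|i|k a b i|{}f g _ cf _ cg|{}f g _ cf _ cg] x.
- exact: cst_continuous.
- exact: coord_continuous.
- apply: (@continuous_comp _ _ _ (fun x : 'rV[R]_m => a * x 0 i + b) (@flat R k)).
    apply: continuousD; last exact: cst_continuous.
    apply: continuousM; first exact: cst_continuous.
    exact: coord_continuous.
  apply: differentiable_continuous; apply/derivable1_diffP.
  by have [] := @is_derive_flat R k (a * x 0 i + b).
- by apply: continuousD; [exact: cf|exact: cg].
- by apply: continuousM; [exact: cf|exact: cg].
Qed.

Lemma smooth_algebra_derive f (v : 'rV[R]_m) : smooth_algebra f ->
  exists2 f', smooth_algebra f' & forall x, is_derive x v f (f' x).
Proof.
elim => [c|i|k a b i|{}f g Af [f' Af' df] Ag [g' Ag' dg]|{}f g Af [f' Af' df] Ag [g' Ag' dg]].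
- by exists (fun=> 0); [exact: smooth_algebra_cst|move=> x; exact: is_derive_cst].
- exists (fun=> v 0 i); first exact: smooth_algebra_cst.
  move=> x; apply: is_derive_lineP.
  rewrite (_ : (fun _ => _) = (fun h : R => v 0 i * h + x 0 i)); last first.
    by apply/funext => h /=; rewrite !mxE addrC mulrC.
  have dl : is_derive (0 : R) (1 : R) (fun h : R => v 0 i * h) (v 0 i).
    have := @is_deriveZ _ _ _ (@id R) (v 0 i) (0 : R) (1 : R) _ (is_derive_id _ _).
    by rewrite [_ *: 1]mulr1.
  have := @is_deriveD _ _ _ _ (cst (x 0 i)) _ _ _ _ dl (is_derive_cst _ _ _).
  by rewrite addr0.
- exists (fun x => (- k%:R * flat k.+1 (a * x 0 i + b) + flat k.+2 (a * x 0 i + b)) * (a * v 0 i)).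
    apply: smooth_algebraM; last exact: smooth_algebra_cst.
    apply: smooth_algebraD; last exact: smooth_algebra_flat.
    by apply: smooth_algebraM; [exact: smooth_algebra_cst|exact: smooth_algebra_flat].
  move=> x; apply: is_derive_lineP.
  rewrite (_ : (fun _ => _) = @flat R k \o (fun h : R => (a * v 0 i) * h + (a * x 0 i + b))); last first.
    by apply/funext => h /=; rewrite !mxE; congr flat; ring.
  apply: is_derive1_comp.
    by rewrite mulr0 add0r; exact: is_derive_flat.
  have dl : is_derive (0 : R) (1 : R) (fun h : R => (a * v 0 i) * h) (a * v 0 i).
    have := @is_deriveZ _ _ _ (@id R) (a * v 0 i) (0 : R) (1 : R) _ (is_derive_id _ _).
    by rewrite [_ *: 1]mulr1.
  have := @is_deriveD _ _ _ _ (cst (a * x 0 i + b)) _ _ _ _ dl (is_derive_cst _ _ _).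
  by rewrite addr0.
- exists (fun x => f' x + g' x); first exact: smooth_algebraD.
  by move=> x; have := @is_deriveD _ _ _ _ _ _ _ _ _ (df x) (dg x).
- exists (fun x => f x * g' x + g x * f' x).
    by apply: smooth_algebraD; exact: smooth_algebraM.
  by move=> x; have := @is_deriveM _ _ _ _ _ _ _ _ (df x) (dg x).
Qed.

Lemma smooth_algebra_smooth f : smooth_algebra f -> smooth f.
Proof.
move=> Af s; have As : smooth_algebra (foldr (@partial R m) f s).
  elim: s => //= j s As; have [g Ag dg] := smooth_algebra_derive (delta_mx 0 j) As.
  rewrite (_ : partial j _ = g)//.
  by apply/funext => x; rewrite /partial; have [] := dg x.
split; first exact: smooth_algebra_continuous.
by move=> j x; have [g _ dg] := smooth_algebra_derive (delta_mx 0 j) As; have [] := dg x.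
Qed.

(** Each factor is positive exactly when the coordinate lies between [l i] and [u i]. Scaling the
    arguments by $k+1$ drives $e^{-1/s}$ to 1 there, so the bumps converge to the indicator of the
    open box while staying in $[0,1]$. *)
Definition bump (l u : 'I_m -> R) (k : nat) x : R :=
  \prod_i (flat 0 (k.+1%:R * (x 0 i - l i)) * flat 0 (k.+1%:R * (u i - x 0 i))).

Lemma bump_ge0 l u k x : 0 <= bump l u k x.
Proof. by apply: prodr_ge0 => i _; rewrite mulr_ge0// flat_ge0. Qed.

Lemma bump_le1 l u k x : bump l u k x <= 1.
Proof.
apply: prodr_ile1 => i _; rewrite mulr_ge0 ?flat_ge0//=.
by rewrite mulr_ile1 ?flat_ge0 ?flat0_le1.
Qed.

Lemma bump_smooth_algebra l u k : smooth_algebra (bump l u k).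
Proof.
rewrite /bump; elim: (index_enum _) => [|i s IH].
  by rewrite (_ : (fun=> _) = fun=> 1); [exact: smooth_algebra_cst|apply/funext => x; rewrite big_nil].
rewrite (_ : (fun=> _) = fun x : 'rV[R]_m => (flat 0 (k.+1%:R * x 0 i + - (k.+1%:R * l i)) *
  flat 0 ((- k.+1%:R) * x 0 i + k.+1%:R * u i)) *
  \prod_(i <- s) (flat 0 (k.+1%:R * (x 0 i - l i)) * flat 0 (k.+1%:R * (u i - x 0 i)))); last first.
  apply/funext => x; rewrite big_cons; congr (flat _ _ * flat _ _ * _).
    by rewrite mulrBr.
  by rewrite mulrBr mulNr addrC.
apply: smooth_algebraM => //.
by apply: smooth_algebraM; exact: smooth_algebra_flat.
Qed.

Lemma bump_cvg l u x :
  (fun k => bump l u k x) @ \oo --> (\1_(open_box l u) x : R).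
Proof.
have -> : \1_(open_box l u) x = \prod_i ((0 < x 0 i - l i)%R%:R * (0 < u i - x 0 i)%R%:R) :> R.
  rewrite indicE; case: (boolP (x \in _)) => [|].
    rewrite inE => /= xb; rewrite big1// => i _; rewrite !subr_gt0.
    by have /andP[-> ->] := xb i; rewrite mulr1.
  rewrite notin_setE /= => /existsNP[i] /negP.
  rewrite -[l i < _]subr_gt0 -[_ < u i]subr_gt0 negb_and => xi; apply/esym/eqP/prodf_eq0; exists i => //.
  by case/orP: xi => /negbTE ->; rewrite ?mulr0 ?mul0r.
apply: cvg_big; first exact: mul_continuous.
by move=> i _; apply: cvgM; exact: flat0_cvg.
Qed.

Lemma bump_neq0 l u k x : bump l u k x != 0 -> open_box l u x.
Proof.
move=> /prodf_neq0 h i; have := h i isT; rewrite mulf_eq0 negb_or /flat.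
rewrite !pmulr_rgt0// !subr_gt0.
by case: (l i < _) => /=; case: (_ < u i); rewrite /= ?eqxx ?andbF.
Qed.

Lemma bump_test_function (U : set 'rV[R]_m) l u k : closed_box l u `<=` U ->
  test_function U (bump l u k).
Proof.
move=> bU; have sub : closure [set x | bump l u k x != 0] `<=` closed_box l u.
  rewrite [X in _ `<=` X](closure_id _).1; last first.
    by apply: compact_closed; [exact: norm_hausdorff|exact: compact_closed_box].
  apply: closure_subset => x /= /bump_neq0 xb i.
  by have /andP[xi1 xi2] := xb i; rewrite !ltW.
split; first exact/smooth_algebra_smooth/bump_smooth_algebra.
- apply: subclosed_compact sub; first exact: closed_closure.
  exact: compact_closed_box.
- exact: subset_trans bU.
Qed.

End bump.

(** * The fundamental lemma of the calculus of variations *)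

Section fundamental_lemma.
Variables (R : realType) (m : nat).
Let mu := lebesgue_rv R m.

Lemma open_box_setI (l u l' u' : 'I_m -> R) :
  open_box l u `&` open_box l' u' =
  open_box (fun i => Num.max (l i) (l' i)) (fun i => Num.min (u i) (u' i)).
Proof.
apply/seteqP; split => x /=.
  move=> [h h'] i; rewrite gt_max lt_min.
  by have /andP[-> ->] := h i; have /andP[-> ->] := h' i.
by move=> h; split => i; have := h i; rewrite gt_max lt_min => /andP[/andP[? ?] /andP[? ?]]; apply/andP.
Qed.

(** Half-spaces $x_i>c$ generate the cylinders, and each is the union over $N$ of the boxes with
    side $(c,N)$ in direction $i$ and $(-N,N)$ in the others. *)
Lemma rv_measurable_open_box (A : set 'rV[R]_m) : measurable A ->
  <<s [set B | exists l u, B = @open_box R m l u] >> A.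
Proof.
set G := [set B | _].
apply: smallest_sub; first exact: smallest_sigma_algebra.
move=> _ [i [B [mB ->]]].
pose coord (x : g_sigma_algebraType G) : R := (x : 'rV[R]_m) 0 i.
have mc : measurable_fun setT coord.
  apply: (measurability _ (RGenOInfty.measurableE R)) => _ [_ [c ->] <-].
  rewrite setTI (_ : _ @^-1` _ = \bigcup_N
    (open_box (fun j => if j == i then c else - N%:R) (fun=> N%:R) : set (g_sigma_algebraType G))).
    apply: bigcupT_measurable => N; apply: sub_sigma_algebra.
    by do 2 eexists.
  apply/seteqP; split => x /=; rewrite /coord in_itv/= andbT.
    move=> cx; exists (Num.truncn (mx_norm (x : 'rV[R]_m))).+1 => // j.
    have : `|(x : 'rV[R]_m) 0 j| < (Num.truncn (mx_norm (x : 'rV[R]_m))).+1%:R.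
      apply: le_lt_trans (truncnS_gt _).
      by rewrite mx_normrE; apply/bigmax_geP; right; exists (0, j).
    rewrite ltr_norml => /andP[x1 x2]; rewrite x2 andbT.
    by case: eqP => // ->.
  by move=> [N _ /(_ i)]; rewrite eqxx => /andP[].
have := mc measurableT B mB.
by rewrite setTI.
Qed.

Lemma integrableM_bounded (D : set 'rV[R]_m) (f h : 'rV[R]_m -> R) (C : R) :
  measurable D -> mu.-integrable D (EFin \o f) -> measurable_fun D h ->
  (forall x, D x -> `|h x| <= C) -> mu.-integrable D (EFin \o (fun x => f x * h x)).
Proof.
move=> mD intf mh hC.
have := @integrableMl _ _ _ mu D mD (EFin \o f) h intf mh.
apply; exists C; split; [exact: num_real|move=> N CN x Dx /=].
by rewrite (le_trans (hC _ Dx))// ltW.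
Qed.

(** Dominated convergence with the bound $C|f|$. It serves twice: from bumps to indicators of boxes,
    and for increasing unions in a lambda-system. *)
Lemma Rintegral_cvg_bounded (D : set 'rV[R]_m) (f h : 'rV[R]_m -> R) (h_ : nat -> 'rV[R]_m -> R) (C : R) :
  measurable D -> mu.-integrable D (EFin \o f) -> (forall k, measurable_fun D (h_ k)) ->
  (forall k x, D x -> `|h_ k x| <= C) -> measurable_fun D h ->
  (forall x, D x -> (fun k => h_ k x) @ \oo --> h x) ->
  (forall k, \int[mu]_(x in D) (f x * h_ k x) = 0) ->
  \int[mu]_(x in D) (f x * h x) = 0.
Proof.
move=> mD intf mh_ hC mh cvgh int0.
have mf : measurable_fun D f by apply/measurable_EFinP; case/integrableP: intf.
have [] := @dominated_convergence _ _ _ mu D mD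
  (fun k => EFin \o (fun x => f x * h_ k x)) (EFin \o (fun x => f x * h x))
  (fun x => (`|f x| * C)%:E).
- by move=> k; apply/measurable_EFinP; exact: measurable_funM.
- by apply/measurable_EFinP; exact: measurable_funM.
- apply: aeW => x Dx; apply: cvg_EFin; first exact: nearW.
  by apply: cvgM; [exact: cvg_cst|exact: cvgh].
- apply: (@integrableM_bounded D (fun x => `|f x|) (cst C) `|C|) => //.
  exact: integrable_norm.
- by apply: aeW => x k Dx /=; rewrite lee_fin normrM ler_wpM2l// hC.
move=> _ _ hc; rewrite /Rintegral.
suff -> : (\int[mu]_(x in D) (f x * h x)%:E)%E = 0%E by [].
apply: (cvg_unique _ hc) => //.
rewrite (_ : [sequence _]_n = cst 0%E); first exact: cvg_cst.
apply/funext => k /=; rewrite -[LHS]fineK.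
  by rewrite -[fine _]/(\int[mu]_(x in D) (f x * h_ k x)) int0.
by apply: integrable_fin_num => //; apply: (@integrableM_bounded _ _ _ C) => // x; exact: hC.
Qed.

Variables (U : set 'rV[R]_m) (G : 'rV[R]_m -> R).
Hypotheses (oU : open U) (intG : mu.-integrable U (EFin \o G)).
Hypothesis G0 : forall phi, test_function U phi ->
  \int[mu]_(x in U) (G x * phi x) = 0.

Let mU : measurable U. Proof. exact: open_measurable_rv. Qed.

Lemma open_closed_box (l u : 'I_m -> R) : open_box l u `<=` closed_box l u.
Proof. by move=> x h i; have /andP[? ?] := h i; rewrite !ltW. Qed.

Let box_integral0 l u : closed_box l u `<=` U ->
  \int[mu]_(x in U) (G x * \1_(open_box l u) x) = 0.
Proof.
move=> bU; apply: (@Rintegral_cvg_bounded U G _ (fun k => bump l u k) 1) => //.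
- move=> k; apply: measurable_funTS; apply: continuous_measurable_rv.
  exact/smooth_algebra_continuous/bump_smooth_algebra.
- by move=> k x _; rewrite ger0_norm ?bump_le1 ?bump_ge0.
- by apply: measurable_indic; exact: measurable_open_box.
- by move=> x _; exact: bump_cvg.
- by move=> k; apply: G0; exact: bump_test_function.
Qed.

(** The argument runs inside one box, so that the whole space belongs to the lambda-system: its
    integral is that of [G] over the box, which vanishes. The generating boxes are stable under
    intersection, and cut by the given box they still have their closed box in [U]. *)
Let box_ae0 l u : closed_box l u `<=` U ->
  {ae mu, forall x, open_box l u x -> G x = 0}.
Proof.
move=> bU; set B := open_box l u.
have mB : measurable B by exact: measurable_open_box.
have BU : B `<=` U by apply: subset_trans bU; exact: open_closed_box.
have intB : mu.-integrable B (EFin \o G) by exact: integrableS intG.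
pose H := [set A : set 'rV[R]_m | measurable A /\ \int[mu]_(x in B) (G x * \1_A x) = 0].
have iB A : measurable A -> mu.-integrable B (EFin \o (fun x => G x * \1_A x)).
  move=> mA; apply: (@integrableM_bounded B G \1_A 1) => //.
  by move=> x _; rewrite indicE; case: (_ \in _); rewrite ?normr1 ?normr0.
have HU : measurable `<=` H.
  move=> A /rv_measurable_open_box; apply: lambda_system_subset => //.
  - move=> _ _ [l1 [u1 ->]] [l2 [u2 ->]]; rewrite open_box_setI.
    by do 2 eexists.
  - split => //.
    + split => //; under eq_Rintegral do rewrite indicT mulr1.
      have := box_integral0 bU.
      rewrite (_ : (fun=> _) = G \_ B); last first.
        by apply/funext => x; rewrite patchE indicE; case: (_ \in _); rewrite ?mulr1 ?mulr0.
      by rewrite -Rintegral_mkcondr setIidr.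
    + move=> A1 A2 A21 [mA1 h1] [mA2 h2]; split; first exact: measurableD.
      rewrite -[RHS](subrr 0) -{1}h1 -{1}h2 -RintegralB//; [|exact: iB|exact: iB].
      apply: eq_Rintegral => x _; rewrite -mulrBr; congr (_ * _).
      rewrite !indicE in_setD; case: (boolP (x \in A2)) => xA2.
        by rewrite andbF (_ : x \in A1) ?subrr// inE; apply: A21; apply/set_mem.
      by rewrite andbT subr0.
    + move=> F ndF HF; split; first by apply: bigcupT_measurable => k; have [] := HF k.
      apply: (@Rintegral_cvg_bounded B G _ (fun k => \1_(F k)) 1) => //.
      * by move=> k; apply: measurable_indic; have [] := HF k.
      * by move=> k x _; rewrite indicE; case: (_ \in _); rewrite ?normr1 ?normr0.
      * by apply: measurable_indic; apply: bigcupT_measurable => k; have [] := HF k.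
      * move=> x _; have [[k _ Fkx]|nF] := pselect ((\bigcup_k F k) x).
          apply: cvg_near_cst; exists k => // j /= kj.
          rewrite !indicE !mem_set//; first by exists k.
          by move: (ndF _ _ kj); rewrite subsetEset; apply.
        apply: cvg_near_cst; apply: nearW => k; rewrite !indicE !memNset//.
        by apply: contra_not nF => Fkx; exists k.
      * by move=> k; have [] := HF k.
  - move=> _ [l1 [u1 ->]]; split; first exact: measurable_open_box.
    have bU' : closed_box (fun i => Num.max (l i) (l1 i)) (fun i => Num.min (u i) (u1 i)) `<=` U.
      apply: subset_trans bU => x h i; have := h i.
      by rewrite ge_max le_min => /andP[/andP[-> _] /andP[-> _]].
    have := box_integral0 bU'; rewrite -open_box_setI -/B.
    have E (A' : set 'rV[R]_m) : (fun x => G x * \1_A' x) = G \_ A'.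
      by apply/funext => x; rewrite patchE indicE; case: (_ \in _); rewrite ?mulr1 ?mulr0.
    rewrite !E -!Rintegral_mkcondr setIA.
    by rewrite (setIidr BU).
have := @integral_ae_eq _ _ _ mu B mB (cst 0%E) (EFin \o G) intB (measurable_cst _).
have h E : E `<=` B -> measurable E ->
    (\int[mu]_(x in E) (EFin \o G) x = \int[mu]_(x in E) cst 0 x)%E.
  move=> EB mE; rewrite integral0.
  have [_] := HU _ mE.
  rewrite (_ : (fun=> _) = G \_ E); last first.
    by apply/funext => x; rewrite patchE indicE; case: (_ \in _); rewrite ?mulr1 ?mulr0.
  rewrite -Rintegral_mkcondr (setIidr EB) /Rintegral => h0.
  rewrite -[LHS]fineK ?h0//; apply: integrable_fin_num => //.
  exact: integrableS intB.
move=> /(_ h); apply: filterS => x /= + Bx => /(_ Bx) [].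
by [].
Qed.

(** Countably many rational boxes with closed box in [U] cover [U], and each contributes a null set
    of bad points. Naturals that code no box contribute the empty set. *)
Lemma fundamental_lemma : {ae mu, forall x, U x -> G x = 0}.
Proof.
pose N (n : nat) : set 'rV[R]_m := if (unpickle n : option ('rV[rat]_m * nat)) is Some p then
  [set x | closed_box (rat_lo R p) (rat_hi R p) `<=` U /\ open_box (rat_lo R p) (rat_hi R p) x /\ G x <> 0]
  else set0.
apply: (@negligibleS _ _ _ _ (\bigcup_n N n)).
  move=> x /= /not_implyP[Ux Gx]; have [p px pU] := open_rat_box oU Ux.
  by exists (pickle p) => //; rewrite /N pickleK.
apply: negligible_bigcup => n; rewrite /N; case: (unpickle n) => [p|]; last exact: negligible_set0.
have [pU|npU] := pselect (closed_box (rat_lo R p) (rat_hi R p) `<=` U); last first.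
  rewrite (_ : [set _ | _] = set0); first exact: negligible_set0.
  by rewrite -subset0 => x [].
apply: negligibleS (box_ae0 pU) => x /= [_ [xp Gx]].
by apply/not_implyP.
Qed.

End fundamental_lemma.

(** * Weak gradients where the function is a polynomial *)

Section weak_gradient_of_polynomials.
Variables (R : realType) (m : nat).
Let mu := lebesgue_rv R m.
Implicit Types (f q phi : 'rV[R]_m -> R) (U : set 'rV[R]_m).

Lemma smooth_algebra_sum (I : Type) (s : seq I) (F : I -> 'rV[R]_m -> R) :
  (forall i, smooth_algebra (F i)) -> smooth_algebra (fun x => \sum_(i <- s) F i x).
Proof.
move=> AF; elim: s => [|i s IH].
  rewrite (_ : (fun=> _) = fun=> 0); first exact: smooth_algebra_cst.
  by apply/funext => x; rewrite big_nil.
rewrite (_ : (fun=> _) = fun x => F i x + \sum_(i <- s) F i x); first exact: smooth_algebraD.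
by apply/funext => x; rewrite big_cons.
Qed.

Lemma smooth_algebra_prod (I : Type) (s : seq I) (F : I -> 'rV[R]_m -> R) :
  (forall i, smooth_algebra (F i)) -> smooth_algebra (fun x => \prod_(i <- s) F i x).
Proof.
move=> AF; elim: s => [|i s IH].
  rewrite (_ : (fun=> _) = fun=> 1); first exact: smooth_algebra_cst.
  by apply/funext => x; rewrite big_nil.
rewrite (_ : (fun=> _) = fun x => F i x * \prod_(i <- s) F i x); first exact: smooth_algebraM.
by apply/funext => x; rewrite big_cons.
Qed.

Lemma smooth_algebra_meval (q : mpoly.mpoly m R) :
  smooth_algebra (fun x => mpoly.meval (fun j => x 0 j) q).
Proof.
under eq_fun do rewrite mpoly.mevalE.
apply: smooth_algebra_sum => k; apply: smooth_algebraM; first exact: smooth_algebra_cst.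
apply: smooth_algebra_prod => i; elim: (mpoly.fun_of_multinom k i) => [|d IH].
  exact: smooth_algebra_cst.
rewrite (_ : (fun=> _) = fun x : 'rV[R]_m => x 0 i * x 0 i ^+ d).
  by apply: smooth_algebraM => //; exact: smooth_algebra_coord.
by apply/funext => x; rewrite exprS.
Qed.

Lemma continuous_bounded_cube f M : continuous f ->
  exists C, forall x, rv_cube m M x -> `|f x| <= C.
Proof.
move=> cf.
have cK : compact (rv_cube m M).
  rewrite (_ : rv_cube _ _ = closed_box (fun=> - M) (fun=> M)); first exact: compact_closed_box.
  by apply/seteqP; split => x h i; have := h i; rewrite /= in_itv.
have /compact_bounded [C [_ hC]] : compact (f @` rv_cube m M).
  by apply: continuous_compact => //; exact: continuous_subspaceT.
exists (C + 1) => x Kx; apply: hC; first by rewrite ltrDl.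
by exists x.
Qed.

Lemma bounded_set_cube (A : set 'rV[R]_m) : bounded_set A ->
  exists M, A `<=` rv_cube m M.
Proof.
move=> [M [_ hM]]; exists (M + 1) => x Ax i /=.
rewrite in_itv/= -ler_norml (le_trans _ (hM (M + 1) _ x Ax)) ?ltrDl//.
by rewrite [leRHS]/Num.norm/= mx_normrE; apply/bigmax_geP; right; exists (0, i).
Qed.

(** On a set of finite measure, $|f|\le 1+f^2$ is enough. *)
Lemma L2_integrable (D : set 'rV[R]_m) f : measurable D -> (mu D < +oo)%E ->
  measurable_fun D f -> mu.-integrable D (fun x => (f x ^+ 2)%:E) ->
  mu.-integrable D (EFin \o f).
Proof.
move=> mD Dfin mf if2.
have i1 : mu.-integrable D (EFin \o cst 1).
  by apply: measurable_bounded_integrable => //; exact: bounded_cst.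
apply: le_integrable (integrableD _ i1 if2) => //; first exact/measurable_EFinP.
move=> x Dx /=; rewrite lee_fin [leRHS]ger0_norm; last by rewrite addr_ge0 ?sqr_ge0.
have : 0 <= (1 - `|f x|) ^+ 2 by exact: sqr_ge0.
rewrite sqrrB expr1n mul1r real_normK ?num_real// => h.
have := sqr_ge0 (f x); have := normr_ge0 (f x); lra.
Qed.

(** What integration by parts uses of a test function: one bound for [phi] and its partial
    derivative, and the vanishing of both off a cube and off [U]. Off the support [phi] is zero in a
    neighbourhood, hence so is its derivative. *)
Lemma test_functionP U phi j : test_function U phi ->
  exists C M : R, [/\ continuous phi, (forall x, derivable phi x (delta_mx 0 j)),
    continuous (partial j phi),
    (forall x, `|phi x| <= C /\ `|partial j phi x| <= C) &
    (forall x, ~ rv_cube m M x \/ ~ U x -> phi x = 0 /\ partial j phi x = 0)].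
Proof.
move=> [sphi cphi suppU].
have [c0 d0] := sphi [::]; have [c1 _] := sphi [:: j]; rewrite /= in c0 c1 d0.
set S := closure _ in cphi suppU.
have out x : ~ S x -> phi x = 0 /\ partial j phi x = 0.
  move=> nSx.
  have near0 : \forall y \near x, phi y = cst 0 y.
    have : nbhs x (~` S).
      by apply: open_nbhs_nbhs; split => //; apply: closed_openC; exact: closed_closure.
    apply: filterS => y nSy; apply/eqP; apply: contraT => py.
    by exfalso; apply: nSy; exact: subset_closure.
  split; first exact: (nbhs_singleton near0).
  rewrite /partial (near_eq_derive _ near0) ?derive_cst//.
have [M SM] := bounded_set_cube (compact_bounded cphi).
have [C1 hC1] := @continuous_bounded_cube phi M c0.
have [C2 hC2] := @continuous_bounded_cube (partial j phi) M c1.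
exists (Num.max 0 (Num.max C1 C2)), M; split => //.
- move=> x; have [Sx|/out[-> ->]] := pselect (S x); last first.
    by rewrite normr0 le_max lexx.
  by split; rewrite !le_max ?(hC1 _ (SM _ Sx)) ?(hC2 _ (SM _ Sx)) !orbT.
- by move=> x [h|h]; apply: out; apply: contra_not h => Sx; [exact: SM|exact: suppU].
Qed.

Lemma Rintegral_sub0 (D U : set 'rV[R]_m) f : U `<=` D ->
  (forall x, ~ U x -> f x = 0) ->
  \int[mu]_(x in D) f x = \int[mu]_(x in U) f x.
Proof.
move=> UD f0; rewrite -[in RHS](setIidr UD) Rintegral_mkcondr.
apply: eq_Rintegral => x _; rewrite patchE; case: ifPn => //.
by rewrite notin_setE => /f0.
Qed.

(** The product of [q] and [phi] is supported in a cube, so its partial derivative has integral zero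
    over the whole space. The factors [phi] and [partial j phi] vanish off [U], which brings the two
    halves back to integrals over [U]. *)
Lemma Rintegral_poly_by_parts U q phi j : test_function U phi -> smooth_algebra q ->
  \int[mu]_(x in U) (q x * partial j phi x) =
  - \int[mu]_(x in U) (partial j q x * phi x).
Proof.
move=> tphi Aq.
have [C [M [c0 d0 c1 hC h0]]] := test_functionP j tphi.
have [q' Aq' dq] := smooth_algebra_derive (delta_mx 0 j) Aq.
have qE : partial j q = q' by apply/funext => x; rewrite /partial; have [] := dq x.
have cq := smooth_algebra_continuous Aq.
have cq' := smooth_algebra_continuous Aq'.
have [C1 hC1] := @continuous_bounded_cube q M cq.
have [C2 hC2] := @continuous_bounded_cube q' M cq'.
pose psi x := q x * phi x.
have dpsi x : is_derive x (delta_mx 0 j) psi (q x * partial j phi x + phi x * q' x).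
  by have := @is_deriveM _ _ _ _ _ _ _ _ (dq x) (derivableP (d0 x)).
have psiE x : 'D_(delta_mx 0 j) psi x = q x * partial j phi x + phi x * q' x.
  by have [] := dpsi x.
pose K := `|C1| * C + C * `|C2|.
have C0 : 0 <= C by have [h _] := hC 0; exact: le_trans h.
have K0 : 0 <= K by rewrite addr_ge0// mulr_ge0.
have bq x g : rv_cube m M x -> `|g| <= C -> `|q x * g| <= `|C1| * C.
  by move=> xM gC; rewrite normrM ler_pM// (le_trans (hC1 _ xM))// ler_norm.
have bq' x g : rv_cube m M x -> `|g| <= C -> `|g * q' x| <= C * `|C2|.
  by move=> xM gC; rewrite normrM ler_pM// (le_trans (hC2 _ xM))// ler_norm.
have i1 : mu.-integrable setT (EFin \o (fun x => q x * partial j phi x)).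
  apply: (@bounded_cube_integrable _ _ _ K M).
  - by apply: continuous_measurable_rv => x; apply: continuousM; [exact: cq|exact: c1].
  - move=> x; have [xM|xM] := pselect (rv_cube m M x).
      rewrite (le_trans (bq _ _ xM (hC x).2))//.
      by rewrite lerDl mulr_ge0.
    by have [_ ->] := h0 x (or_introl xM); rewrite mulr0 normr0.
  - by move=> x xM; have [_ ->] := h0 x (or_introl xM); rewrite mulr0.
have i2 : mu.-integrable setT (EFin \o (fun x => phi x * q' x)).
  apply: (@bounded_cube_integrable _ _ _ K M).
  - by apply: continuous_measurable_rv => x; apply: continuousM; [exact: c0|exact: cq'].
  - move=> x; have [xM|xM] := pselect (rv_cube m M x).
      rewrite (le_trans (bq' _ _ xM (hC x).1))//.
      by rewrite lerDr mulr_ge0.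
    by have [-> _] := h0 x (or_introl xM); rewrite mul0r normr0.
  - by move=> x xM; have [-> _] := h0 x (or_introl xM); rewrite mul0r.
have : \int[mu]_x 'D_(delta_mx 0 j) psi x = 0.
  apply: (@Rintegral_derive0 _ _ psi _ K M).
  - by apply: continuous_measurable_rv => x; apply: continuousM; [exact: cq|exact: c0].
  - by move=> x; have [] := dpsi x.
  - move=> x; have [xM|xM] := pselect (rv_cube m M x).
      rewrite (le_trans (bq _ _ xM (hC x).1))//.
      by rewrite lerDl mulr_ge0.
    by rewrite /psi; have [-> _] := h0 x (or_introl xM); rewrite mulr0 normr0.
  - move=> x; rewrite psiE; have [xM|xM] := pselect (rv_cube m M x).
      rewrite (le_trans (ler_normD _ _))//.
      by rewrite lerD ?bq ?bq' ?(hC x).1 ?(hC x).2.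
    have [-> ->] := h0 x (or_introl xM).
    by rewrite mulr0 mul0r addr0 normr0.
  - by move=> x xM; rewrite /psi; have [-> _] := h0 x (or_introl xM); rewrite mulr0.
under eq_Rintegral do rewrite psiE.
rewrite RintegralD// qE.
rewrite (@Rintegral_sub0 setT U)// => [|x /(or_intror) /h0[_ ->]]; last by rewrite mulr0.
rewrite (@Rintegral_sub0 setT U (fun x => phi x * q' x))// => [|x /(or_intror) /h0[-> _]]; last by rewrite mul0r.
move=> /eqP; rewrite addr_eq0 => /eqP ->.
by under eq_Rintegral do rewrite mulrC.
Qed.

(** Test functions supported in [U] are admissible for [Omega] and see [v] only where it equals [q].
    Comparing the weak gradient with integration by parts for [q] makes the difference of the two
    derivatives orthogonal to all of them. *)
Lemma weak_gradient_ae n (Omega U : set 'rV[R]_m) (v : 'rV[R]_m -> 'rV[R]_n)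
    (G : 'rV[R]_m -> 'M[R]_(n, m)) q i j :
  bounded_set Omega -> open Omega -> open U -> U `<=` Omega ->
  weak_gradient Omega v G -> smooth_algebra q ->
  (forall x, U x -> v x 0 i = q x) ->
  {ae mu, forall x, U x -> G x i j = partial j q x}.
Proof.
move=> bO oO oU UO [LG wG] Aq vq.
have mO : measurable Omega by exact: open_measurable_rv.
have mU : measurable U by exact: open_measurable_rv.
have Ofin : (mu Omega < +oo)%E by exact: bounded_lebesgue_rv_lty.
have Ufin : (mu U < +oo)%E.
  by apply: le_lt_trans Ofin; apply: le_measure; rewrite ?inE.
have [q' Aq' dq] := smooth_algebra_derive (delta_mx 0 j) Aq.
have qE : partial j q = q' by apply/funext => x; rewrite /partial; have [] := dq x.
have [M OM] := bounded_set_cube bO.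
have [C hC] := @continuous_bounded_cube q' M (smooth_algebra_continuous Aq').
have mq' : measurable_fun U q'.
  by apply: measurable_funTS; exact: continuous_measurable_rv (smooth_algebra_continuous Aq').
have iq' : mu.-integrable U (EFin \o q').
  apply: measurable_bounded_integrable => //.
  exists C; split; [exact: num_real|move=> N CN x Ux /=].
  by rewrite (le_trans (hC x _)) ?(ltW CN)//; apply: OM; exact: UO.
have iG : mu.-integrable U (EFin \o (fun x => G x i j)).
  have [mG iG2] := LG i j.
  by apply: (integrableS mO) => //; exact: L2_integrable.
suff : {ae mu, forall x, U x -> G x i j - q' x = 0}.
  by apply: filterS => x h Ux; rewrite qE; apply/eqP; rewrite -subr_eq0 h.
apply: fundamental_lemma => //.
  have := integrableB mU iG iq'.
  by apply: eq_ind; congr (integrable _ _ _).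
move=> phi tphi.
have [C' [M' [c0 d0 c1 hC' h0]]] := test_functionP j tphi.
have tO : test_function Omega phi.
  by case: tphi => s1 s2 s3; split => //; exact: subset_trans UO.
have mphi : measurable_fun U phi.
  by apply: measurable_funTS; exact: continuous_measurable_rv.
under eq_Rintegral do rewrite mulrBl.
rewrite RintegralB//; last 2 first.
- by apply: (integrableM_bounded (C := C')) => // x _; have [] := hC' x.
- by apply: (integrableM_bounded (C := C')) => // x _; have [] := hC' x.
have := wG phi tO i j.
rewrite (@Rintegral_sub0 Omega U)//; last first.
  by move=> x nU; have [_ ->] := h0 x (or_intror nU); rewrite mulr0.
rewrite (@Rintegral_sub0 Omega U (fun x => G x i j * phi x))//; last first.
  by move=> x nU; have [-> _] := h0 x (or_intror nU); rewrite mulr0.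
rewrite (@eq_Rintegral _ _ _ _ U (fun x => q x * partial j phi x)); last first.
  by move=> x /set_mem Ux; rewrite vq.
rewrite (Rintegral_poly_by_parts j tphi Aq) qE => /oppr_inj <-.
exact: subrr.
Qed.

End weak_gradient_of_polynomials.

(** * Simplices: open interiors and null boundaries *)

Section simplices.
Variables (R : realType) (m : nat).
Let mu := lebesgue_rv R m.

(** A nonconstant affine form vanishes on a hyperplane, and a nonzero constant vanishes nowhere. *)
Lemma affine_null (b : 'I_m -> R) (a : R) : (exists j, b j != 0) \/ a != 0 ->
  mu [set x : 'rV[R]_m | \sum_j x 0 j * b j + a = 0] = 0%E.
Proof.
move=> h; have [hb|nb] := pselect (exists j, b j != 0).
  rewrite (_ : [set _ | _] = [set x : 'rV[R]_m | \sum_j x 0 j * b j = - a]).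
    exact: hyperplane_null.
  by apply/seteqP; split => x /=; [move/eqP; rewrite addr_eq0 => /eqP|move=> ->; rewrite addNr].
have {}h : a != 0 by case: h.
rewrite (_ : [set _ | _] = set0) ?measure0// -subset0 => x /=.
rewrite big1 ?add0r => [/eqP|j _]; first by rewrite (negbTE h).
by apply/eqP; rewrite mulf_eq0; apply/orP; right; apply: contraT => bj; exfalso; apply: nb; exists j.
Qed.

(** The matrix [M] holds the vertices in homogeneous coordinates, and its inverse gives the
    barycentric coordinates as affine functions of [x]. [Ko] is where all of them are positive; the
    rest of the simplex lies in the zero sets of single coordinates. *)
Lemma simplex_interior (K : 'M[R]_(m.+1, m)) : affinely_independent K ->
  exists Ko : set 'rV[R]_m,
    [/\ open Ko, Ko `<=` conv_hull K & mu.-negligible (conv_hull K `\` Ko)].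
Proof.
rewrite /affinely_independent; set M := row_mx _ _ => rfM.
have uM : (M : 'M[R]_(1 + m)) \in unitmx by rewrite -row_free_unit.
pose N : 'M[R]_(1 + m) := invmx (M : 'M[R]_(1 + m)).
pose bary (x : 'rV[R]_m) : 'rV[R]_(1 + m) := row_mx 1%:M x *m N.
have baryM x : bary x *m (M : 'M[R]_(1 + m)) = row_mx 1%:M x.
  by rewrite /bary -mulmxA mulVmx// mulmx1.
pose a i : R := N (lshift m 0) i.
pose b i j : R := N (rshift 1 j) i.
have baryE x i : bary x 0 i = \sum_j x 0 j * b i j + a i.
  rewrite /bary mxE big_split_ord/= big_ord1 row_mxEl mxE mulr1n mul1r addrC.
  by congr (_ + _); apply: eq_bigr => j _; rewrite row_mxEr.
have hull_bary x (c : 'rV[R]_m.+1) : (\sum_i c 0 i = 1) -> x = c *m K -> bary x = (c : 'rV[R]_(1 + m)).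
  move=> c1 xE; have -> : bary x = (c : 'rV[R]_(1 + m)) *m M *m N.
    rewrite /bary; congr (_ *m _); rewrite [RHS](@mul_mx_row _ 1 (1 + m) 1 m).
    congr row_mx; last by [].
    apply/matrixP => i j; rewrite !ord1 !mxE/= mulr1n -[LHS]c1.
    by apply: eq_bigr => k _; rewrite mxE mulr1.
  by rewrite -mulmxA mulmxV// mulmx1.
pose Ko := [set x : 'rV[R]_m | forall i, 0 < bary x 0 i].
have cb i : continuous (fun x : 'rV[R]_m => bary x 0 i).
  rewrite (_ : (fun _ => _) = fun x : 'rV[R]_m => \sum_j x 0 j * b i j + a i); last first.
    by apply/funext => x; exact: baryE.
  apply: smooth_algebra_continuous; apply: smooth_algebraD; last exact: smooth_algebra_cst.
  apply: smooth_algebra_sum => j; apply: smooth_algebraM; last exact: smooth_algebra_cst.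
  exact: smooth_algebra_coord.
exists Ko; split.
- rewrite openE => x Kx; rewrite /interior /Ko.
  have h i : \forall y \near x, 0 < bary y 0 i.
    by have := cb i x [set t | 0 < t]; apply; exact: lt_nbhsr (Kx i).
  exact: (@filter_forall _ _ (fun i (y : 'rV[R]_m) => 0 < bary y 0 i) (nbhs x) (nbhs_filter x) h).
- move=> x Kx; exists (bary x : 'rV[R]_m.+1) => /=; last first.
    have := baryM x; rewrite [X in X = _ -> _](@mul_mx_row _ 1 (1 + m) 1 m).
    by case/eq_row_mx.
  split; first by move=> i; exact/ltW/Kx.
  have := baryM x; rewrite [X in X = _ -> _](@mul_mx_row _ 1 (1 + m) 1 m).
  case/eq_row_mx => /matrixP/(_ 0 0); rewrite !mxE/= mulr1n => h _; rewrite -[RHS]h.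
  by apply: eq_bigr => k _; rewrite [X in _ * X]mxE mulr1.
(* Zero sets indexed by all naturals, empty beyond the last coordinate, to fit the countable union
   of null sets. *)
- pose Z (k : nat) := if insub k is Some i then
    [set x : 'rV[R]_m | \sum_j x 0 j * b i j + a i = 0] else set0.
  apply: (@negligibleS _ _ _ _ (\bigcup_k Z k)).
    move=> x [[c [/= c0 c1] xE] nKx].
    have bE := hull_bary x c c1 (esym xE).
    have /existsNP[i /negP] := nKx; rewrite -leNgt => ci.
    exists i => //; rewrite /Z insubT ?ltn_ord// => ?; rewrite /= (_ : Sub _ _ = i) -?baryE; last exact/val_inj.
    apply/eqP.
    by rewrite eq_le ci bE c0.
  have mZ i : measurable [set x : 'rV[R]_m | \sum_j x 0 j * b i j + a i = 0].
    rewrite (_ : [set _ | _] = (fun x : 'rV[R]_m => bary x 0 i) @^-1` [set 0]); last first.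
      by apply/seteqP; split => x /=; rewrite baryE.
    rewrite -[X in measurable X]setTI; apply: continuous_measurable_rv => //.
  have nZ i : mu [set x : 'rV[R]_m | \sum_j x 0 j * b i j + a i = 0] = 0%E.
    apply: affine_null.
    (* The entries of column [i] are the coefficients of the [i]-th barycentric coordinate; a zero
       column would contradict the invertibility of [M]. *)
    have : col i N != 0.
      apply/eqP => N0; have := congr1 (mulmx (M : 'M[R]_(1 + m))) N0.
      rewrite colE mulmxA (mulmxV uM) mul1mx mulmx0 => /matrixP/(_ i 0).
      by rewrite !mxE !eqxx => /eqP; rewrite oner_eq0.
    move=> /eqP cN; apply: contrapT => /not_orP[nb /negP]; rewrite negbK => /eqP a0.
    apply: cN; apply/matrixP => k l; rewrite !mxE; case: (split_ordP k) => k' ->.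
      by rewrite ord1.
    by apply/eqP; apply: contraT => bk; exfalso; apply: nb; exists k'.
  apply: negligible_bigcup => k; rewrite /Z; case: insubP => [i _ _|_]; last exact: negligible_set0.
  by exists [set x : 'rV[R]_m | \sum_j x 0 j * b i j + a i = 0]; split; [exact: mZ|exact: nZ|].
Qed.

End simplices.

(** * Nonempty open sets have positive measure *)

Section positive_measure.
Variables (R : realType) (m : nat).
Let mu := lebesgue_rv R m.

Lemma lebesgue_rv_cube_gt0 (M : R) : 0 < M -> (0 < lebesgue_rv R m (rv_cube m M))%E.
Proof.
move=> M0; rewrite /mu; elim: m => [|k IH].
  rewrite /= diracE mem_set ?lte_fin//.
  by case.
rewrite /= /lebesgue_cons /pushforward.
rewrite (_ : _ @^-1` _ = `[- M, M]%classic `*` rv_cube k M); last first.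
  apply/seteqP; split => -[x y]; rewrite /rv_cons /=.
    move=> h; split => [|i].
      by have := h (@lshift 1 k 0); rewrite (row_mxEl x%:M y) mxE mulr1n.
    by have := h (rshift 1 i); rewrite (row_mxEr x%:M y).
  move=> [hx hy] i; case: (split_ordP (i : 'I_(1 + k))) => j ->.
    by rewrite (row_mxEl x%:M y) ord1 mxE mulr1n.
  by rewrite (row_mxEr x%:M y).
rewrite product_measure1E//; last exact: measurable_rv_cube.
set I : set R := `[- M, M]%classic.
have h : (0 < lebesgue_measure I)%E.
  rewrite /I lebesgue_measure_itv/= lte_fin (lt_trans _ M0) ?oppr_lt0//.
  by rewrite -EFinB lte_fin opprK addr_gt0.
exact: mule_gt0.
Qed.

Lemma open_not_negligible (U : set 'rV[R]_m) : open U -> U !=set0 -> ~ mu.-negligible U.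
Proof.
move=> oU [x Ux] [A [mA A0 UA]].
have /nbhs_ballP[e /= e0 xeU] : nbhs x U by exact: open_nbhs_nbhs.
have sub : rv_cube m (e / 2) `<=` (fun y => y + x) @^-1` A.
  move=> y hy; apply: UA; apply: xeU; rewrite mx_norm_ball /ball_/=.
  rewrite [ltLHS]mx_normrE; apply/bigmax_ltP; split => // -[i j] _ /=.
  rewrite ord1 !mxE opprD addrCA subrr addr0 normrN.
  have := hy j; rewrite /= in_itv/= -ler_norml => /le_lt_trans; apply.
  by rewrite ltr_pdivrMr// ltr_pMr// ltr1n.
have := lebesgue_rv_cube_gt0 (divr_gt0 e0 (ltr0n R 2)).
rewrite ltNge => /negP; apply; rewrite -A0 -[leRHS](lebesgue_rv_translate x mA).
apply: le_measure => //; rewrite inE; first exact: measurable_rv_cube.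
by rewrite -[X in measurable X]setTI; exact: measurable_rv_translate.
Qed.

(** Near a point of the closure where [f] is nonzero, [f] stays nonzero on a nonempty open part of
    [Omega], which is not negligible. This is what turns a vanishing $L^2$ norm into an equality of
    functions. *)
Lemma ae0_closure n (Omega : set 'rV[R]_m) (f : 'rV[R]_m -> 'rV[R]_n) :
  open Omega -> {within closure Omega, continuous f} ->
  {ae mu, forall x, Omega x -> f x = 0} -> forall x, closure Omega x -> f x = 0.
Proof.
move=> oO cf f0 x clx; apply/eqP; apply: contraT => fx0; exfalso.
have : nbhs (f x) (~` [set 0]).
  apply: open_nbhs_nbhs; split; last exact/eqP.
  apply: closed_openC; apply: accessible_closed_set1.
  by apply: hausdorff_accessible; exact: norm_hausdorff.
move=> /(cf x); rewrite /nbhs/= -nbhs_subspace_in// => Vx.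
pose W := [set y | closure Omega y -> (~` [set 0]) (f y)]°.
have oW : open W by exact: open_interior.
have Wx : W x by exact: Vx.
have [y [Oy Wy]] := clx W (open_nbhs_nbhs (conj oW Wx)).
apply: (@open_not_negligible (W `&` Omega)); [exact: openI|by exists y|].
apply: negligibleS f0 => z [Wz Oz] /= /(_ Oz) fz0.
by have := interior_subset Wz; move=> /(_ (subset_closure Oz)); apply.
Qed.

End positive_measure.

Lemma integrable_scale (d : measure_display) (T : measurableType d) (R : realType)
    (mu : {measure set T -> \bar R}) (D : set T) (f : T -> R) (c : R) :
  measurable D -> mu.-integrable D (EFin \o f) ->
  mu.-integrable D (EFin \o (fun x => c * f x)).
Proof.
move=> mD intf; have := integrableZl mD c intf.
by apply: eq_integrable => // x _; rewrite /= EFinM.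
Qed.

(** * The finite element space and its classical gradients *)

Section finite_elements.
Variables (R : realType) (m n : nat) (Omega : set 'rV[R]_m).
Variables (Th : seq 'M[R]_(m.+1, m)) (r : nat).
Hypotheses (oO : open Omega) (bO : bounded_set Omega).
Hypothesis cover : closure Omega = \bigcup_(K in [set` Th]) conv_hull K.
Hypothesis indep : {in Th, forall K, affinely_independent K}.
Let mu := lebesgue_rv R m.
Let Vh := @fe_space R m Omega Th r n.
Implicit Types (v w : 'rV[R]_m -> 'rV[R]_n) (E : nat -> set 'rV[R]_m).

(** Determined by the values of [v], hence linear in [v] wherever the components are derivable; the
    chosen representative [grad] offers neither at a given point. *)
Definition cgrad v (x : 'rV[R]_m) : 'M[R]_(n, m) :=
  \matrix_(i, j) partial j (fun y => v y 0 i) x.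

(** The pieces stand for the open simplices cut with [Omega]. Indexing by naturals with an empty
    tail allows countable unions of null sets and, for bounds, a maximum over finitely many
    pieces. *)
Definition core E : Prop :=
  [/\ forall k, open (E k), forall k, E k `<=` Omega,
      mu.-negligible (Omega `\` \bigcup_k E k),
      exists N, forall k, (N <= k)%N -> E k = set0 &
      forall k, E k !=set0 -> exists2 K, K \in Th & E k `<=` conv_hull K].

Lemma core_exists : exists E, core E.
Proof.
have h (K : 'M[R]_(m.+1, m)) : exists Ko : set 'rV[R]_m, K \in Th ->
    [/\ open Ko, Ko `<=` conv_hull K & mu.-negligible (conv_hull K `\` Ko)].
  have [KT|KT] := boolP (K \in Th); last by exists set0.
  by have [Ko hKo] := simplex_interior (indep KT); exists Ko.
have [Ko hKo] := choice h.
pose E k := if (k < size Th)%N then Omega `&` Ko (nth 0 Th k) else set0.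
exists E; split.
- move=> k; rewrite /E; case: ifPn => [kT|_]; last exact: open0.
  by apply: openI => //; have [] := hKo _ (mem_nth 0 kT).
- by move=> k x; rewrite /E; case: ifPn => // _ [].
- pose Z k := if (k < size Th)%N then conv_hull (nth 0 Th k) `\` Ko (nth 0 Th k) else set0.
  apply: (@negligibleS _ _ _ _ (\bigcup_k Z k)).
    move=> x [Ox nEx]; have : closure Omega x by exact: subset_closure.
    rewrite cover => -[K /= KT Kx]; exists (index K Th) => //.
    rewrite /Z index_mem KT nth_index//; split => // Kox; apply: nEx.
    by exists (index K Th) => //; rewrite /E index_mem KT nth_index.
  apply: negligible_bigcup => k; rewrite /Z; case: ifPn => [kT|_]; last exact: negligible_set0.
  by have [] := hKo _ (mem_nth 0 kT).
- by exists (size Th) => k kT; rewrite /E ltnNge kT.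
- move=> k [x]; rewrite /E; case: ifPn => // kT _; exists (nth 0 Th k); first exact: mem_nth.
  by move=> y [_]; have [_ + _] := hKo _ (mem_nth 0 kT); apply.
Qed.

Lemma fe_L2 v : Vh v -> L2 Omega v. Proof. by case => _ []. Qed.

Lemma fe_weak_gradient v : Vh v -> weak_gradient Omega v (grad Omega v).
Proof. by case => _ [_ [G wG]] _; rewrite /grad; exact: (@xgetPex _ _ [set G | weak_gradient Omega v G] (ex_intro _ G wG)). Qed.

Let mO : measurable Omega. Proof. exact: open_measurable_rv. Qed.
Let Ofin : (mu Omega < +oo)%E. Proof. exact: bounded_lebesgue_rv_lty. Qed.

Lemma L2_comb a b (f g : 'rV[R]_m -> 'M[R]_(a, b)) (c : R) :
  L2 Omega f -> L2 Omega g -> L2 Omega (fun x => f x + c *: g x).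
Proof.
move=> Lf Lg i j; have [mf if2] := Lf i j; have [mg ig2] := Lg i j.
have E x : (f x + c *: g x) i j = f x i j + c * g x i j by rewrite !mxE.
have mfg : measurable_fun Omega (fun x => (f x + c *: g x) i j).
  under eq_fun do rewrite E.
  by apply: measurable_funD => //; exact: measurable_funM.
split => //.
(* The dominating function of $(f+cg)^2\le 2f^2+2c^2g^2$. *)
have i1 := integrableD mO (integrableZl mO 2 if2) (integrableZl mO (2 * c ^+ 2) ig2).
apply: le_integrable i1 => //; first exact/measurable_EFinP/measurable_funX.
move=> x Ox /=; rewrite E lee_fin !ger0_norm ?sqr_ge0//; last first.
  apply: addr_ge0; first by apply: mulr_ge0 => //; exact: sqr_ge0.
  by apply: mulr_ge0; [apply: mulr_ge0 => //|]; exact: sqr_ge0.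
have := sqr_ge0 (f x i j - c * g x i j); nra.
Qed.

(** One operation covers sums, differences and scalings. The same combination of the chosen [grad]s
    is a weak gradient; its pairings with a test function are integrable because [phi] and its
    derivatives are bounded. *)
Lemma fe_comb v w c : Vh v -> Vh w -> Vh (fun x => v x + c *: w x).
Proof.
move=> Vv Vw; have [cv [Lv _] pv] := Vv; have [cw [Lw _] pw] := Vw.
have [LGv wGv] := fe_weak_gradient Vv; have [LGw wGw] := fe_weak_gradient Vw.
split.
- move=> x; apply: (@continuousD _ _ (subspace (closure Omega)) v (fun x => c *: w x)); first exact: cv.
  by apply: (@continuousZr _ _ (subspace (closure Omega)) w c); exact: cw.
- split; first exact: L2_comb.
  exists (fun x => grad Omega v x + c *: grad Omega w x); split; first exact: L2_comb.
  move=> phi tphi i j; have [C [M [c0 d0 c1 hC h0]]] := test_functionP j tphi.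
  have ip u : L2 Omega u -> mu.-integrable Omega (EFin \o (fun x => u x 0 i * partial j phi x)).
    move=> Lu; have [mu1 iu] := Lu 0 i; apply: (@integrableM_bounded _ _ _ (fun x => u x 0 i) _ C) => //.
    + exact: L2_integrable.
    + by apply: measurable_funTS; exact: continuous_measurable_rv.
    + by move=> x _; have [] := hC x.
  have iG (G : 'rV[R]_m -> 'M[R]_(n, m)) : L2 Omega G -> mu.-integrable Omega (EFin \o (fun x => G x i j * phi x)).
    move=> Lu; have [mu1 iu] := Lu i j; apply: (@integrableM_bounded _ _ _ (fun x => G x i j) _ C) => //.
    + exact: L2_integrable.
    + by apply: measurable_funTS; exact: continuous_measurable_rv.
    + by move=> x _; have [] := hC x.
  have E1 x : (v x + c *: w x) 0 i * partial j phi x = v x 0 i * partial j phi x + c * (w x 0 i * partial j phi x).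
    by rewrite !mxE mulrDl mulrA.
  have E2 x : (grad Omega v x + c *: grad Omega w x) i j * phi x =
      grad Omega v x i j * phi x + c * (grad Omega w x i j * phi x).
    by rewrite !mxE mulrDl mulrA.
  under eq_Rintegral do rewrite E1; under [in RHS]eq_Rintegral do rewrite E2.
  rewrite RintegralD//; [|exact: ip|apply: integrable_scale => //; exact: ip].
  rewrite RintegralD//; [|exact: iG|apply: integrable_scale => //; exact: iG].
  rewrite !RintegralZl//; [|exact: iG|exact: ip].
  by rewrite (wGv phi tphi) (wGw phi tphi); ring.
- move=> K KT i; have [q hq qE] := pv K KT i; have [q' hq' qE'] := pw K KT i.
  exists (q + mpoly.mpolyC m c * q').
    apply: leq_trans (mpoly.msizeD_le _ _) _; rewrite geq_max hq/= mpoly.mul_mpolyC.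
    exact: leq_trans (mpoly.msizeZ_le _ _) hq'.
  move=> x Kx; rewrite mpoly.mevalD mpoly.mevalM mpoly.mevalC -qE// -qE'//.
  by rewrite !mxE.
Qed.

Lemma fe_zero : Vh (fun=> 0).
Proof.
have L0 a b : L2 Omega (fun=> 0 : 'M[R]_(a, b)).
  move=> i j; split; first exact: measurable_cst.
  under eq_fun do rewrite mxE expr0n/=.
  exact: integrable0.
split.
- by move=> x; exact: cst_continuous.
- split => //; exists (fun=> 0); split => // phi _ i j.
  under eq_Rintegral do rewrite mxE mul0r.
  under [in RHS]eq_Rintegral do rewrite mxE mul0r.
  by rewrite Rintegral_cst// mul0r oppr0.
- move=> K KT i; exists 0; first by rewrite mpoly.msize0.
  by move=> x _; rewrite mpoly.meval0 mxE.
Qed.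

Lemma fe_sum (k : nat) (c : 'I_k -> R) (v : 'I_k -> 'rV[R]_m -> 'rV[R]_n) :
  (forall a, Vh (v a)) -> Vh (fun x => \sum_a c a *: v a x).
Proof.
move=> Vv; suff h s : Vh (fun x => \sum_(a <- s) c a *: v a x) by exact: h.
elim: s => [|a s IH].
  by rewrite (_ : (fun=> _) = fun=> 0); [exact: fe_zero|apply/funext => x; rewrite big_nil].
rewrite (_ : (fun=> _) = fun x => \sum_(a <- s) c a *: v a x + c a *: v a x); first exact: fe_comb.
by apply/funext => x; rewrite big_cons addrC.
Qed.

Variables (E : nat -> set 'rV[R]_m).
Hypothesis coreE : core E.
Let D := \bigcup_k E k.

Lemma core_sub : D `<=` Omega.
Proof. by move=> x [k _ Ex]; have [_ EO _ _ _] := coreE; exact: (EO k). Qed.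

Lemma core_open : open D.
Proof. by apply: bigcup_open => k _; have [] := coreE. Qed.

Lemma core_measurable : measurable D.
Proof. by apply: open_measurable_rv; exact: core_open. Qed.

Lemma core_lty : (mu D < +oo)%E.
Proof.
apply: le_lt_trans Ofin; apply: le_measure; rewrite ?inE//.
  exact: core_measurable.
exact: core_sub.
Qed.

Lemma fe_local v k i : Vh v ->
  exists2 q, smooth_algebra q & forall x, E k x -> v x 0 i = q x.
Proof.
move=> [_ _ pv]; have [_ _ _ _ hK] := coreE.
have [/hK[K KT EK]|nE] := pselect (E k !=set0); last first.
  by exists (fun=> 0); [exact: smooth_algebra_cst|move=> x Ex; exfalso; apply: nE; exists x].
have [q _ qE] := pv K KT i; exists (fun x => mpoly.meval (fun j => x 0 j) q).
  exact: smooth_algebra_meval.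
by move=> x /EK; exact: qE.
Qed.

Lemma near_fe_local v k i q x : E k x -> (forall x, E k x -> v x 0 i = q x) ->
  \forall y \near x, q y = v y 0 i.
Proof.
move=> Ex qE; have : nbhs x (E k).
  by apply: open_nbhs_nbhs; split => //; have [] := coreE.
by apply: filterS => y Ey; rewrite qE.
Qed.

Lemma fe_derivable v x i j : Vh v -> D x -> derivable (fun y => v y 0 i) x (delta_mx 0 j).
Proof.
move=> Vv [k _ Ex]; have [q Aq qE] := fe_local k i Vv.
apply: (near_eq_derivable (near_fe_local Ex qE)).
by have [q' _ dq] := smooth_algebra_derive (delta_mx 0 j) Aq; have [] := dq x.
Qed.

Lemma cgrad_local v k i j q x : (forall x, E k x -> v x 0 i = q x) -> E k x ->
  cgrad v x i j = partial j q x.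
Proof.
by move=> qE Ex; rewrite mxE /partial (near_eq_derive _ (near_fe_local Ex qE)).
Qed.

Lemma cgrad_comb v w c x : Vh v -> Vh w -> D x ->
  cgrad (fun y => v y + c *: w y) x = cgrad v x + c *: cgrad w x.
Proof.
move=> Vv Vw Dx; apply/matrixP => i j; rewrite !mxE /partial.
rewrite (_ : (fun y => _) = (fun y => v y 0 i) + c \*: (fun y => w y 0 i)); last first.
  by apply/funext => y; rewrite !mxE.
rewrite deriveD; [|exact: fe_derivable|apply: derivableZ; exact: fe_derivable].
by rewrite deriveZ//; exact: fe_derivable.
Qed.

Lemma cgrad_sum k (c : 'I_k -> R) (v : 'I_k -> 'rV[R]_m -> 'rV[R]_n) x :
  (forall a, Vh (v a)) -> D x ->
  cgrad (fun y => \sum_a c a *: v a y) x = \sum_a c a *: cgrad (v a) x.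
Proof.
move=> Vv Dx; apply/matrixP => i j; rewrite summxE mxE /partial.
rewrite (_ : (fun y => _) = \sum_a (c a \*: (fun y => v a y 0 i))); last first.
  apply/funext => y; rewrite summxE fct_sumE; apply: eq_bigr => a _.
  by rewrite !mxE.
rewrite derive_sum => [|a]; last by apply: derivableZ; exact: fe_derivable.
apply: eq_bigr => a _; rewrite deriveZ; last exact: fe_derivable.
by rewrite !mxE.
Qed.

(** The set [D] is open and contained in [Omega], so derivatives at its points see no value outside.
    Functions known to agree only on the closure may thus be exchanged. *)
Lemma cgrad_eq v w x : D x -> (forall y, closure Omega y -> v y = w y) -> cgrad v x = cgrad w x.
Proof.
move=> Dx vw; apply/matrixP => i j; rewrite !mxE /partial; apply: near_eq_derive.
have : nbhs x D by apply: open_nbhs_nbhs; split => //; exact: core_open.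
by apply: filterS => y Dy; rewrite vw//; apply: subset_closure; exact: core_sub.
Qed.

(** [Omega] sits in a cube, on which each local expression is bounded; the final constant is a
    maximum over the finitely many pieces that can be nonempty. *)
Lemma local_bounded (f : 'rV[R]_m -> R) :
  (forall k, exists2 q, smooth_algebra q & forall x, E k x -> f x = q x) ->
  measurable_fun D f /\ exists C, forall x, D x -> `|f x| <= C.
Proof.
move=> hf; have [oE EO _ [N EN] _] := coreE; split.
  apply/measurable_fun_bigcup => k; first by apply: open_measurable_rv.
  have [q Aq qE] := hf k.
  apply: (eq_measurable_fun q) => [x /set_mem /qE //|].
  by apply: measurable_funTS; exact: continuous_measurable_rv (smooth_algebra_continuous Aq).
have [M OM] := bounded_set_cube bO.
have /choice[C hC] k : exists C, forall x, E k x -> `|f x| <= C.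
  have [q Aq qE] := hf k.
  have [C hC] := @continuous_bounded_cube R m q M (smooth_algebra_continuous Aq).
  by exists C => x Ex; rewrite qE//; apply: hC; apply: OM; exact: (EO k).
exists (\big[Num.max/0]_(k < N) C k) => x [k _ Ex].
have [kN|/EN Ek] := ltnP k N; last by rewrite Ek in Ex.
by rewrite (le_trans (hC k x Ex))// (le_bigmax _ (fun k : 'I_N => C k) (Ordinal kN)).
Qed.

Lemma fe_bounded v i : Vh v ->
  measurable_fun D (fun x => v x 0 i) /\ exists C, forall x, D x -> `|v x 0 i| <= C.
Proof. by move=> Vv; apply: local_bounded => k; exact: fe_local. Qed.

Lemma cgrad_bounded v i j : Vh v ->
  measurable_fun D (fun x => cgrad v x i j) /\
  exists C, forall x, D x -> `|cgrad v x i j| <= C.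
Proof.
move=> Vv; apply: local_bounded => k; have [q Aq qE] := fe_local k i Vv.
have [q' Aq' dq] := smooth_algebra_derive (delta_mx 0 j) Aq; exists q' => // x Ex.
by rewrite (cgrad_local j qE Ex) /partial; have [] := dq x.
Qed.

Lemma grad_ae v : Vh v -> {ae mu, forall x, D x -> grad Omega v x = cgrad v x}.
Proof.
move=> Vv; have [oE EO _ _ _] := coreE.
have h k i j : {ae mu, forall x, E k x -> grad Omega v x i j = cgrad v x i j}.
  have [q Aq qE] := fe_local k i Vv.
  have := weak_gradient_ae j bO oO (oE k) (EO k) (fe_weak_gradient Vv) Aq qE.
  by apply: filterS => x + Ex; rewrite (cgrad_local j qE Ex); apply.
have {}h k : {ae mu, forall x, E k x -> grad Omega v x = cgrad v x}.
  have hi i : {ae mu, forall x, forall j, E k x -> grad Omega v x i j = cgrad v x i j}.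
    exact: filter_forall.
  have : {ae mu, forall x, forall i j, E k x -> grad Omega v x i j = cgrad v x i j}.
    exact: filter_forall.
  by apply: filterS => x + Ex => hx; apply/matrixP => i j; exact: hx.
have := ae_foralln h; apply: filterS => x + [k _ Ex].
by move=> /(_ k Ex).
Qed.

(** The passage from the statement to the proof: integrals over [Omega] of expressions in [grad]
    become integrals over [D] of the same expressions in [cgrad]. *)
Lemma Rintegral_core (f g : 'rV[R]_m -> R) :
  measurable_fun Omega f -> measurable_fun D g ->
  {ae mu, forall x, D x -> f x = g x} ->
  \int[mu]_(x in Omega) f x = \int[mu]_(x in D) g x.
Proof.
move=> mf mg fg; have [_ _ nD _ _] := coreE.
rewrite -(setIidr core_sub) Rintegral_mkcondr /Rintegral; congr fine.
apply: ae_eq_integral => //.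
- exact/measurable_EFinP.
- apply/measurable_EFinP; apply/measurable_restrict => //; first exact: core_measurable.
  by rewrite (setIidr core_sub).
have nD' : {ae mu, forall x, Omega x -> D x}.
  by apply: negligibleS nD => x /= /not_implyP.
apply: (@filterS2 _ _ _ _ _ _ _ nD' fg) => x OD fgx Ox; have Dx := OD Ox.
by rewrite patchE mem_set// fgx.
Qed.

End finite_elements.

(** * Euclidean and Frobenius inner products *)

Section inner_products.
Variables (R : realType) (a b : nat).
Implicit Types A B C : 'M[R]_(a, b).

Lemma mxdotC A B : mxdot A B = mxdot B A.
Proof. by apply: eq_bigr => i _; apply: eq_bigr => j _; rewrite mulrC. Qed.

Lemma mxdotDl A B C : mxdot (A + B) C = mxdot A C + mxdot B C.
Proof.
rewrite /mxdot -big_split; apply: eq_bigr => i _; rewrite -big_split.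
by apply: eq_bigr => j _; rewrite mxE mulrDl.
Qed.

Lemma mxdotZl c A B : mxdot (c *: A) B = c * mxdot A B.
Proof.
rewrite /mxdot mulr_sumr; apply: eq_bigr => i _; rewrite mulr_sumr.
by apply: eq_bigr => j _; rewrite mxE mulrA.
Qed.

Lemma mxdotDr A B C : mxdot A (B + C) = mxdot A B + mxdot A C.
Proof. by rewrite mxdotC mxdotDl !(mxdotC A). Qed.

Lemma mxdotZr c A B : mxdot A (c *: B) = c * mxdot A B.
Proof. by rewrite mxdotC mxdotZl mxdotC. Qed.

Lemma mxdotNl A B : mxdot (- A) B = - mxdot A B.
Proof. by rewrite -scaleN1r mxdotZl mulN1r. Qed.

Lemma mxdotNr A B : mxdot A (- B) = - mxdot A B.
Proof. by rewrite mxdotC mxdotNl mxdotC. Qed.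

Lemma mxdot0l A : mxdot 0 A = 0.
Proof. by rewrite -(scale0r A) mxdotZl mul0r. Qed.

Lemma mxdot_ge0 A : 0 <= mxdot A A.
Proof. by apply: sumr_ge0 => i _; apply: sumr_ge0 => j _; rewrite -expr2 sqr_ge0. Qed.

Lemma mxdot_eq0 A : mxdot A A = 0 -> A = 0.
Proof.
move=> A0; apply/matrixP => i j; rewrite mxE; apply/eqP; rewrite -sqrf_eq0 expr2.
have := A0; move=> /eqP; rewrite psumr_eq0 => [|k _]; last first.
  by apply: sumr_ge0 => l _; rewrite -expr2 sqr_ge0.
move=> /allP/(_ i (mem_index_enum _))/=; rewrite psumr_eq0 => [|k _]; last first.
  by rewrite -expr2 sqr_ge0.
by move=> /allP/(_ j (mem_index_enum _)).
Qed.

Lemma fnorm_sqr A : fnorm A ^+ 2 = mxdot A A.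
Proof. by rewrite /fnorm sqr_sqrtr// mxdot_ge0. Qed.

Lemma mxdot_sum_r (I : finType) (c : I -> R) (B : I -> 'M[R]_(a, b)) A :
  mxdot A (\sum_k c k *: B k) = \sum_k c k * mxdot A (B k).
Proof.
elim/big_rec2 : _ => [|k x y _ <-]; first by rewrite mxdotC mxdot0l.
by rewrite mxdotDr mxdotZr.
Qed.

Lemma ler_norm_mxdot A B (x y : R) :
  (forall i j, `|A i j| <= x) -> (forall i j, `|B i j| <= y) ->
  `|mxdot A B| <= (a * b)%:R * (x * y).
Proof.
move=> hA hB; rewrite /mxdot (le_trans (ler_norm_sum _ _ _))//.
rewrite (@le_trans _ _ (\sum_(i < a) \sum_(j < b) (x * y)))//; last first.
  by rewrite !sumr_const !card_ord -mulrnA mulr_natl mulnC.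
apply: ler_sum => i _; rewrite (le_trans (ler_norm_sum _ _ _))//.
by apply: ler_sum => j _; rewrite normrM ler_pM.
Qed.

End inner_products.

(** * The regularized norm: convexity and directional derivative of its power *)

Section regularized_norm.
Variables (R : realType) (m n : nat) (p eps : R).
Hypotheses (p1 : 1 <= p) (eps0 : 0 < eps).
Implicit Types Y Z : 'M[R]_(n, m).
Let N := @reg_norm R m n p eps.
Let p0 : 0 < p. Proof. exact: lt_le_trans p1. Qed.

Lemma reg_norm_sqr Y : N Y ^+ 2 = mxdot Y Y + a_coef p eps ^+ 2.
Proof. by rewrite /N /reg_norm fnorm_sqr sqr_sqrtr// addr_ge0 ?mxdot_ge0 ?sqr_ge0. Qed.

Lemma reg_norm_ge0 Y : 0 <= N Y. Proof. exact: sqrtr_ge0. Qed.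

(** For $p<2$ the regularization is [eps], which is positive. Degeneracy thus occurs only for
    $p\ge2$ and at $Y=0$, where the flux vanishes anyway. *)
Lemma reg_norm_eq0 Y : N Y = 0 -> Y = 0 /\ 2 <= p.
Proof.
move=> NY; have := reg_norm_sqr Y; rewrite NY expr0n/= => /esym/eqP.
rewrite paddr_eq0 ?mxdot_ge0 ?sqr_ge0// => /andP[/eqP/mxdot_eq0 -> ].
by rewrite sqrf_eq0 /a_coef; case: ifPn => // _; rewrite gt_eqF.
Qed.

(** Cauchy-Schwarz for the vectors $(Y,a)$ and $(Z,a)$, whose Euclidean norms are the regularized
    norms. *)
Lemma reg_norm_CS Y Z : mxdot Y Z + a_coef p eps ^+ 2 <= N Y * N Z.
Proof.
set s := N Y; set t := N Z; set al := a_coef p eps.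
have s0 : 0 <= s by exact: reg_norm_ge0.
have t0 : 0 <= t by exact: reg_norm_ge0.
have sE : s ^+ 2 = mxdot Y Y + al ^+ 2 by exact: reg_norm_sqr.
have tE : t ^+ 2 = mxdot Z Z + al ^+ 2 by exact: reg_norm_sqr.
have al0 u : u = 0 -> u ^+ 2 = al ^+ 2 -> al ^+ 2 = 0 by move=> -> <-; rewrite expr0n.
have [sz|sz] := eqVneq s 0.
  have [Y0 _] := reg_norm_eq0 sz; rewrite sz mul0r Y0 mxdot0l add0r.
  by move: sE; rewrite sz Y0 mxdot0l add0r expr0n/= => <-.
have [tz|tz] := eqVneq t 0.
  have [Z0 _] := reg_norm_eq0 tz; rewrite tz mulr0 Z0 mxdotC mxdot0l add0r.
  by move: tE; rewrite tz Z0 mxdot0l add0r expr0n/= => <-.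
have st : 0 < s * t by rewrite mulr_gt0// lt_neqAle eq_sym ?sz ?tz.
have h := mxdot_ge0 (t *: Y - s *: Z).
have {}h : 0 <= 2 * (s * t) * (s * t - (mxdot Y Z + al ^+ 2)).
  (* The right-hand side is the squared norm of $t(Y,a)-s(Z,a)$. *)
  have -> : 2 * (s * t) * (s * t - (mxdot Y Z + al ^+ 2)) =
      mxdot (t *: Y - s *: Z) (t *: Y - s *: Z) + (t - s) ^+ 2 * al ^+ 2.
    rewrite mxdotDl !mxdotDr !mxdotNl !mxdotNr !mxdotZl !mxdotZr (mxdotC Z Y).
    have -> : mxdot Y Y = s ^+ 2 - al ^+ 2 by rewrite sE addrK.
    have -> : mxdot Z Z = t ^+ 2 - al ^+ 2 by rewrite tE addrK.
    by ring.
  by rewrite addr_ge0// mulr_ge0 ?sqr_ge0.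
move: h; rewrite pmulr_rge0 ?subr_ge0// mulr_gt0//.
Qed.

(** Young's inequality for $t$ and $s^{p-1}$ with exponents $p$ and $p/(p-1)$. At $p=1$ there is no
    finite conjugate exponent, and the two sides are equal. *)
Lemma powR_tangent (s t : R) : 0 < s -> 0 <= t ->
  s `^ (p - 1) * (t - s) <= p^-1 * t `^ p - p^-1 * s `^ p.
Proof.
move=> s0 t0.
have sp : s `^ (p - 1) * s = s `^ p by rewrite mulrC mulr_powRB1// ltW.
have [pE|pN] := eqVneq p 1.
  by rewrite pE subrr powRr0 mul1r invr1 !mul1r !powRr1 ?(ltW s0).
have pm : 0 < p - 1 by rewrite subr_gt0 lt_neqAle eq_sym pN.
pose q := p / (p - 1).
have q0 : 0 < q by rewrite divr_gt0.
have pq : p^-1 + q^-1 = 1.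
  by rewrite /q; field; rewrite !gt_eqF.
have := @conjugate_powR R t (s `^ (p - 1)) p q t0 (powR_ge0 _ _) p0 q0 pq.
rewrite -powRrM (_ : (p - 1) * q = p); last by rewrite /q; field; rewrite gt_eqF.
rewrite mulrBr sp => h.
have qE : q^-1 = 1 - p^-1 by rewrite -pq; ring.
by move: h; rewrite qE; lra.
Qed.

(** The $p$-part of the flux is a subgradient: the scalar tangent is composed with Cauchy-Schwarz.
    If the norm vanishes at [Y], then $Y=0$ and the left side is 0 whatever value the power
    takes. *)
Lemma reg_norm_tangent Y Z :
  N Y `^ (p - 2) * mxdot Y (Z - Y) <= p^-1 * N Z `^ p - p^-1 * N Y `^ p.
Proof.
have [sz|sz] := eqVneq (N Y) 0.
  have [Y0 _] := reg_norm_eq0 sz; rewrite sz Y0 mxdot0l mulr0 powR0 ?gt_eqF//.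
  by rewrite mulr0 subr0 mulr_ge0 ?powR_ge0// invr_ge0 ltW.
have s0 : 0 < N Y by rewrite lt_neqAle eq_sym sz reg_norm_ge0.
apply: le_trans (powR_tangent s0 (reg_norm_ge0 Z)).
have -> : N Y `^ (p - 1) = N Y `^ (p - 2) * N Y.
  rewrite -[X in _ = _ * X]powRr1 ?reg_norm_ge0// -powRD.
    by congr (_ `^ _); ring.
  by rewrite sz implybT.
rewrite -mulrA ler_wpM2l ?powR_ge0// mxdotDr mxdotNr.
have -> : mxdot Y Y = N Y ^+ 2 - a_coef p eps ^+ 2 by rewrite reg_norm_sqr addrK.
by have := reg_norm_CS Y Z; nra.
Qed.

(** For $p\ge2$ the power increases with the norm; for $p<2$ it decreases, and the norm is at least
    [eps]. *)
Lemma reg_norm_pow_bounded (B : R) : exists C, forall Y, (forall i j, `|Y i j| <= B) ->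
  N Y `^ (p - 2) <= C.
Proof.
have [p2|p2] := leP 2 p.
  exists (Num.sqrt ((n * m)%:R * (B * B) + a_coef p eps ^+ 2) `^ (p - 2)) => Y hY.
  apply: ge0_ler_powR; rewrite ?subr_ge0 ?nnegrE ?sqrtr_ge0//.
  rewrite ler_wsqrtr// lerD2r fnorm_sqr.
  by rewrite (le_trans (ler_norm _))// ler_norm_mxdot.
exists (eps `^ (2 - p))^-1 => Y _.
have -> : p - 2 = - (2 - p) by rewrite opprB.
rewrite powRN lef_pV2 ?posrE ?powR_gt0//.
  rewrite ge0_ler_powR ?subr_ge0 ?(ltW p2) ?nnegrE ?(ltW eps0) ?reg_norm_ge0//.
  rewrite /N /reg_norm -[leLHS]gtr0_norm// -sqrtr_sqr ler_wsqrtr//.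
  by rewrite /a_coef [2 <= p]leNgt p2/= lerDr sqr_ge0.
rewrite lt_neqAle eq_sym reg_norm_ge0 andbT; apply: contraTneq p2 => /reg_norm_eq0[_].
by rewrite leNgt.
Qed.

(** The tangents at $Y$ and at $Y+tZ$ trap the quotient between the claimed limit and [up], so it
    remains to follow [up] as $t$ tends to 0. *)
Lemma reg_norm_cvg_derive Y Z :
  (fun k : nat => k.+1%:R * (p^-1 * N (Y + k.+1%:R^-1 *: Z) `^ p - p^-1 * N Y `^ p)) @ \oo
  --> N Y `^ (p - 2) * mxdot Y Z.
Proof.
pose t (k : nat) : R := k.+1%:R^-1.
have t0 k : 0 < t k by rewrite invr_gt0.
have tV k : k.+1%:R = (t k)^-1 by rewrite invrK.
pose up k : R := N (Y + t k *: Z) `^ (p - 2) * mxdot (Y + t k *: Z) Z.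
have lo k : N Y `^ (p - 2) * mxdot Y Z <=
    k.+1%:R * (p^-1 * N (Y + t k *: Z) `^ p - p^-1 * N Y `^ p).
  rewrite tV ler_pdivlMl//.
  have := reg_norm_tangent Y (Y + t k *: Z).
  have -> : Y + t k *: Z - Y = t k *: Z by rewrite addrAC subrr add0r.
  by rewrite mxdotZr; apply: le_trans; rewrite mulrCA.
have hi k : k.+1%:R * (p^-1 * N (Y + t k *: Z) `^ p - p^-1 * N Y `^ p) <= up k.
  rewrite tV ler_pdivrMl//.
  have := reg_norm_tangent (Y + t k *: Z) Y.
  have -> : Y - (Y + t k *: Z) = - (t k *: Z) by rewrite opprD addrA subrr add0r.
  rewrite mxdotNr mxdotZr mulrN /up => h.
  rewrite -lerN2 opprB; apply: le_trans h; rewrite lerN2.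
  by rewrite mulrCA.
suff cu : up @ \oo --> N Y `^ (p - 2) * mxdot Y Z.
  apply: squeeze_cvgr cu; last exact: cvg_cst.
  by apply: nearW => k; rewrite lo hi.
have ct : t @ \oo --> (0 : R) by exact: cvg_harmonic.
have cd : (fun k => mxdot (Y + t k *: Z) Z) @ \oo --> mxdot Y Z.
  rewrite (_ : (fun k => _) = (fun k => mxdot Y Z + t k * mxdot Z Z)); last first.
    by apply/funext => k; rewrite mxdotDl mxdotZl.
  rewrite -[X in _ --> X]addr0 -(mul0r (mxdot Z Z)).
  by apply: cvgD; [exact: cvg_cst|apply: cvgM => //; exact: cvg_cst].
have cN : (fun k => N (Y + t k *: Z)) @ \oo --> N Y.
  suff h : (fun k => fnorm (Y + t k *: Z) ^+ 2 + a_coef p eps ^+ 2) @ \oo -->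
      fnorm Y ^+ 2 + a_coef p eps ^+ 2.
    exact: (cvg_comp _ _ h (@sqrt_continuous R _)).
  apply: cvgD; last exact: cvg_cst.
  rewrite fnorm_sqr (_ : (fun k => _) =
     (fun k => mxdot Y Y + t k * (mxdot Y Z + mxdot (Y + t k *: Z) Z))); last first.
    apply/funext => k; rewrite fnorm_sqr !mxdotDl !mxdotDr !mxdotZl !mxdotZr (mxdotC Z).
    by ring.
  rewrite -[X in _ --> X]addr0 -(mul0r (mxdot Y Z + mxdot Y Z)).
  apply: cvgD; first exact: cvg_cst.
  by apply: cvgM => //; apply: cvgD => //; exact: cvg_cst.
have [sz|sz] := eqVneq (N Y) 0; last first.
  apply: cvgM cd.
  suff h : {for N Y, continuous (fun x : R => x `^ (p - 2))} by exact: (cvg_comp _ _ cN h).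
  apply: differentiable_continuous; apply/derivable1_diffP; apply: derivable_powR.
  by rewrite in_itv/= andbT lt_neqAle eq_sym sz reg_norm_ge0.
have [Y0 p2] := reg_norm_eq0 sz.
have al0 : a_coef p eps = 0 by rewrite /a_coef p2.
rewrite Y0 mxdot0l mulr0.
(* Here $Y=0$, $a=0$ and $p\ge2$: since $t\le1$, the norm of $tZ$ is at most that of $Z$, so [up] is
   at most $t\,|Z|^{p-2}|Z|^2$. *)
apply: (@squeeze_cvgr _ _ _ _ (cst 0) (fun k => t k * (N Z `^ (p - 2) * mxdot Z Z))).
- apply: nearW => k /=; rewrite /up Y0 add0r mxdotZl.
  rewrite mulr_ge0 ?powR_ge0//=; last by rewrite mulr_ge0 ?mxdot_ge0// ltW.
  rewrite mulrCA ler_wpM2l ?(ltW (t0 k))// ler_wpM2r ?mxdot_ge0//.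
  rewrite ge0_ler_powR ?subr_ge0// ?nnegrE ?reg_norm_ge0//.
  rewrite /N /reg_norm al0 expr0n/= !addr0 ler_wsqrtr// !fnorm_sqr.
  rewrite mxdotZl mxdotZr mulrA ler_piMl ?mxdot_ge0//.
  have tk : t k <= 1 by rewrite /t invf_le1// ler1n.
  by rewrite mulr_ile1// ltW.
- exact: cvg_cst.
- rewrite -[X in _ --> X](mul0r (N Z `^ (p - 2) * mxdot Z Z)).
  by apply: cvgM => //; exact: cvg_cst.
Qed.

End regularized_norm.

(** * Convex differentiable potentials *)

Section convex_potentials.
Variables (R : realType) (n : nat) (W : 'rV[R]_n -> R).
Hypotheses (cW : convex_function setT W) (dW : forall y : 'rV[R]_n, differentiable W y).

Lemma convex_continuous : continuous W.
Proof. by move=> y; exact: differentiable_continuous. Qed.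

Lemma derive_gradient y v : 'D_v W y = mxdot (gradient W y) v.
Proof.
rewrite deriveE// {1}(row_sum_delta v) linear_sum /mxdot big_ord1.
apply: eq_bigr => j _; rewrite linearZ /= [RHS]mulrC; congr (_ * _).
by rewrite mxE /partial deriveE.
Qed.

(** The convexity inequality at $y+t(z-y)$, divided by $t=1/(k+1)$, in the limit. *)
Lemma convex_tangent y z : mxdot (gradient W y) (z - y) <= W z - W y.
Proof.
rewrite -derive_gradient.
have c : (fun k : nat => k.+1%:R * (W (y + k.+1%:R^-1 *: (z - y)) - W y)) @ \oo --> 'D_(z - y) W y.
  by apply: cvg_derive_seq; exact: diff_derivable.
have c' : (fun _ : nat => W z - W y) @ \oo --> W z - W y by exact: cvg_cst.
apply: (ler_cvg_to c c'); apply: nearW => k.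
have k0 : 0 < k.+1%:R^-1 :> R by rewrite invr_gt0.
have k1 : k.+1%:R^-1 <= 1 :> R by rewrite invf_le1// ler1n.
have := cW (Itv01 (ltW k0) k1) (mem_set (I : setT z)) (mem_set (I : setT y)).
rewrite [leLHS](_ : _ = W (y + k.+1%:R^-1 *: (z - y))); last first.
  congr W; rewrite /conv/= /unstable.onem scalerBl scale1r scalerBr.
  by rewrite addrCA addrA.
rewrite convRE/= /unstable.onem => h.
rewrite -ler_pdivlMl ?ltr0n//.
move: h; set t := k.+1%:R^-1 => h; lra.
Qed.

(** Differentiability alone gives no local bound on the gradient, but convexity does: tangents in
    the directions plus and minus a unit vector bound a component by the oscillation of [W] on a
    cube larger by 1. *)
Lemma gradient_bounded (B : R) : exists C, forall y : 'rV[R]_n, (forall i, `|y 0 i| <= B) ->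
  forall j, `|gradient W y 0 j| <= C.
Proof.
have [C hC] := @continuous_bounded_cube R n W (B + 1) convex_continuous.
exists (C + C) => y hy j.
have dE (s : R) : mxdot (gradient W y) (s *: delta_mx 0 j) = s * gradient W y 0 j.
  by rewrite mxdotZr -derive_gradient mxE.
have cube s : `|s| <= 1 -> rv_cube n (B + 1) (y + s *: delta_mx 0 j).
  move=> s1 i /=; rewrite in_itv/= -ler_norml !mxE (le_trans (ler_normD _ _))// lerD//.
  rewrite normrM; case: (_ && _); rewrite ?normr1 ?normr0 ?mulr1 ?mulr0//.
have h s : `|s| <= 1 -> s * gradient W y 0 j <= C + C.
  move=> s1; have := convex_tangent y (y + s *: delta_mx 0 j).
  rewrite (_ : y + _ - y = s *: delta_mx 0 j); last by rewrite addrAC subrr add0r.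
  rewrite dE => /le_trans; apply; rewrite (le_trans (ler_norm _))//.
  rewrite (le_trans (ler_normB _ _))// lerD ?hC//; first exact: cube.
  by have := cube 0; rewrite normr0 scale0r addr0; apply.
have h1 : `|1 : R| <= 1 by rewrite normr1.
have h2 : `|- 1 : R| <= 1 by rewrite normrN normr1.
have := h 1 h1; have := h (-1) h2; rewrite mul1r mulN1r => g1 g2.
by rewrite ler_norml g2 andbT lerNl.
Qed.

Lemma measurable_gradient j : measurable_fun setT (fun y => gradient W y 0 j).
Proof.
under eq_fun do rewrite mxE.
apply: measurable_derive_rv => [|x]; last exact: diff_derivable.
exact: (continuous_measurable_rv convex_continuous).
Qed.

End convex_potentials.

(** * Pointwise densities of the step functional and of the energy *)

Section densities.
Variables (R : realType) (m n : nat) (p alpha eps delta lambda tau : R).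
Variables (Wp Wm : 'rV[R]_n -> R).
Hypotheses (p1 : 1 <= p) (eps0 : 0 < eps) (delta0 : 0 < delta) (lambda0 : 0 < lambda).
Hypothesis tau0 : 0 < tau.
Hypotheses (cWp : convex_function setT Wp) (cWm : convex_function setT Wm).
Hypotheses (dWp : forall y : 'rV[R]_n, differentiable Wp y)
           (dWm : forall y : 'rV[R]_n, differentiable Wm y).
Hypothesis hF : forall y : 'rV[R]_n, potential y = Wp y - Wm y.
Let b := b_coef alpha eps.
Let N := @reg_norm R m n p eps.
Implicit Types (y z g w : 'rV[R]_n) (Y Z : 'M[R]_(n, m)).

Let b0 : 0 <= b. Proof. exact: powR_ge0. Qed.

(* The functional whose minimizer is the next time step, and its derivative. *)
Definition step_density y0 g w y Y : R :=
  (2 * tau)^-1 * mxdot (y - y0) (y - y0) + b / 2 * mxdot Y Y + p^-1 * N Y `^ p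
  + delta^-1 * Wp y + lambda / 2 * mxdot (y - g) (y - g) - delta^-1 * mxdot w y.

Definition step_derivative y0 g w y Y z Z : R :=
  mxdot (tau^-1 *: (y - y0)) z + mxdot ((b + N Y `^ (p - 2)) *: Y) Z
  + lambda * mxdot (y - g) z + delta^-1 * mxdot (gradient Wp y) z
  - delta^-1 * mxdot w z.

Definition energy_density g y Y : R :=
  b / 2 * fnorm Y ^+ 2 + p^-1 * N Y `^ p + delta^-1 * potential y
  + lambda / 2 * fnorm (y - g) ^+ 2.

Lemma mxdot_sqr_expand (i j : nat) (u v c : 'M[R]_(i, j)) :
  mxdot (v - c) (v - c) =
  mxdot (u - c) (u - c) + 2 * mxdot (u - c) (v - u) + mxdot (v - u) (v - u).
Proof.
have -> : v - c = (u - c) + (v - u) by rewrite [RHS]addrC addrA subrK.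
by move: (u - c) (v - u) => x y; rewrite mxdotDl !mxdotDr (mxdotC y x); ring.
Qed.

Lemma mxdot_sqr_tangent (i j : nat) (u v c : 'M[R]_(i, j)) :
  2 * mxdot (u - c) (v - u) <= mxdot (v - c) (v - c) - mxdot (u - c) (u - c).
Proof. by have := mxdot_sqr_expand u v c; have := mxdot_ge0 (v - u); lra. Qed.

Lemma flux_tangent Y Z : mxdot ((b + N Y `^ (p - 2)) *: Y) (Z - Y) <=
  (b / 2 * mxdot Z Z + p^-1 * N Z `^ p) - (b / 2 * mxdot Y Y + p^-1 * N Y `^ p).
Proof.
rewrite mxdotZl mulrDl.
have h1 := reg_norm_tangent p1 eps0 Y Z.
have := mxdot_sqr_tangent Y Z 0; rewrite !subr0 => h2.
have h3 : b * mxdot Y (Z - Y) <= b / 2 * mxdot Z Z - b / 2 * mxdot Y Y.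
  rewrite -mulrBr -mulrA ler_wpM2l//; lra.
by rewrite -/N in h1; lra.
Qed.

(** The time-difference term is expanded exactly instead of being bounded by its tangent. Its
    quadratic remainder is the strong convexity on which coercivity and uniqueness rest. *)
Lemma step_tangent y0 g w y Y z Z :
  step_derivative y0 g w y Y (z - y) (Z - Y) + (2 * tau)^-1 * mxdot (z - y) (z - y)
  <= step_density y0 g w z Z - step_density y0 g w y Y.
Proof.
rewrite /step_derivative /step_density.
have h1 := flux_tangent Y Z.
have h2 : delta^-1 * mxdot (gradient Wp y) (z - y) <= delta^-1 * (Wp z - Wp y).
  by rewrite ler_wpM2l ?invr_ge0 ?(ltW delta0)// convex_tangent.
have h3 : lambda * mxdot (y - g) (z - y) <=
    lambda / 2 * (mxdot (z - g) (z - g) - mxdot (y - g) (y - g)).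
  rewrite -mulrA ler_wpM2l ?(ltW lambda0)//.
  by have := mxdot_sqr_tangent y z g; lra.
rewrite (mxdot_sqr_expand y z y0) (mxdotZl tau^-1).
have -> : tau^-1 = 2 * (2 * tau)^-1 by field; rewrite gt_eqF.
have -> : mxdot w (z - y) = mxdot w z - mxdot w y by rewrite mxdotDr mxdotNr.
rewrite !mulrDr.
move: h2 h3; rewrite !mulrBr; set q1 := (2 * tau)^-1; lra.
Qed.

(** Each part of the potential is linearized where the scheme evaluates it: [Wp] at the new value
    towards the old one, [Wm] at the old value towards the new one. The two tangent inequalities add
    up to the difference of the potentials. *)
Lemma energy_tangent y0 Y0 g y Y :
  energy_density g y Y + tau^-1 * mxdot (y - y0) (y - y0) - energy_density g y0 Y0
  <= step_derivative y0 g (gradient Wm y0) y Y (y - y0) (Y - Y0).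
Proof.
rewrite /step_derivative /energy_density !hF !fnorm_sqr (mxdotZl tau^-1).
have h1 := flux_tangent Y Y0.
have -> : mxdot ((b + N Y `^ (p - 2)) *: Y) (Y - Y0) =
    - mxdot ((b + N Y `^ (p - 2)) *: Y) (Y0 - Y) by rewrite -mxdotNr opprB.
have h2 : delta^-1 * mxdot (gradient Wp y) (y0 - y) <= delta^-1 * (Wp y0 - Wp y).
  by rewrite ler_wpM2l ?invr_ge0 ?(ltW delta0)// convex_tangent.
have h2' : delta^-1 * mxdot (gradient Wm y0) (y - y0) <= delta^-1 * (Wm y - Wm y0).
  by rewrite ler_wpM2l ?invr_ge0 ?(ltW delta0)// convex_tangent.
have -> : mxdot (gradient Wp y) (y - y0) = - mxdot (gradient Wp y) (y0 - y).
  by rewrite -mxdotNr opprB.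
have h3 : lambda * mxdot (y - g) (y0 - y) <=
    lambda / 2 * (mxdot (y0 - g) (y0 - g) - mxdot (y - g) (y - g)).
  rewrite -mulrA ler_wpM2l ?(ltW lambda0)//.
  by have := mxdot_sqr_tangent y y0 g; lra.
have -> : mxdot (y - g) (y - y0) = - mxdot (y - g) (y0 - y) by rewrite -mxdotNr opprB.
move: h2 h2' h3; rewrite !mulrBr !mulrN; lra.
Qed.

(** The datum [g] occurs only in the fidelity term, and there affinely, so a constant times
    $1+\sum_i|g_i|$ suffices while the other arguments range over a bounded set. *)
Lemma step_derivative_bounded (B : R) : 0 <= B -> exists2 K, 0 <= K &
  forall y0 g w y Y z Z,
    (forall i, `|y0 0 i| <= B) -> (forall i, `|w 0 i| <= B) -> (forall i, `|y 0 i| <= B) ->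
    (forall i j, `|Y i j| <= B) -> (forall i, `|z 0 i| <= B) -> (forall i j, `|Z i j| <= B) ->
    `|step_derivative y0 g w y Y z Z| <= K * (1 + \sum_i `|g 0 i|).
Proof.
move=> B0.
have [C hC] := @reg_norm_pow_bounded R m n p eps eps0 B.
have [C' hC'] := gradient_bounded cWp dWp B.
pose k1 := (1 * n)%:R * ((tau^-1 * (B + B)) * B).
pose k2 := (n * m)%:R * (((b + `|C|) * B) * B).
pose k3 := (1 * n)%:R * (B * B).
pose k4 := (1 * n)%:R * (`|C'| * B).
have ti : 0 <= tau^-1 by rewrite invr_ge0 ltW.
have di : 0 <= delta^-1 by rewrite invr_ge0 ltW.
have k10 : 0 <= k1 by rewrite /k1 !mulr_ge0// addr_ge0.
have k20 : 0 <= k2 by rewrite /k2 !mulr_ge0// addr_ge0.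
have k30 : 0 <= k3 by rewrite /k3 !mulr_ge0.
have k40 : 0 <= k4 by rewrite /k4 !mulr_ge0.
have l0 := ltW lambda0.
(* [k1] bounds the time difference, [k2] the flux, [k3] the plain products and [k4] the [Wp] term;
   [lambda * B] is the coefficient of $\sum_i|g_i|$. *)
pose K := k1 + k2 + lambda * k3 + delta^-1 * k4 + delta^-1 * k3 + lambda * B.
have K0 : 0 <= K by rewrite /K !addr_ge0// mulr_ge0.
exists K => // y0 g w y Y z Z hy0 hw hy hY hz hZ.
have row (u : 'rV[R]_n) (c : R) : (forall i, `|u 0 i| <= c) -> forall i j, `|u i j| <= c.
  by move=> hu i j; rewrite ord1.
have b1 : `|mxdot (tau^-1 *: (y - y0)) z| <= k1.
  apply: ler_norm_mxdot; apply: row => // i; rewrite !mxE normrM (ger0_norm ti).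
  by rewrite ler_wpM2l// (le_trans (ler_normB _ _))// lerD.
have b2 : `|mxdot ((b + N Y `^ (p - 2)) *: Y) Z| <= k2.
  apply: ler_norm_mxdot => // i j; rewrite !mxE normrM ler_pM//.
  rewrite ger0_norm ?addr_ge0 ?powR_ge0// lerD2l.
  by rewrite (le_trans (hC Y hY))// ler_norm.
have b3 : `|mxdot y z| <= k3 by apply: ler_norm_mxdot; exact: row.
have b5 : `|mxdot w z| <= k3 by apply: ler_norm_mxdot; exact: row.
have b4 : `|mxdot (gradient Wp y) z| <= k4.
  apply: ler_norm_mxdot; apply: row => // i.
  by rewrite (le_trans (hC' y hy i))// ler_norm.
set S := \sum_i `|g 0 i|.
have S0 : 0 <= S by apply: sumr_ge0.
have b6 : `|mxdot g z| <= B * S.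
  rewrite /mxdot big_ord1 (le_trans (ler_norm_sum _ _ _))// mulr_sumr.
  by apply: ler_sum => i _; rewrite normrM mulrC ler_wpM2r.
have c1 : `|step_derivative y0 g w y Y z Z| <=
    k1 + k2 + lambda * (k3 + B * S) + delta^-1 * k4 + delta^-1 * k3.
  rewrite /step_derivative.
  have hD (u v x y' : R) : `|u| <= x -> `|v| <= y' -> `|u + v| <= x + y'.
    by move=> hu hv; rewrite (le_trans (ler_normD _ _))// lerD.
  apply: (hD _ _ _ _); last by rewrite normrN normrM (ger0_norm di) ler_wpM2l.
  apply: (hD _ _ _ _); last by rewrite normrM (ger0_norm di) ler_wpM2l.
  apply: (hD _ _ _ _); last first.
    rewrite normrM (ger0_norm l0) ler_wpM2l// mxdotDl mxdotNl.
    by apply: (hD _ _ _ _) => //; rewrite normrN.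
  exact: hD.
apply: (le_trans c1); rewrite /K.
have t1 : 0 <= k1 * S by rewrite mulr_ge0.
have t2 : 0 <= k2 * S by rewrite mulr_ge0.
have t3 : 0 <= (lambda * k3) * S by rewrite !mulr_ge0.
have t4 : 0 <= (delta^-1 * k4) * S by rewrite !mulr_ge0.
have t5 : 0 <= (delta^-1 * k3) * S by rewrite !mulr_ge0.
have t6 : 0 <= lambda * B by rewrite mulr_ge0.
clear -t1 t2 t3 t4 t5 t6.
move: (delta^-1) t4 t5 => di t4 t5.
have -> : (k1 + k2 + lambda * k3 + di * k4 + di * k3 + lambda * B) * (1 + S) =
  k1 + k2 + lambda * (k3 + B * S) + di * k4 + di * k3 +
  (k1 * S + k2 * S + lambda * k3 * S + di * k4 * S + di * k3 * S + lambda * B) by ring.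
by rewrite lerDl !addr_ge0.
Qed.

(** For the quadratic and linear terms the quotient is exactly the derivative plus $Q/(k+1)$; only
    the power of the norm and [Wp] involve a genuine limit. *)
Lemma step_density_cvg y0 g w y Y z Z :
  (fun k : nat => k.+1%:R * (step_density y0 g w (y + k.+1%:R^-1 *: z) (Y + k.+1%:R^-1 *: Z)
     - step_density y0 g w y Y)) @ \oo --> step_derivative y0 g w y Y z Z.
Proof.
pose Q : R := (2 * tau)^-1 * mxdot z z + b / 2 * mxdot Z Z + lambda / 2 * mxdot z z.
pose f1 (k : nat) := k.+1%:R * (p^-1 * N (Y + k.+1%:R^-1 *: Z) `^ p - p^-1 * N Y `^ p).
pose f2 (k : nat) := k.+1%:R * (Wp (y + k.+1%:R^-1 *: z) - Wp y).
have c1 : f1 @ \oo --> N Y `^ (p - 2) * mxdot Y Z by exact: reg_norm_cvg_derive.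
have c2 : f2 @ \oo --> mxdot (gradient Wp y) z.
  by rewrite -derive_gradient//; apply: cvg_derive_seq; exact: diff_derivable.
rewrite (_ : (fun k => _) = (fun k : nat =>
  (mxdot (tau^-1 *: (y - y0)) z + b * mxdot Y Z + lambda * mxdot (y - g) z - delta^-1 * mxdot w z
   + f1 k + delta^-1 * f2 k) + k.+1%:R^-1 * Q)); last first.
  apply/funext => k; rewrite /f1 /f2 /step_density /Q.
  have k0 : k.+1%:R != 0 :> R by rewrite pnatr_eq0.
  move: (k.+1%:R) k0 => s s0.
  have ED (u v : 'rV[R]_n) : u + s^-1 *: v - u = s^-1 *: v by rewrite addrAC subrr add0r.
  have ED' (u v : 'M[R]_(n, m)) : u + s^-1 *: v - u = s^-1 *: v by rewrite addrAC subrr add0r.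
  rewrite (mxdot_sqr_expand y (y + s^-1 *: z) y0) (mxdot_sqr_expand y (y + s^-1 *: z) g) !ED.
  have -> : mxdot (Y + s^-1 *: Z) (Y + s^-1 *: Z) = mxdot Y Y + 2 * (s^-1 * mxdot Y Z) + s^-1 * (s^-1 * mxdot Z Z).
    by rewrite mxdotDl !mxdotDr !mxdotZl !mxdotZr (mxdotC Z Y); ring.
  rewrite (mxdotDr w) !mxdotZl !mxdotZr.
  move: (N (Y + s^-1 *: Z) `^ p) (N Y `^ p) (Wp _) (Wp _) => a1 a2 a3 a4.
  by field; rewrite s0 !gt_eqF// (lt_le_trans _ p1).
have -> : step_derivative y0 g w y Y z Z =
  (mxdot (tau^-1 *: (y - y0)) z + b * mxdot Y Z + lambda * mxdot (y - g) z - delta^-1 * mxdot w z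
   + N Y `^ (p - 2) * mxdot Y Z + delta^-1 * mxdot (gradient Wp y) z) + 0 * Q.
  by rewrite /step_derivative (mxdotZl (b + _)); ring.
apply: cvgD; last by apply: cvgM; [exact: cvg_harmonic|exact: cvg_cst].
apply: cvgD; last by apply: cvgM => //; exact: cvg_cst.
by apply: cvgD => //; exact: cvg_cst.
Qed.

End densities.

(* Strong convexity makes E coercive, bounded subgradients make it locally
   Lipschitz, and the derivative A vanishes at a minimizer. *)
Lemma strongly_convex_critical_point (R : realType) (k : nat) (E : 'rV[R]_k -> R)
    (A : 'rV[R]_k -> 'rV[R]_k -> R) (s : R) :
  0 < s ->
  (forall c d, A c d = \sum_i d 0 i * A c (delta_mx 0 i)) ->
  (forall c c', A c (c' - c) + s * \sum_i (c' - c) 0 i ^+ 2 <= E c' - E c) ->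
  (forall B, exists K, forall c, `|c| <= B -> forall i, `|A c (delta_mx 0 i)| <= K) ->
  (forall c d, (fun j : nat => j.+1%:R * (E (c + j.+1%:R^-1 *: d) - E c)) @ \oo --> A c d) ->
  exists c, forall d, A c d = 0.
Proof.
move=> s0 Alin E1 Abnd E4.
have coord (c : 'rV[R]_k) i : `|c 0 i| <= `|c|.
  by rewrite [leRHS]/Num.norm/= mx_normrE; apply/bigmax_geP; right; exists (0, i).
have Ale (c d : 'rV[R]_k) K : 0 <= K -> (forall i, `|A c (delta_mx 0 i)| <= K) ->
    `|A c d| <= k%:R * K * `|d|.
  move=> K0 hK; rewrite Alin (le_trans (ler_norm_sum _ _ _))//.
  rewrite (@le_trans _ _ (\sum_(i < k) (`|d| * K)))//.
    by apply: ler_sum => i _; rewrite normrM ler_pM.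
  by rewrite sumr_const card_ord -[leLHS]mulr_natl (mulrC `|d|) mulrA.
have Egap c c' : A c (c' - c) <= E c' - E c.
  apply: le_trans (E1 c c'); rewrite lerDl mulr_ge0 ?(ltW s0)//.
  by apply: sumr_ge0 => i _; exact: sqr_ge0.
have [K0 hK0] := Abnd 0.
have {}hK0 i : `|A 0 (delta_mx 0 i)| <= `|K0|.
  by rewrite (le_trans (hK0 0 _ i)) ?normr0// ler_norm.
(* Beyond this radius $s|c|^2$ outweighs the linear term, which is at most $k|K_0||c|$; the added 1
   keeps the radius positive. *)
pose rho := k%:R * `|K0| / s + 1.
have rho0 : 0 < rho by rewrite ltr_wpDl// divr_ge0 ?mulr_ge0// ltW.
have far c : rho < `|c| -> E 0 <= E c.
  move=> rc; rewrite -subr_ge0; apply: le_trans (E1 0 c); rewrite subr0.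
  have := Ale 0 c `|K0| (normr_ge0 _) hK0; rewrite ler_norml => /andP[h _].
  have c2 : `|c| ^+ 2 <= \sum_i c 0 i ^+ 2.
    have c0 : mx_norm c != 0.
      by rewrite gt_eqF// (lt_trans rho0).
    have [i] := mx_norm_neq0 c0; rewrite -[mx_norm c]/(`|c|) => ->.
    rewrite ord1 real_normK ?num_real// (bigD1 i.2)//= lerDl.
    by apply: sumr_ge0 => j _; exact: sqr_ge0.
  have h2 : s * `|c| ^+ 2 <= s * \sum_i c 0 i ^+ 2 by rewrite ler_wpM2l// ltW.
  have h3 : k%:R * `|K0| <= s * `|c|.
    have : k%:R * `|K0| / s <= `|c| by rewrite ltW// (lt_trans _ rc)// ltrDl.
    by rewrite ler_pdivrMr// (mulrC s).
  have h4 : k%:R * `|K0| * `|c| <= s * `|c| ^+ 2.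
    by rewrite expr2 mulrA ler_wpM2r.
  by move: h h2 h4; lra.
have cE : continuous E.
  move=> c; apply: (proj2 (@cvgrPdist_le _ _ _ (nbhs c) (nbhs_filter c) E (E c))) => e e0.
  have [K hK] := Abnd (`|c| + 1).
  pose K' := k%:R * `|K| + 1.
  have K'0 : 0 < K' by rewrite ltr_wpDl// mulr_ge0.
  (* The gap inequality at [a] bounds the difference in one direction only; continuity uses it with
     each of the two points in the role of [a]. *)
  have lip a a' : `|a| <= `|c| + 1 -> E a - E a' <= K' * `|a - a'|.
    move=> ha.
    have hK' i : `|A a (delta_mx 0 i)| <= `|K| by rewrite (le_trans (hK a ha i))// ler_norm.
    have := Ale a (a' - a) `|K| (normr_ge0 _) hK'; rewrite ler_norml => /andP[h _].
    have := Egap a a'; rewrite (distrC a a').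
    have : 0 <= `|a' - a| by [].
    rewrite /K' mulrDl mul1r; lra.
  have nb e1 : 0 < e1 -> \forall c' \near c, `|c - c'| < e1.
    by move=> e10; exact: (proj1 (@cvgrPdist_lt _ _ _ (nbhs c) (nbhs_filter c) id c) cvg_id _ e10).
  near=> c'.
  have cc' : `|c' - c| < 1.
    by rewrite distrC; near: c'; exact: nb.
  have hc' : `|c'| <= `|c| + 1.
    rewrite -[c' in leLHS](subrK c) (le_trans (ler_normD _ _))// addrC lerD2l.
    exact: ltW.
  have hc : `|c| <= `|c| + 1 by rewrite lerDl.
  have d : K' * `|c - c'| <= e.
    rewrite -ler_pdivlMl// ltW//; near: c'; apply: nb.
    by rewrite mulr_gt0// invr_gt0.
  rewrite ler_norml (le_trans (lip _ _ hc) d) andbT lerNl opprB.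
  by rewrite (le_trans (lip _ _ hc'))// distrC.
pose ball0 := [set c : 'rV[R]_k | `|c| <= rho].
have cb : compact ball0.
  apply: bounded_closed_compact.
    by exists rho; split; [exact: num_real|move=> M rM c /= /le_trans -> //; exact: ltW].
  rewrite (_ : ball0 = (fun c : 'rV[R]_k => `|c|) @^-1` [set t | t <= rho])//.
  by apply: closed_comp => [c _|]; [exact: norm_continuous|exact: closed_le].
have b0 : ball0 0 by rewrite /ball0/= normr0 ltW.
have [c cball cmin] : exists2 c, ball0 c & forall c', ball0 c' -> E c <= E c'.
  have [c] := @compact_EVT_min _ _ E ball0 (ex_intro _ 0 b0) cb (continuous_subspaceT cE).
  by rewrite inE => cB h; exists c => // c' hc'; apply: h; rewrite inE.
have gmin c' : E c <= E c'.
  have [h|h] := leP `|c'| rho; first exact: cmin.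
  exact: le_trans (cmin 0 b0) (far _ h).
(* At a minimizer the quotients are nonnegative, hence so is their limit; linearity in [d] then
   gives the opposite sign. *)
have pos d : 0 <= A c d.
  have c0 : (fun _ : nat => 0 : R) @ \oo --> (0 : R) by exact: cvg_cst.
  apply: (ler_cvg_to c0 (E4 c d)); apply: nearW => j /=.
  by rewrite mulr_ge0// subr_ge0 gmin.
exists c => d; apply/eqP; rewrite eq_le pos andbT.
have := pos (- d); rewrite Alin [A c d]Alin -oppr_le0 -sumrN.
by rewrite (eq_bigr (fun i => d 0 i * A c (delta_mx 0 i)))// => i _; rewrite mxE mulNr opprK.
Unshelve. all: by end_near. Qed.

(** * Measurability of fields and rules for real-valued integrals *)

Section measurable_fields.
Variables (R : realType) (m : nat) (A : set 'rV[R]_m).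
Hypothesis mA : measurable A.

Lemma measurable_mxdot a b (F G : 'rV[R]_m -> 'M[R]_(a, b)) :
  (forall i j, measurable_fun A (fun x => F x i j)) ->
  (forall i j, measurable_fun A (fun x => G x i j)) ->
  measurable_fun A (fun x => mxdot (F x) (G x)).
Proof.
move=> mF mG; apply: measurable_sum => i; apply: measurable_sum => j.
exact: measurable_funM.
Qed.

Lemma measurable_mxscale a b (f : 'rV[R]_m -> R) (F : 'rV[R]_m -> 'M[R]_(a, b)) :
  measurable_fun A f -> (forall i j, measurable_fun A (fun x => F x i j)) ->
  forall i j, measurable_fun A (fun x => (f x *: F x) i j).
Proof. by move=> mf mF i j; under eq_fun do rewrite mxE; exact: measurable_funM. Qed.

Lemma measurable_mxsub a b (F G : 'rV[R]_m -> 'M[R]_(a, b)) :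
  (forall i j, measurable_fun A (fun x => F x i j)) ->
  (forall i j, measurable_fun A (fun x => G x i j)) ->
  forall i j, measurable_fun A (fun x => (F x - G x) i j).
Proof. by move=> mF mG i j; under eq_fun do rewrite !mxE; exact: measurable_funB. Qed.

Lemma measurable_reg_norm n (p eps : R) (Y : 'rV[R]_m -> 'M[R]_(n, m)) :
  (forall i j, measurable_fun A (fun x => Y x i j)) ->
  measurable_fun A (fun x => reg_norm p eps (Y x)).
Proof.
move=> mY; rewrite /reg_norm; under eq_fun do rewrite fnorm_sqr.
apply: (measurableT_comp (f := @Num.sqrt R)).
  by apply: continuous_measurable_fun; exact: sqrt_continuous.
by apply: measurable_funD => //; exact: measurable_mxdot.
Qed.

Lemma measurable_rv_comp n (f : 'rV[R]_n -> R) (y : 'rV[R]_m -> 'rV[R]_n) :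
  measurable_fun setT f -> (forall i j, measurable_fun A (fun x => y x i j)) ->
  measurable_fun A (fun x => f (y x)).
Proof.
move=> mf my; apply: (measurableT_comp mf).
apply: (@measurability _ _ _ _ A _ (@rv_cylinders R n)) => //.
by move=> _ [_ [i [B [mB ->]]] <-]; exact: (my 0 i).
Qed.

End measurable_fields.

Section real_integrals.
Variables (d : measure_display) (T : measurableType d) (R : realType).
Variables (mu : {measure set T -> \bar R}) (D : set T).
Hypothesis mD : measurable D.

Lemma dominated_integrable_real (f h : T -> R) : measurable_fun D f ->
  (forall x, D x -> `|f x| <= h x) -> mu.-integrable D (EFin \o h) ->
  mu.-integrable D (EFin \o f).
Proof.
move=> mf fh; apply: le_integrable => //; first exact/measurable_EFinP.
by move=> x Dx /=; rewrite lee_fin (le_trans (fh _ Dx))// ler_norm.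
Qed.

Lemma integrable_add (f h : T -> R) : mu.-integrable D (EFin \o f) ->
  mu.-integrable D (EFin \o h) -> mu.-integrable D (EFin \o (fun x => f x + h x)).
Proof.
move=> i1 i2; have := integrableD mD i1 i2.
by apply: eq_integrable => // x _; rewrite /= EFinD.
Qed.

Lemma integrable_bigsum (I : Type) (s : seq I) (f : I -> T -> R) :
  (forall i, mu.-integrable D (EFin \o f i)) ->
  mu.-integrable D (EFin \o (fun x => \sum_(i <- s) f i x)).
Proof.
move=> hf; elim: s => [|i s IH].
  by rewrite (_ : _ \o _ = cst 0%E); [exact: integrable0|apply/funext => x /=; rewrite big_nil].
rewrite (_ : (fun=> _) = fun x => f i x + \sum_(i <- s) f i x); first exact: integrable_add.
by apply/funext => x; rewrite big_cons.
Qed.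

Lemma Rintegral_bigsum (I : Type) (s : seq I) (f : I -> T -> R) :
  (forall i, mu.-integrable D (EFin \o f i)) ->
  \int[mu]_(x in D) (\sum_(i <- s) f i x) = \sum_(i <- s) \int[mu]_(x in D) f i x.
Proof.
move=> hf; elim: s => [|i s IH].
  under eq_Rintegral do rewrite big_nil.
  by rewrite big_nil Rintegral_cst// mul0r.
under eq_Rintegral do rewrite big_cons.
by rewrite RintegralD ?IH ?big_cons//; exact: integrable_bigsum.
Qed.

Lemma Rintegral_dominated (f_ : nat -> T -> R) (f h : T -> R) :
  (forall k, measurable_fun D (f_ k)) -> measurable_fun D f ->
  (forall k x, D x -> `|f_ k x| <= h x) -> mu.-integrable D (EFin \o h) ->
  (forall x, D x -> (fun k => f_ k x) @ \oo --> f x) ->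
  (fun k => \int[mu]_(x in D) f_ k x) @ \oo --> \int[mu]_(x in D) f x.
Proof.
move=> mf_ mf fh ih cf.
have [] := @dominated_convergence _ _ _ mu D mD (fun k => EFin \o f_ k) (EFin \o f) (EFin \o h).
- by move=> k; exact/measurable_EFinP.
- exact/measurable_EFinP.
- by apply: aeW => x Dx; apply: cvg_EFin; [exact: nearW|exact: cf].
- exact: ih.
- by apply: aeW => x k Dx /=; rewrite lee_fin fh.
move=> i1 _ hc; apply: fine_cvg.
by rewrite fineK//; exact: integrable_fin_num.
Qed.

End real_integrals.

Lemma fin_bounded (R : realType) (T : Type) (I : finType) (D : set T) (f : I -> T -> R) :
  (forall i, exists C, forall x, D x -> `|f i x| <= C) ->
  exists2 C, 0 <= C & forall i x, D x -> `|f i x| <= C.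
Proof.
move=> /choice[C hC]; exists (\sum_i `|C i|); first exact: sumr_ge0.
move=> i x Dx; rewrite (le_trans (hC i x Dx))// (le_trans (ler_norm _))//.
by rewrite (bigD1 i)//= lerDl sumr_ge0.
Qed.

(** * The step functional and the energy as integrals over the core *)

Section step_integrals.
Variables (R : realType) (m n : nat) (Omega : set 'rV[R]_m).
Variables (Th : seq 'M[R]_(m.+1, m)) (r : nat).
Hypotheses (oO : open Omega) (bO : bounded_set Omega).
Variables (p alpha eps delta lambda tau : R).
Variables (Wp Wm : 'rV[R]_n -> R).
Hypotheses (p1 : 1 <= p) (eps0 : 0 < eps) (delta0 : 0 < delta) (lambda0 : 0 < lambda).
Hypothesis tau0 : 0 < tau.
Hypotheses (cWp : convex_function setT Wp) (cWm : convex_function setT Wm).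
Hypotheses (dWp : forall y : 'rV[R]_n, differentiable Wp y)
           (dWm : forall y : 'rV[R]_n, differentiable Wm y).
Hypothesis hF : forall y : 'rV[R]_n, potential y = Wp y - Wm y.
Variable g : 'rV[R]_m -> 'rV[R]_n.
Hypothesis hg : L2 Omega g.
Variable E : nat -> set 'rV[R]_m.
Hypothesis coreE : core Omega Th E.
Let mu := lebesgue_rv R m.
Let Vh := @fe_space R m Omega Th r n.
Let D := \bigcup_k E k.
Let mD : measurable D. Proof. exact: (core_measurable coreE). Qed.
Let Dfin : (mu D < +oo)%E. Proof. exact: (core_lty oO bO coreE). Qed.
Let mO : measurable Omega. Proof. exact: open_measurable_rv. Qed.
Let DO : D `<=` Omega. Proof. exact: (core_sub coreE). Qed.
Implicit Types u v w : 'rV[R]_m -> 'rV[R]_n.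

Let mOg i j : measurable_fun Omega (fun x => g x i j).
Proof. by have [] := hg i j. Qed.
Let mg i j : measurable_fun D (fun x => g x i j).
Proof. exact: (measurable_funS mO DO). Qed.
Let mOv v i j : Vh v -> measurable_fun Omega (fun x => v x i j).
Proof. by move=> /fe_L2 /(_ i j) []. Qed.
Let mv v i j : Vh v -> measurable_fun D (fun x => v x i j).
Proof. by move=> Vv; apply: (measurable_funS mO DO); exact: mOv. Qed.
Let mOG v i j : Vh v -> measurable_fun Omega (fun x => grad Omega v x i j).
Proof. by move=> /fe_weak_gradient [/(_ i j) []]. Qed.
Let mG v i j : Vh v -> measurable_fun D (fun x => cgrad v x i j).
Proof. by move=> Vv; have [] := cgrad_bounded bO coreE i j Vv. Qed.

Lemma fe_uniform_bound v : Vh v -> exists2 B, 0 <= B & forall x, D x ->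
  (forall i, `|v x 0 i| <= B) /\ (forall i j, `|cgrad v x i j| <= B).
Proof.
move=> Vv.
have [B1 B10 h1] : exists2 C, 0 <= C & forall i x, D x -> `|v x 0 i| <= C.
  by apply: (@fin_bounded _ _ _ D (fun i x => v x 0 i)) => i; have [] := fe_bounded bO coreE i Vv.
have [B2 B20 h2] : exists2 C, 0 <= C & forall (ij : 'I_n * 'I_m) x, D x -> `|cgrad v x ij.1 ij.2| <= C.
  apply: (@fin_bounded _ _ _ D (fun (ij : 'I_n * 'I_m) x => cgrad v x ij.1 ij.2)) => ij.
  by have [] := cgrad_bounded bO coreE ij.1 ij.2 Vv.
exists (B1 + B2); first exact: addr_ge0.
move=> x Dx; split => [i|i j]; first by rewrite (le_trans (h1 i x Dx))// lerDl.
by rewrite (le_trans (h2 (i, j) x Dx))// lerDr.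
Qed.

(** Integrable since [g] is square integrable on a set of finite measure; it dominates the step
    derivative and its difference quotients. *)
Definition g_weight (x : 'rV[R]_m) : R := 1 + \sum_i `|g x 0 i|.

Let ig i : mu.-integrable D (EFin \o (fun x => g x 0 i)).
Proof.
have [mgi ig2] := hg 0 i; apply: (integrableS mO) => //.
by apply: L2_integrable => //; exact: bounded_lebesgue_rv_lty.
Qed.

Let cst_int (c : R) : mu.-integrable D (EFin \o (fun=> c)).
Proof. by apply: measurable_bounded_integrable => //; exact: bounded_cst. Qed.

Lemma g_weight_integrable : mu.-integrable D (EFin \o g_weight).
Proof.
apply: integrable_add => //; apply: integrable_bigsum => // i.
exact: integrable_norm.
Qed.

Let ig2 : mu.-integrable D (EFin \o (fun x => mxdot (g x) (g x))).
Proof.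
rewrite /mxdot; under eq_fun do rewrite big_ord1.
apply: integrable_bigsum => // i; under eq_fun do rewrite -expr2.
by apply: (integrableS mO) => //; have [] := hg 0 i.
Qed.

Let bounded_int (f : 'rV[R]_m -> R) (C : R) : measurable_fun D f ->
  (forall x, D x -> `|f x| <= C) -> mu.-integrable D (EFin \o f).
Proof. by move=> mf fC; apply: dominated_integrable_real fC (cst_int C). Qed.

Lemma measurable_gradient_comp (W : 'rV[R]_n -> R) (A : set 'rV[R]_m) v : measurable A ->
  (forall y : 'rV[R]_n, differentiable W y) ->
  (forall i j, measurable_fun A (fun x => v x i j)) ->
  forall i j, measurable_fun A (fun x => gradient W (v x) i j).
Proof.
move=> mA dW mv' i j; rewrite (ord1 i).
by apply: (@measurable_rv_comp R m A mA n (fun y => gradient W y 0 j) v) => //; exact: measurable_gradient.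
Qed.

Let sden := @step_density R m n p alpha eps delta lambda tau Wp.
Let sder := @step_derivative R m n p alpha eps delta lambda tau Wp.
Let eden := @energy_density R m n p alpha eps delta lambda.

Let msder A (y0 w y z : 'rV[R]_m -> 'rV[R]_n) (Y Z : 'rV[R]_m -> 'M[R]_(n, m)) : measurable A ->
  (forall i j, measurable_fun A (fun x => g x i j)) ->
  (forall i j, measurable_fun A (fun x => y0 x i j)) ->
  (forall i j, measurable_fun A (fun x => w x i j)) ->
  (forall i j, measurable_fun A (fun x => y x i j)) ->
  (forall i j, measurable_fun A (fun x => z x i j)) ->
  (forall i j, measurable_fun A (fun x => Y x i j)) ->
  (forall i j, measurable_fun A (fun x => Z x i j)) ->
  [/\ measurable_fun A (fun x => mxdot (tau^-1 *: (y x - y0 x)) (z x)),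
      measurable_fun A (fun x => mxdot ((b_coef alpha eps + reg_norm p eps (Y x) `^ (p - 2)) *: Y x) (Z x)),
      measurable_fun A (fun x => mxdot (y x - g x) (z x)),
      measurable_fun A (fun x => mxdot (gradient Wp (y x)) (z x)) &
      measurable_fun A (fun x => mxdot (w x) (z x))].
Proof.
move=> mA m1 m2 m3 m4 m5 m6 m7; split; apply: measurable_mxdot => //.
- by apply: (measurable_mxscale (f := fun=> tau^-1)) => //; exact: measurable_mxsub.
- apply: measurable_mxscale => //; apply: measurable_funD => //.
  by apply: (measurableT_comp (measurable_powR _)); exact: measurable_reg_norm.
- exact: measurable_mxsub.
- exact: measurable_gradient_comp.
Qed.

Let fd u0 u v x := sder (u0 x) (g x) (gradient Wm (u0 x)) (u x) (cgrad u x) (v x) (cgrad v x).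
Let fe u0 u x := sden (u0 x) (g x) (gradient Wm (u0 x)) (u x) (cgrad u x).

Lemma step_derivative_dominated u0 (B : R) : Vh u0 -> 0 <= B -> exists2 K, 0 <= K &
  forall x (y : 'rV[R]_n) (Y : 'M[R]_(n, m)) (z : 'rV[R]_n) (Z : 'M[R]_(n, m)),
    D x -> (forall i, `|y 0 i| <= B) -> (forall i j, `|Y i j| <= B) ->
    (forall i, `|z 0 i| <= B) -> (forall i j, `|Z i j| <= B) ->
    `|sder (u0 x) (g x) (gradient Wm (u0 x)) y Y z Z| <= K * g_weight x.
Proof.
move=> V0 B0; have [B1 B10 h1] := fe_uniform_bound V0.
have [C hC] := gradient_bounded cWm dWm B1.
(* One constant has to serve the arguments, [u0], and the gradient of [Wm] at [u0]. *)
pose B' := B + B1 + `|C|.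
have B'0 : 0 <= B' by rewrite !addr_ge0.
have [K K0 hK] := @step_derivative_bounded R m n p alpha eps delta lambda tau Wp
  eps0 delta0 lambda0 tau0 cWp dWp B' B'0.
have le0 : B <= B' by rewrite /B' -addrA lerDl addr_ge0.
have le1 : B1 <= B' by rewrite /B' addrAC lerDr addr_ge0.
have le2 : C <= B' by rewrite (le_trans (ler_norm C))// lerDr addr_ge0.
exists K => // x y Y z Z Dx hy hY hz hZ; have [h2 _] := h1 x Dx.
apply: hK => [i|i|i|i j|i|i j].
- exact: le_trans (h2 i) le1.
- exact: le_trans (hC _ h2 i) le2.
- exact: le_trans (hy i) le0.
- exact: le_trans (hY i j) le0.
- exact: le_trans (hz i) le0.
- exact: le_trans (hZ i j) le0.
Qed.

Let mfd u0 u v : Vh u0 -> Vh u -> Vh v -> measurable_fun D (fd u0 u v).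
Proof.
move=> V0 Vu Vv.
have mw := measurable_gradient_comp mD dWm (fun i j => mv i j V0).
have [h1 h2 h3 h4 h5] := msder mD mg (fun i j => mv i j V0) mw (fun i j => mv i j Vu)
  (fun i j => mv i j Vv) (fun i j => mG i j Vu) (fun i j => mG i j Vv).
apply: measurable_funB; last exact: measurable_funM.
apply: measurable_funD; last exact: measurable_funM.
apply: measurable_funD; last exact: measurable_funM.
exact: measurable_funD.
Qed.

Let bound2 u v : Vh u -> Vh v -> exists2 B, 0 <= B & forall x, D x ->
  [/\ forall i, `|u x 0 i| <= B, forall i j, `|cgrad u x i j| <= B,
      forall i, `|v x 0 i| <= B & forall i j, `|cgrad v x i j| <= B].
Proof.
move=> /fe_uniform_bound[B1 B10 h1] /fe_uniform_bound[B2 B20 h2].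
exists (B1 + B2) => [|x Dx]; first exact: addr_ge0.
have [a1 a2] := h1 x Dx; have [a3 a4] := h2 x Dx.
by split => [i|i j|i|i j]; [apply: le_trans (a1 _) _|apply: le_trans (a2 _ _) _
  |apply: le_trans (a3 _) _|apply: le_trans (a4 _ _) _]; rewrite ?lerDl ?lerDr.
Qed.

Lemma step_derivative_int u0 u v : Vh u0 -> Vh u -> Vh v ->
  mu.-integrable D (EFin \o fd u0 u v).
Proof.
move=> V0 Vu Vv; have [B B0 hB] := bound2 Vu Vv.
have [K K0 hK] := step_derivative_dominated V0 B0.
apply: (@dominated_integrable_real _ _ _ mu D mD _ (fun x => K * g_weight x)).
- exact: mfd.
- by move=> x Dx; have [? ? ? ?] := hB x Dx; exact: hK.
- by apply: integrable_scale => //; exact: g_weight_integrable.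
Qed.

Let msden u0 (y : 'rV[R]_m -> 'rV[R]_n) (Y : 'rV[R]_m -> 'M[R]_(n, m)) : Vh u0 ->
  (forall i j, measurable_fun D (fun x => y x i j)) ->
  (forall i j, measurable_fun D (fun x => Y x i j)) ->
  measurable_fun D (fun x => sden (u0 x) (g x) (gradient Wm (u0 x)) (y x) (Y x)).
Proof.
move=> V0 my mY.
have m0 i j := mv i j V0.
have mw := measurable_gradient_comp mD dWm m0.
apply: measurable_funB; last by apply: measurable_funM => //; exact: measurable_mxdot.
apply: measurable_funD; last first.
  by apply: measurable_funM => //; apply: measurable_mxdot; exact: measurable_mxsub.
apply: measurable_funD; last first.
  apply: measurable_funM => //; apply: (measurable_rv_comp mD (continuous_measurable_rv _)) => //.
  exact: convex_continuous.
apply: measurable_funD; last first.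
  apply: measurable_funM => //; apply: (measurableT_comp (measurable_powR _)).
  exact: measurable_reg_norm.
apply: measurable_funD; apply: measurable_funM => //; apply: measurable_mxdot => //; exact: measurable_mxsub.
Qed.

Let mcst a b (C : 'M[R]_(a, b)) i j : measurable_fun D (fun=> C i j).
Proof. exact: measurable_cst. Qed.

(** The tangent inequalities from 0 to [u] and from [u] to 0 place the density within a multiple of
    [g_weight] of its value [e0] at 0. That value is explicit, so no growth estimate for the power
    or for [Wp] is involved. *)
Lemma step_density_int u0 u : Vh u0 -> Vh u -> mu.-integrable D (EFin \o fe u0 u).
Proof.
move=> V0 Vu; have [B B0 hB] := bound2 Vu Vu.
have [K K0 hK] := step_derivative_dominated V0 B0.
have [B1 B10 h1] := fe_uniform_bound V0.
pose e0 x := sden (u0 x) (g x) (gradient Wm (u0 x)) 0 0.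
have me0 : measurable_fun D e0.
  by apply: (@msden u0 (fun=> 0) (fun=> 0)) => //; exact: mcst.
pose c0 : R := p^-1 * reg_norm p eps (0 : 'M[R]_(n, m)) `^ p + delta^-1 * Wp 0.
have e0E x : e0 x = (2 * tau)^-1 * mxdot (u0 x) (u0 x) + c0 + lambda / 2 * mxdot (g x) (g x).
  rewrite /e0 /sden /step_density !sub0r !mxdotNl !mxdotNr !opprK mxdot0l.
  by rewrite (mxdotC _ 0) mxdot0l /c0; ring.
have ie0 : mu.-integrable D (EFin \o (fun x => `|e0 x|)).
  apply: integrable_norm.
  have -> : e0 = (fun x => (2 * tau)^-1 * mxdot (u0 x) (u0 x) + c0 + lambda / 2 * mxdot (g x) (g x)).
    by apply/funext => x; exact: e0E.
  apply: integrable_add => //; last exact: integrable_scale.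
  apply: integrable_add => //; apply: integrable_scale => //.
  apply: (@bounded_int _ ((1 * n)%:R * (B1 * B1))).
    by apply: measurable_mxdot => i j; exact: mv.
  move=> x Dx; have [h2 _] := h1 x Dx.
  by apply: ler_norm_mxdot => i j; rewrite (ord1 i).
apply: (@dominated_integrable_real _ _ _ mu D mD _ (fun x => `|e0 x| + K * g_weight x)).
- by apply: msden => // i j; [exact: mv|exact: mG].
- move=> x Dx; have [b1 b2 _ _] := hB x Dx.
  have t1 := @step_tangent R m n p alpha eps delta lambda tau Wp p1 eps0 delta0 lambda0 tau0
    cWp dWp (u0 x) (g x) (gradient Wm (u0 x)) 0 0 (u x) (cgrad u x).
  have t2 := @step_tangent R m n p alpha eps delta lambda tau Wp p1 eps0 delta0 lambda0 tau0
    cWp dWp (u0 x) (g x) (gradient Wm (u0 x)) (u x) (cgrad u x) 0 0.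
  rewrite !subr0 in t1; rewrite !sub0r in t2.
  have q1 := mxdot_ge0 (u x); have q2 := mxdot_ge0 (- u x).
  have ti : 0 <= (2 * tau)^-1 by rewrite invr_ge0 mulr_ge0// ltW.
  have r1 := mulr_ge0 ti q1; have r2 := mulr_ge0 ti q2.
  have z1 (i : 'I_n) : `|(0 : 'rV[R]_n) 0 i| <= B by rewrite mxE normr0.
  have z2 i j : `|(0 : 'M[R]_(n, m)) i j| <= B by rewrite mxE normr0.
  have n1 (i : 'I_n) : `|(- u x) 0 i| <= B by rewrite mxE normrN.
  have n2 i j : `|(- cgrad u x) i j| <= B by rewrite mxE normrN.
  have := hK x 0 0 (u x) (cgrad u x) Dx z1 z2 b1 b2; rewrite ler_norml => /andP[k1 _].
  have := hK x (u x) (cgrad u x) (- u x) (- cgrad u x) Dx b1 b2 n1 n2; rewrite ler_norml => /andP[k2 _].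
  have l1 := ler_norm (e0 x); have l2 := ler_norm (- e0 x); rewrite normrN in l2.
  rewrite -/sden -/sder -/(e0 x) -/(fe u0 u x) in t1 t2 k1 k2 *.
  by rewrite ler_norml; apply/andP; split; lra.
- by apply: integrable_add => //; apply: integrable_scale => //; exact: g_weight_integrable.
Qed.

(** Written as a combination with coefficient $-1$ so that [fe_comb] and [cgrad_comb] apply as they
    stand. *)
Definition fe_sub v u : 'rV[R]_m -> 'rV[R]_n := fun x => v x + (-1) *: u x.

Lemma fe_subP v u : Vh v -> Vh u -> Vh (fe_sub v u).
Proof. by move=> Vv Vu; exact: (fe_comb oO bO). Qed.

Let fe_subE v u x : fe_sub v u x = v x - u x.
Proof. by rewrite /fe_sub scaleN1r. Qed.

Let cgrad_subE v u x : Vh v -> Vh u -> D x -> cgrad (fe_sub v u) x = cgrad v x - cgrad u x.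
Proof. by move=> Vv Vu Dx; rewrite (cgrad_comb coreE (-1) Vv Vu Dx) scaleN1r. Qed.

Lemma fe_dot_int u v : Vh u -> Vh v -> mu.-integrable D (EFin \o (fun x => mxdot (u x) (v x))).
Proof.
move=> Vu Vv; have [B B0 hB] := bound2 Vu Vv.
apply: (@bounded_int _ ((1 * n)%:R * (B * B))).
  by apply: measurable_mxdot => i j; exact: mv.
move=> x Dx; have [h1 _ h2 _] := hB x Dx.
by apply: ler_norm_mxdot => i j; rewrite (ord1 i).
Qed.

Lemma step_gap u0 u v : Vh u0 -> Vh u -> Vh v ->
  \int[mu]_(x in D) fd u0 u (fe_sub v u) x +
  (2 * tau)^-1 * \int[mu]_(x in D) mxdot (fe_sub v u x) (fe_sub v u x)
  <= \int[mu]_(x in D) fe u0 v x - \int[mu]_(x in D) fe u0 u x.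
Proof.
move=> V0 Vu Vv; have Vs := fe_subP Vv Vu.
have i1 := step_derivative_int V0 Vu Vs; have i2 := fe_dot_int Vs Vs.
have i3 := step_density_int V0 Vv; have i4 := step_density_int V0 Vu.
have i2' := integrable_scale (2 * tau)^-1 mD i2.
rewrite -RintegralZl// -RintegralD// -RintegralB//; apply: le_Rintegral => //.
- exact: integrable_add.
- have := integrableB mD i3 i4.
  by apply: eq_integrable => // x _; rewrite /= EFinB.
move=> x Dx; rewrite /fd cgrad_subE// !fe_subE.
exact: (step_tangent _ p1 eps0 delta0 lambda0 tau0 cWp dWp).
Qed.

Lemma step_derivative_linear u0 u k (d : 'I_k -> R) (v : 'I_k -> 'rV[R]_m -> 'rV[R]_n) :
  Vh u0 -> Vh u -> (forall a, Vh (v a)) ->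
  \int[mu]_(x in D) fd u0 u (fun x => \sum_a d a *: v a x) x =
  \sum_a d a * \int[mu]_(x in D) fd u0 u (v a) x.
Proof.
move=> V0 Vu Vv; have i1 a := step_derivative_int V0 Vu (Vv a).
under [RHS]eq_bigr do rewrite -RintegralZl//.
rewrite -Rintegral_bigsum//; last by move=> a; exact: integrable_scale.
apply: eq_Rintegral => x /set_mem Dx; rewrite /fd (cgrad_sum coreE d Vv Dx).
rewrite /sder /step_derivative !mxdot_sum_r !mulr_sumr -sumrN -!big_split/=.
by apply: eq_bigr => a _; ring.
Qed.

(** Dominated convergence. The tangent inequalities at both ends trap the quotient between the
    derivatives at [u] and at [u + t v], and both are bounded by the same multiple of [g_weight]. *)
Lemma step_derivative_cvg u0 u v : Vh u0 -> Vh u -> Vh v ->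
  (fun j : nat => j.+1%:R * (\int[mu]_(x in D) fe u0 (fun x => u x + j.+1%:R^-1 *: v x) x
     - \int[mu]_(x in D) fe u0 u x)) @ \oo --> \int[mu]_(x in D) fd u0 u v x.
Proof.
move=> V0 Vu Vv; have [B B0 hB] := bound2 Vu Vv.
(* Twice [B] covers the whole segment, because $t\le1$. *)
have BB0 : 0 <= B + B by exact: addr_ge0.
have [K K0 hK] := step_derivative_dominated V0 BB0.
have Vj (j : nat) : Vh (fun x => u x + j.+1%:R^-1 *: v x) by exact: (fe_comb oO bO).
have i4 := step_density_int V0 Vu.
pose q (j : nat) x := j.+1%:R * (fe u0 (fun x => u x + j.+1%:R^-1 *: v x) x - fe u0 u x).
have iB j : mu.-integrable D (EFin \o (fun x => fe u0 (fun x => u x + j.+1%:R^-1 *: v x) x - fe u0 u x)).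
  have := integrableB mD (step_density_int V0 (Vj j)) i4.
  by apply: eq_integrable => // x _; rewrite /= EFinB.
rewrite (_ : (fun j => _) = (fun j => \int[mu]_(x in D) q j x)); last first.
  by apply/funext => j; rewrite /q RintegralZl// RintegralB//; exact: step_density_int.
apply: (@Rintegral_dominated _ _ _ mu D mD _ _ (fun x => K * g_weight x)).
- move=> j; apply/measurable_EFinP.
  by have /integrableP[] := integrable_scale j.+1%:R mD (iB j).
- exact: mfd.
- move=> j x Dx; rewrite /q.
  have [a1 a2 a3 a4] := hB x Dx.
  set t : R := j.+1%:R^-1.
  have t0 : 0 < t by rewrite invr_gt0.
  have t1 : t <= 1 by rewrite invf_le1// ler1n.
  have -> : j.+1%:R = t^-1 by rewrite invrK.
  have cE : cgrad (fun x => u x + t *: v x) x = cgrad u x + t *: cgrad v x.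
    exact: (cgrad_comb coreE t Vu Vv Dx).
  rewrite /fe cE -/sden.
  have tg := @step_tangent R m n p alpha eps delta lambda tau Wp p1 eps0 delta0 lambda0 tau0
    cWp dWp (u0 x) (g x) (gradient Wm (u0 x)).
  have L1 := tg (u x) (cgrad u x) (u x + t *: v x) (cgrad u x + t *: cgrad v x).
  have L2' := tg (u x + t *: v x) (cgrad u x + t *: cgrad v x) (u x) (cgrad u x).
  have s1 : u x + t *: v x - u x = t *: v x by rewrite addrAC subrr add0r.
  have s2 : cgrad u x + t *: cgrad v x - cgrad u x = t *: cgrad v x by rewrite addrAC subrr add0r.
  have s3 : u x - (u x + t *: v x) = (- t) *: v x by rewrite opprD addrA subrr add0r scaleNr.
  have s4 : cgrad u x - (cgrad u x + t *: cgrad v x) = (- t) *: cgrad v x.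
    by rewrite opprD addrA subrr add0r scaleNr.
  rewrite s1 s2 in L1; rewrite s3 s4 in L2'.
  have hom y Y (s : R) z Z : sder (u0 x) (g x) (gradient Wm (u0 x)) y Y (s *: z) (s *: Z) =
      s * sder (u0 x) (g x) (gradient Wm (u0 x)) y Y z Z.
    by rewrite /sder /step_derivative !mxdotZr; ring.
  rewrite -/sder -/sden !hom in L1 L2'.
  have ti : 0 <= (2 * tau)^-1 by rewrite invr_ge0 mulr_ge0// ltW.
  have r1 := mulr_ge0 ti (mxdot_ge0 (t *: v x)).
  have r2 := mulr_ge0 ti (mxdot_ge0 ((- t) *: v x)).
  have bb (c e : R) : `|c| <= B -> `|e| <= B -> `|c + t * e| <= B + B.
    move=> hc he; rewrite (le_trans (ler_normD _ _))// lerD// normrM (gtr0_norm t0).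
    by rewrite -[leRHS]mul1r ler_pM// ltW.
  have BBB : B <= B + B by rewrite lerDl.
  have c1 (i : 'I_n) : `|(u x + t *: v x) 0 i| <= B + B by rewrite !mxE bb.
  have c2 i l : `|(cgrad u x + t *: cgrad v x) i l| <= B + B.
    have -> : (cgrad u x + t *: cgrad v x) i l = cgrad u x i l + t * cgrad v x i l.
      by rewrite [LHS]mxE [X in _ + X = _]mxE.
    exact: bb.
  have a1' i := le_trans (a1 i) BBB; have a3' i := le_trans (a3 i) BBB.
  have a2' i l := le_trans (a2 i l) BBB; have a4' i l := le_trans (a4 i l) BBB.
  have := hK x _ _ _ _ Dx a1' a2' a3' a4'; rewrite ler_norml => /andP[k1 _].
  have := hK x _ _ _ _ Dx c1 c2 a3' a4'; rewrite ler_norml => /andP[_ k2].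
  rewrite ler_norml; apply/andP; split.
    rewrite ler_pdivlMl//; apply: le_trans (_ : t * sder (u0 x) (g x) (gradient Wm (u0 x)) (u x) (cgrad u x) (v x) (cgrad v x) <= _).
      by rewrite ler_wpM2l// ltW.
    by move: L1 r1; lra.
  rewrite ler_pdivrMl//; apply: le_trans (_ : _ <= t * sder (u0 x) (g x) (gradient Wm (u0 x)) (u x + t *: v x) (cgrad u x + t *: cgrad v x) (v x) (cgrad v x)) _.
    by move: L2' r2; lra.
  by rewrite ler_wpM2l// ltW.
- by apply: integrable_scale => //; exact: g_weight_integrable.
- move=> x Dx.
  suff : (fun j : nat => j.+1%:R * (sden (u0 x) (g x) (gradient Wm (u0 x))
      (u x + j.+1%:R^-1 *: v x) (cgrad u x + j.+1%:R^-1 *: cgrad v x)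
      - sden (u0 x) (g x) (gradient Wm (u0 x)) (u x) (cgrad u x))) @ \oo --> fd u0 u v x.
  2: by apply: step_density_cvg.
  apply: cvg_trans; apply: near_eq_cvg; apply: nearW => j.
  by rewrite /q /fe (cgrad_comb coreE _ Vu Vv Dx).
Qed.

(** Merging the five integrals into one requires each integrand to be integrable. Four of them are
    bounded on [D]; the one containing [g] is dominated by [g_weight]. *)
Lemma scheme_step u0 u v : Vh u0 -> Vh u -> Vh v ->
  L2dot Omega (dt tau u0 u) v + L2dot Omega (flux Omega p alpha eps u) (grad Omega v)
  + lambda * L2dot Omega (fun x => u x - g x) v
  + delta^-1 * L2dot Omega (fun x => gradient Wp (u x)) v
  - delta^-1 * L2dot Omega (fun x => gradient Wm (u0 x)) v = \int[mu]_(x in D) fd u0 u v x.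
Proof.
move=> V0 Vu Vv.
have mw := measurable_gradient_comp mD dWm (fun i j => mv i j V0).
have mwO := measurable_gradient_comp mO dWm (fun i j => mOv i j V0).
have [h1 h2 h3 h4 h5] := msder mD mg (fun i j => mv i j V0) mw (fun i j => mv i j Vu)
  (fun i j => mv i j Vv) (fun i j => mG i j Vu) (fun i j => mG i j Vv).
have [z1 z2 z3 z4 z5] := msder mO mOg (fun i j => mOv i j V0) mwO (fun i j => mOv i j Vu)
  (fun i j => mOv i j Vv) (fun i j => mOG i j Vu) (fun i j => mOG i j Vv).
have ae_same (f : 'rV[R]_m -> R) : {ae mu, forall x, D x -> f x = f x} by exact: aeW.
rewrite /L2dot /dt /flux.
rewrite (Rintegral_core oO coreE z1 h1 (ae_same _)) (Rintegral_core oO coreE z3 h3 (ae_same _)).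
rewrite (Rintegral_core oO coreE z4 h4 (ae_same _)) (Rintegral_core oO coreE z5 h5 (ae_same _)).
have ae2 : {ae mu, forall x, D x ->
    mxdot ((b_coef alpha eps + reg_norm p eps (grad Omega u x) `^ (p - 2)) *: grad Omega u x) (grad Omega v x)
  = mxdot ((b_coef alpha eps + reg_norm p eps (cgrad u x) `^ (p - 2)) *: cgrad u x) (cgrad v x)}.
  apply: (@filterS2 _ _ _ _ _ _ _ (grad_ae oO bO coreE Vu) (grad_ae oO bO coreE Vv)) => x hu hv Dx.
  by rewrite hu// hv.
rewrite (Rintegral_core oO coreE z2 h2 ae2).
have [B B0 hB] := bound2 Vu Vv; have [B1 B10 hB1] := fe_uniform_bound V0.
have [C1 hC1] := gradient_bounded cWp dWp B; have [C2 hC2] := gradient_bounded cWm dWm B1.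
have [C3 hC3] := @reg_norm_pow_bounded R m n p eps eps0 B.
have row (y : 'rV[R]_n) (c : R) : (forall i, `|y 0 i| <= c) -> forall i j, `|y i j| <= c.
  by move=> hu i j; rewrite ord1.
have i1 : mu.-integrable D (EFin \o (fun x => mxdot (tau^-1 *: (u x - u0 x)) (v x))).
  apply: (@bounded_int _ ((1 * n)%:R * ((`|tau^-1| * (B + B1)) * B))) => // x Dx.
  have [a1 _ a3 _] := hB x Dx; have [a0 _] := hB1 x Dx.
  apply: ler_norm_mxdot; apply: row => // i; rewrite !mxE normrM ler_wpM2l//.
  by rewrite (le_trans (ler_normB _ _))// lerD.
have i2 : mu.-integrable D (EFin \o (fun x => mxdot ((b_coef alpha eps + reg_norm p eps (cgrad u x) `^ (p - 2)) *: cgrad u x) (cgrad v x))).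
  apply: (@bounded_int _ ((n * m)%:R * (((b_coef alpha eps + `|C3|) * B) * B))) => // x Dx.
  have [_ a2 _ a4] := hB x Dx.
  apply: ler_norm_mxdot => // i j; rewrite mxE normrM; apply: ler_pM; rewrite ?normr_ge0 ?a2//.
  rewrite ger0_norm ?addr_ge0 ?powR_ge0// lerD2l.
  by rewrite (le_trans (hC3 _ a2))// ler_norm.
have i4 : mu.-integrable D (EFin \o (fun x => mxdot (gradient Wp (u x)) (v x))).
  apply: (@bounded_int _ ((1 * n)%:R * (C1 * B))) => // x Dx; have [a1 _ a3 _] := hB x Dx.
  by apply: ler_norm_mxdot; apply: row => // i; exact: hC1.
have i5 : mu.-integrable D (EFin \o (fun x => mxdot (gradient Wm (u0 x)) (v x))).
  apply: (@bounded_int _ ((1 * n)%:R * (C2 * B))) => // x Dx; have [_ _ a3 _] := hB x Dx; have [a0 _] := hB1 x Dx.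
  by apply: ler_norm_mxdot; apply: row => // i; exact: hC2.
have i3 : mu.-integrable D (EFin \o (fun x => mxdot (u x - g x) (v x))).
  apply: (@dominated_integrable_real _ _ _ mu D mD _ (fun x => ((1 * n)%:R * (B * B) + B) * g_weight x)) => //.
    move=> x Dx; have [a1 _ a3 _] := hB x Dx; rewrite mxdotDl mxdotNl.
    set S := \sum_i `|g x 0 i|; have S0 : 0 <= S by apply: sumr_ge0.
    have e1 : `|mxdot (u x) (v x)| <= (1 * n)%:R * (B * B) by apply: ler_norm_mxdot; exact: row.
    have e2 : `|mxdot (g x) (v x)| <= B * S.
      rewrite /mxdot big_ord1 (le_trans (ler_norm_sum _ _ _))// mulr_sumr.
      by apply: ler_sum => i _; rewrite normrM mulrC ler_wpM2r.
    rewrite (le_trans (ler_normB _ _))// (le_trans (lerD e1 e2))// /g_weight -/S mulrDl.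
    rewrite mulrDr mulr1 (mulrDr B) mulr1 lerD//; first by rewrite lerDl !mulr_ge0.
    by rewrite lerDr.
  by apply: integrable_scale => //; exact: g_weight_integrable.
have j3 := integrable_scale lambda mD i3; have j4 := integrable_scale delta^-1 mD i4.
have j5 := integrable_scale delta^-1 mD i5.
have j12 := integrable_add mD i1 i2; have j123 := integrable_add mD j12 j3.
have j1234 := integrable_add mD j123 j4.
have e5 := RintegralB mD j1234 j5; have e4 := RintegralD mD j123 j4.
have e3 := RintegralD mD j12 j3; have e2 := RintegralD mD i1 i2.
have s3 := RintegralZl lambda mD i3; have s4 := RintegralZl delta^-1 mD i4.
have s5 := RintegralZl delta^-1 mD i5.
apply/esym; rewrite /fd /sder /step_derivative.
exact: (etrans e5 (f_equal2 (fun a c : R => a - c)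
  (etrans e4 (f_equal2 +%R (etrans e3 (f_equal2 +%R e2 s3)) s4)) s5)).
Qed.

(** The energy density is the step density with previous value 0, up to the time term, [Wm] and a
    linear term, all bounded on [D]. Integrability is inherited from there. *)
Lemma energy_core v : Vh v -> energy Omega p alpha eps delta lambda g v =
  \int[mu]_(x in D) eden (g x) (v x) (cgrad v x) /\
  mu.-integrable D (EFin \o (fun x => eden (g x) (v x) (cgrad v x))).
Proof.
move=> Vv.
have meas (A : set 'rV[R]_m) (Y : 'rV[R]_m -> 'M[R]_(n, m)) : measurable A ->
    (forall i j, measurable_fun A (fun x => g x i j)) ->
    (forall i j, measurable_fun A (fun x => v x i j)) ->
    (forall i j, measurable_fun A (fun x => Y x i j)) ->
    measurable_fun A (fun x => eden (g x) (v x) (Y x)).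
  move=> mA m1 m2 m3; rewrite /eden /energy_density.
  under eq_fun do rewrite !fnorm_sqr hF.
  apply: measurable_funD; last first.
    by apply: measurable_funM => //; apply: measurable_mxdot; exact: measurable_mxsub.
  apply: measurable_funD; last first.
    apply: measurable_funM => //; apply: measurable_funB;
      apply: (measurable_rv_comp mA (continuous_measurable_rv _)) => //; exact: convex_continuous.
  apply: measurable_funD; first by apply: measurable_funM => //; exact: measurable_mxdot.
  apply: measurable_funM => //; apply: (measurableT_comp (measurable_powR _)).
  exact: measurable_reg_norm.
split.
  apply: (Rintegral_core oO coreE) => //.
  - by apply: (meas Omega (grad Omega v)) => // i j; [exact: mOv|exact: mOG].
  - by apply: meas => // i j; [exact: mv|exact: mG].
  - by have := grad_ae oO bO coreE Vv; apply: filterS => x hx Dx; rewrite hx.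
have V0 : Vh (fun=> 0) by exact: fe_zero.
have i1 := step_density_int V0 Vv.
have [B B0 hB] := fe_uniform_bound Vv.
have [C hC] := @continuous_bounded_cube R n Wm B (convex_continuous dWm).
have i2 : mu.-integrable D (EFin \o (fun x => delta^-1 * Wm (v x))).
  apply: integrable_scale => //; apply: (@bounded_int _ C).
    apply: (measurable_rv_comp mD (continuous_measurable_rv _)) => [|i j]; last exact: mv.
    exact: convex_continuous.
  move=> x Dx; apply: hC => i /=; rewrite in_itv/= -ler_norml.
  by have [] := hB x Dx.
have i3 : mu.-integrable D (EFin \o (fun x => mxdot (gradient Wm 0) (v x))).
  apply: (@bounded_int _ ((1 * n)%:R * ((\sum_i `|gradient Wm 0 0 i|) * B))).
    by apply: measurable_mxdot => // i j; exact: mv.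
  move=> x Dx; have [a1 _] := hB x Dx; apply: ler_norm_mxdot => i j; rewrite (ord1 i) //.
  by rewrite (bigD1 j)//= lerDl sumr_ge0.
have i4 := fe_dot_int Vv Vv.
have := integrable_add mD (integrable_add mD i1 (integrable_scale (- 1) mD i2))
  (integrable_add mD (integrable_scale delta^-1 mD i3) (integrable_scale (- (2 * tau)^-1) mD i4)).
apply: eq_integrable => // x _ /=; congr (_%:E).
rewrite /fe /sden /step_density /eden /energy_density !fnorm_sqr hF subr0; ring.
Qed.

(** The increment [u - u0] is the test function. The time term is kept whole, so the weight is
    [tau], twice the one finally claimed. *)
Lemma energy_step u0 u : Vh u0 -> Vh u -> (forall v, Vh v -> \int[mu]_(x in D) fd u0 u v x = 0) ->
  tau * L2norm Omega (dt tau u0 u) ^+ 2 + energy Omega p alpha eps delta lambda g u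
  <= energy Omega p alpha eps delta lambda g u0.
Proof.
move=> V0 Vu hs; have Vs := fe_subP Vu V0.
have [-> i1] := energy_core Vu; have [-> i2] := energy_core V0.
have i3 := fe_dot_int Vs Vs; have i4 := step_derivative_int V0 Vu Vs.
have -> : tau * L2norm Omega (dt tau u0 u) ^+ 2 =
    \int[mu]_(x in D) (tau^-1 * mxdot (fe_sub u u0 x) (fe_sub u u0 x)).
  rewrite /L2norm sqr_sqrtr; last by apply: Rintegral_ge0 => x _; exact: mxdot_ge0.
  have E1 x : mxdot (dt tau u0 u x) (dt tau u0 u x) = tau^-1 * (tau^-1 * mxdot (fe_sub u u0 x) (fe_sub u u0 x)).
    by rewrite /dt mxdotZl mxdotZr fe_subE.
  rewrite /L2dot (@Rintegral_core _ _ _ _ oO _ coreE _ (fun x => tau^-1 * (tau^-1 * mxdot (fe_sub u u0 x) (fe_sub u u0 x)))).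
  - rewrite RintegralZl//; last exact: integrable_scale.
    by rewrite mulrA mulfV ?mul1r// gt_eqF.
  - under eq_fun do rewrite E1.
    apply: measurable_funM => //; apply: measurable_funM => //.
    by apply: measurable_mxdot => i j; exact: mOv.
  - apply: measurable_funM => //; apply: measurable_funM => //.
    by apply: measurable_mxdot => i j; exact: mv.
  - by apply: aeW => x _; exact: E1.
have i3' := integrable_scale tau^-1 mD i3.
rewrite -subr_le0 -(hs _ Vs) -(RintegralD mD i3' i1) -(RintegralB mD (integrable_add mD i3' i1) i2).
apply: le_Rintegral => //.
- have := integrableB mD (integrable_add mD i3' i1) i2.
  by apply: eq_integrable => // x _; rewrite /= EFinB.
- move=> x Dx; rewrite /fd cgrad_subE// !fe_subE.
  rewrite (addrC (tau^-1 * _)).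
  by apply: energy_tangent.
Qed.

End step_integrals.

(** * Finite dimension of the finite element space *)

Section dimension.
Variables (R : realType) (m n : nat) (Omega : set 'rV[R]_m).
Variables (Th : seq 'M[R]_(m.+1, m)) (r : nat).
Hypothesis cover : closure Omega = \bigcup_(K in [set` Th]) conv_hull K.
Let Vh := @fe_space R m Omega Th r n.
Let I := ('I_(size Th) * 'I_n * mpoly.bmultinom m r.+1)%type.

(** Each point of the closure is assigned one simplex containing it, and [e] consists of monomials
    times unit vectors, cut off to the points assigned to a given simplex. These functions need not
    be continuous nor lie in [Vh]: they serve to count dimensions. *)
Lemma fe_coefficients : exists e : I -> 'rV[R]_m -> 'rV[R]_n, forall v, Vh v ->
  exists c : I -> R, forall x, closure Omega x -> v x = \sum_t c t *: e t x.
Proof.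
have ht x : exists t : option 'I_(size Th), closure Omega x ->
    if t is Some t then conv_hull (nth 0 Th t) x else False.
  have [cx|ncx] := pselect (closure Omega x); last by exists None.
  have := cx; rewrite cover => -[K /= KT Kx].
  have kT : (index K Th < size Th)%N by rewrite index_mem.
  by exists (Some (Ordinal kT)) => _ /=; rewrite nth_index.
have [tx htx] := choice ht.
exists (fun (t : I) x => (if tx x == Some t.1.1 then mpoly.meval (fun j => x 0 j) (mpoly.mpolyX R (t.2 : mpoly.multinom m)) else 0) *: delta_mx 0 t.1.2).
move=> v [_ _ pv].
have hq (ti : 'I_(size Th) * 'I_n) : exists q : mpoly.mpoly m R, (mpoly.msize q <= r.+1)%N /\
    forall x, conv_hull (nth 0 Th ti.1) x -> v x 0 ti.2 = mpoly.meval (fun j => x 0 j) q.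
  by have [q q1 q2] := pv _ (mem_nth 0 (ltn_ord ti.1)) ti.2; exists q.
have [q hq'] := choice hq.
exists (fun t : I => mpoly.mcoeff (t.2 : mpoly.multinom m) (q t.1)) => x cx.
have := htx x cx; case E : (tx x) => [t|//] Kx.
rewrite (eq_bigr (fun s : I => (if t == s.1.1 then
   mpoly.mcoeff (s.2 : mpoly.multinom m) (q (s.1.1, s.1.2)) * mpoly.meval (fun j => x 0 j) (mpoly.mpolyX R (s.2 : mpoly.multinom m)) else 0) *: delta_mx 0 s.1.2)); last first.
  move=> [[s1 s2] b] _ /=; rewrite ?E scalerA (_ : (Some t == Some s1) = (t == s1))//.
  by case: ifP; rewrite ?mulr0.
rewrite -(pair_big xpredT xpredT (fun (ti : 'I_(size Th) * 'I_n) (b : mpoly.bmultinom m r.+1) =>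
  (if t == ti.1 then mpoly.mcoeff (b : mpoly.multinom m) (q (ti.1, ti.2)) *
    mpoly.meval (fun j => x 0 j) (mpoly.mpolyX R (b : mpoly.multinom m)) else 0) *: (delta_mx 0 ti.2 : 'rV[R]_n)))/=.
rewrite -(pair_big xpredT xpredT (fun (t' : 'I_(size Th)) (i : 'I_n) => \sum_(b : mpoly.bmultinom m r.+1)
  (if t == t' then mpoly.mcoeff (b : mpoly.multinom m) (q (t', i)) *
    mpoly.meval (fun j => x 0 j) (mpoly.mpolyX R (b : mpoly.multinom m)) else 0) *: (delta_mx 0 i : 'rV[R]_n)))/=.
rewrite (bigD1 t)//= [X in _ = _ + X]big1 ?addr0 => [|t' tt']; last first.
  rewrite big1// => i _; rewrite big1// => b _; rewrite eq_sym (negbTE tt') scale0r//.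
rewrite [LHS]row_sum_delta; apply: eq_bigr => i _; rewrite eqxx -scaler_suml; congr (_ *: _).
have [q1 q2] := hq' (t, i); rewrite (q2 x Kx) {1}(mpoly.mpolywE q1).
rewrite raddf_sum/=; apply: eq_bigr => b _.
by rewrite mpoly.mevalZ.
Qed.

End dimension.

(** * Existence and uniqueness of one time step *)

Section time_step.
Variables (R : realType) (m n : nat) (Omega : set 'rV[R]_m).
Variables (Th : seq 'M[R]_(m.+1, m)) (r : nat).
Hypotheses (oO : open Omega) (bO : bounded_set Omega).
Hypothesis cover : closure Omega = \bigcup_(K in [set` Th]) conv_hull K.
Variables (p alpha eps delta lambda tau : R).
Variables (Wp Wm : 'rV[R]_n -> R).
Hypotheses (p1 : 1 <= p) (eps0 : 0 < eps) (delta0 : 0 < delta) (lambda0 : 0 < lambda).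
Hypothesis tau0 : 0 < tau.
Hypotheses (cWp : convex_function setT Wp) (cWm : convex_function setT Wm).
Hypotheses (dWp : forall y : 'rV[R]_n, differentiable Wp y)
           (dWm : forall y : 'rV[R]_n, differentiable Wm y).
Variable g : 'rV[R]_m -> 'rV[R]_n.
Hypothesis hg : L2 Omega g.
Variable E : nat -> set 'rV[R]_m.
Hypothesis coreE : core Omega Th E.
Let mu := lebesgue_rv R m.
Let Vh := @fe_space R m Omega Th r n.
Let D := \bigcup_k E k.
Let mD : measurable D. Proof. exact: (core_measurable coreE). Qed.
Implicit Types u v w : 'rV[R]_m -> 'rV[R]_n.

Let ip u v := \int[mu]_(x in D) mxdot (u x) (v x).
Let fd u0 u v x := @step_derivative R m n p alpha eps delta lambda tau Wp
  (u0 x) (g x) (gradient Wm (u0 x)) (u x) (cgrad u x) (v x) (cgrad v x).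
Let fe u0 u x := @step_density R m n p alpha eps delta lambda tau Wp
  (u0 x) (g x) (gradient Wm (u0 x)) (u x) (cgrad u x).

Let idot u v : Vh u -> Vh v -> mu.-integrable D (EFin \o (fun x => mxdot (u x) (v x))).
Proof. by move=> Vu Vv; apply: (fe_dot_int oO bO coreE Vu Vv). Qed.

(** A zero integral of $|v|^2$ gives $v=0$ almost everywhere in [D], hence in [Omega]; continuity
    extends this to every point of the closure. *)
Let ip_eq0 v : Vh v -> ip v v = 0 -> forall x, closure Omega x -> v x = 0.
Proof.
move=> Vv v0; have i1 := idot Vv Vv.
have mf : measurable_fun D (EFin \o (fun x => mxdot (v x) (v x))) by case/integrableP: i1.
have ae0 : ae_eq mu D (EFin \o (fun x => mxdot (v x) (v x))) (cst 0%E).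
  apply/(ae_eq_integral_abs mu mD mf).
  rewrite (eq_integral (EFin \o (fun x => mxdot (v x) (v x)))); last first.
    by move=> x _; rewrite /= ger0_norm// mxdot_ge0.
  rewrite -[LHS]fineK; last exact: integrable_fin_num.
  by move: v0; rewrite /ip /Rintegral => ->.
apply: (ae0_closure oO); first by case: Vv.
have [_ _ nD _ _] := coreE.
have nD' : {ae mu, forall x, Omega x -> D x}.
  by apply: negligibleS nD => x /= /not_implyP.
apply: (@filterS2 _ _ _ _ _ _ _ nD' ae0) => x OD h Ox.
by have := h (OD Ox) => /= -[] /mxdot_eq0.
Qed.

Let ip_suml k (c : 'I_k -> R) (v : 'I_k -> 'rV[R]_m -> 'rV[R]_n) w :
  (forall a, Vh (v a)) -> Vh w ->
  ip (fun x => \sum_a c a *: v a x) w = \sum_a c a * ip (v a) w.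
Proof.
move=> Vv Vw; under [RHS]eq_bigr do rewrite /ip -RintegralZl ?idot//.
rewrite -Rintegral_bigsum//; last by move=> a; apply: integrable_scale => //; exact: idot.
apply: eq_Rintegral => x _; rewrite mxdotC mxdot_sum_r.
by apply: eq_bigr => a _; rewrite mxdotC.
Qed.

Let ipC u v : ip u v = ip v u.
Proof. by apply: eq_Rintegral => x _; rewrite mxdotC. Qed.

Let orthonormal k (v : 'I_k -> 'rV[R]_m -> 'rV[R]_n) :=
  (forall a, Vh (v a)) /\ forall a b, ip (v a) (v b) = (a == b)%:R.

(** The coefficient rows of an orthonormal family are independent: a relation between them is a
    relation between the functions on [D], and pairing it with each member kills the coefficients.
    The number of columns is thus a bound. *)
Let orthonormal_bound : exists N, forall k (v : 'I_k -> 'rV[R]_m -> 'rV[R]_n), orthonormal v -> (k <= N)%N.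
Proof.
have [e he] := @fe_coefficients R m n Omega Th r cover.
set I := (_ * _)%type in e he; exists #|{: I}| => k v [Vv ov].
have /choice[c hc] a := he _ (Vv a).
pose T : 'M[R]_(k, #|{: I}|) := \matrix_(a, t) c a (enum_val t).
suff /eqP <- : row_free T by exact: rank_leq_col.
apply: inj_row_free => l lT.
have lc t : \sum_a l 0 a * c a t = 0.
  have := congr1 (fun A : 'rV[R]_#|{: I}| => A 0 (enum_rank t)) lT; rewrite !mxE => lt0.
  by rewrite -[RHS]lt0; apply: eq_bigr => a _; rewrite mxE enum_rankK.
have l0 x : D x -> \sum_a l 0 a *: v a x = 0.
  move=> Dx; have cx : closure Omega x by apply: subset_closure; exact: (core_sub coreE).
  under eq_bigr do rewrite (hc _ x cx) scaler_sumr.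
  rewrite exchange_big/= big1// => t _; under eq_bigr do rewrite scalerA.
  by rewrite -scaler_suml lc scale0r.
apply/rowP => b; rewrite mxE.
have : ip (fun x => \sum_a l 0 a *: v a x) (v b) = 0.
  rewrite /ip (@eq_Rintegral _ _ _ _ D (cst 0)); first by rewrite Rintegral_cst// mul0r.
  by move=> x /set_mem Dx; rewrite l0// mxdot0l.
rewrite ip_suml// (bigD1 b)//= ov eqxx mulr1 big1 ?addr0// => a ab.
by rewrite ov (negbTE ab) mulr0.
Qed.

(** A maximal orthonormal family: if the residual of a projection had positive norm, normalizing and
    appending it would give a longer one. Orthonormality later turns the $L^2$ norm into the sum of
    squares of coordinates. *)
Let basis : exists k (v : 'I_k -> 'rV[R]_m -> 'rV[R]_n), orthonormal v /\
  forall w, Vh w -> forall x, closure Omega x -> w x = \sum_a ip w (v a) *: v a x.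
Proof.
have [N hN] := orthonormal_bound.
pose P k := `[< exists v : 'I_k -> 'rV[R]_m -> 'rV[R]_n, orthonormal v >].
have P0 : exists k, P k.
  by exists 0%N; apply/asboolP; exists (fun _ _ => 0); split => -[].
have PN k : P k -> (k <= N)%N by move=> /asboolP[v]; exact: hN.
case: (ex_maxnP P0 PN) => k /asboolP[v [Vv ov]] kmax.
exists k, v; split => // w Vw.
pose s x := \sum_a ip w (v a) *: v a x.
have Vs : Vh s by exact: (fe_sum oO bO).
pose z := fe_sub w s.
have Vz : Vh z by exact: (fe_subP oO bO).
have zE x : z x = w x - s x by rewrite /z /fe_sub scaleN1r.
have ipz u : Vh u -> ip z u = ip w u - ip s u.
  move=> Vu; rewrite /ip -RintegralB; [|exact: mD|exact: idot|exact: idot].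
  by apply: eq_Rintegral => x _; rewrite zE mxdotDl mxdotNl.
have zv b : ip z (v b) = 0.
  rewrite ipz// /s ip_suml// (bigD1 b)//= ov eqxx mulr1 big1 ?addr0 ?subrr// => a ab.
  by rewrite ov (negbTE ab) mulr0.
suff z0 : ip z z = 0.
  move=> x cx; have := ip_eq0 Vz z0 cx; rewrite zE => /eqP.
  by rewrite subr_eq0 => /eqP.
apply/eqP; apply: contraT => zn0.
have zp : 0 < ip z z.
  by rewrite lt_neqAle eq_sym zn0; apply: Rintegral_ge0 => x _; exact: mxdot_ge0.
pose q := (Num.sqrt (ip z z))^-1.
(* Scaling is written as a sum with one term so that [fe_sum] and [ip_suml] apply. *)
pose z' : 'I_1 -> 'rV[R]_m -> 'rV[R]_n := fun _ x => \sum_(a < 1) q *: z x.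
have Vz' a : Vh (z' a) by apply: (@fe_sum _ _ _ _ _ _ oO bO 1 (fun=> q) (fun=> z)).
have ipz' a u : Vh u -> ip (z' a) u = q * ip z u.
  by move=> Vu; rewrite /z' (@ip_suml 1 (fun=> q) (fun=> z)) ?big_ord1.
pose v' (a : 'I_k.+1) := if unlift ord_max a is Some b then v b else z' 0.
have : P k.+1.
  apply/asboolP; exists v'; split => [a|a b]; rewrite /v'.
    by case: unliftP => [c _|_].
  case: unliftP => [c ->|->]; case: unliftP => [d ->|->].
  - by rewrite ov (inj_eq lift_inj).
  - by rewrite ipC ipz'// zv mulr0 eq_sym (negbTE (neq_lift _ _)).
  - by rewrite ipz'// zv mulr0 (negbTE (neq_lift _ _)).
  - rewrite ipz'// ipC ipz'// eqxx mulrA -expr2 exprVn sqr_sqrtr ?(ltW zp)//.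
    by rewrite mulVf.
by move=> /kmax; rewrite ltnn.
Qed.

(** The functional is transported to the coordinates of the orthonormal basis; a critical point
    there annihilates the derivative in every direction [U d], hence in every test function. *)
Lemma step_exists u0 : Vh u0 ->
  exists2 u, Vh u & forall v, Vh v -> \int[mu]_(x in D) fd u0 u v x = 0.
Proof.
move=> V0; have [k [v [[Vv ov] span]]] := basis.
pose U (c : 'rV[R]_k) x := \sum_a c 0 a *: v a x.
have VU c : Vh (U c) by exact: (fe_sum oO bO).
have Udelta i : U (delta_mx 0 i) = v i.
  apply/funext => x; rewrite /U (bigD1 i)//= big1 ?addr0 => [|a ai].
    by rewrite mxE !eqxx scale1r.
  by rewrite mxE (negbTE ai) andbF scale0r.
have Ucomb c d t x : U (c + t *: d) x = U c x + t *: U d x.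
  rewrite /U scaler_sumr -big_split; apply: eq_bigr => a _.
  by rewrite !mxE scalerDl scalerA.
have Usub c c' : fe_sub (U c') (U c) = U (c' - c).
  by apply/funext => x; rewrite -scaleN1r Ucomb.
have ipU d : ip (U d) (U d) = \sum_i d 0 i ^+ 2.
  rewrite [LHS]ip_suml//; apply: eq_bigr => a _; rewrite ipC [X in _ * X]ip_suml//.
  rewrite (bigD1 a)//= ov eqxx mulr1 big1 ?addr0 ?expr2// => b ab.
  by rewrite ov (negbTE ab) mulr0.
have ti : 0 < (2 * tau)^-1 by rewrite invr_gt0 mulr_gt0.
have [c hc] : exists c : 'rV[R]_k, forall d, \int[mu]_(x in D) fd u0 (U c) (U d) x = 0.
  apply: (@strongly_convex_critical_point R k (fun c => \int[mu]_(x in D) fe u0 (U c) x)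
    (fun c d => \int[mu]_(x in D) fd u0 (U c) (U d) x) _ ti).
  - move=> c d; under [RHS]eq_bigr do rewrite Udelta.
    exact: (@step_derivative_linear R m n Omega Th r oO bO p alpha eps delta lambda tau Wp Wm
      eps0 delta0 lambda0 tau0 cWp cWm dWp dWm g hg E coreE u0 (U c) k (fun a => d 0 a) v V0 (VU c) Vv).
  - move=> c c'; rewrite -ipU -Usub.
    exact: (@step_gap R m n Omega Th r oO bO p alpha eps delta lambda tau Wp Wm p1 eps0 delta0
      lambda0 tau0 cWp cWm dWp dWm g hg E coreE u0 (U c) (U c') V0 (VU c) (VU c')).
  - move=> B.
    have [Bv Bv0 hBv] : exists2 C, 0 <= C & forall a x, D x ->
        (forall i, `|v a x 0 i| <= C) /\ (forall i j, `|cgrad (v a) x i j| <= C).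
      have /choice[C hC] a : exists C, 0 <= C /\ forall x, D x ->
          (forall i, `|v a x 0 i| <= C) /\ (forall i j, `|cgrad (v a) x i j| <= C).
        by have [C C0 hC] := fe_uniform_bound bO coreE (Vv a); exists C.
      exists (\sum_a C a); first by apply: sumr_ge0 => a _; have [] := hC a.
      move=> a x Dx; have [_ /(_ x Dx)[h1 h2]] := hC a.
      have le : C a <= \sum_a C a.
        by rewrite (bigD1 a)//= lerDl; apply: sumr_ge0 => b _; have [] := hC b.
      by split => [i|i j]; [exact: le_trans (h1 i) le|exact: le_trans (h2 i j) le].
    (* The first term bounds every combination of basis functions with coefficients at most $|B|$,
       the second a single basis function used as a direction. *)
    pose B' := k%:R * (`|B| * Bv) + Bv.
    have B'0 : 0 <= B' by rewrite addr_ge0// !mulr_ge0.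
    have [K K0 hK] := @step_derivative_dominated R m n Omega Th r bO p alpha eps delta lambda tau Wp Wm
      eps0 delta0 lambda0 tau0 cWp cWm dWp dWm g E coreE u0 B' V0 B'0.
    exists (K * \int[mu]_(x in D) g_weight g x) => c cB i; rewrite Udelta.
    have coord a : `|c 0 a| <= `|B|.
      apply: le_trans (le_trans cB (ler_norm B)).
      by rewrite [leRHS]/Num.norm/= mx_normrE; apply/bigmax_geP; right; exists (0, a).
    have sumB (F : 'I_k -> R) : (forall a, `|F a| <= Bv) -> `|\sum_a c 0 a * F a| <= B'.
      move=> hF'; rewrite (le_trans (ler_norm_sum _ _ _))//.
      rewrite (@le_trans _ _ (\sum_(a < k) (`|B| * Bv)))//.
        by apply: ler_sum => a _; rewrite normrM ler_pM.
      by rewrite sumr_const card_ord -[leLHS]mulr_natl lerDl.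
    have ig := g_weight_integrable oO bO hg coreE.
    have id := @step_derivative_int R m n Omega Th r oO bO p alpha eps delta lambda tau Wp Wm
      eps0 delta0 lambda0 tau0 cWp cWm dWp dWm g hg E coreE u0 (U c) (v i) V0 (VU c) (Vv i).
    rewrite -RintegralZl// (le_trans (le_normr_Rintegral mD id))//.
    apply: le_Rintegral => //; [exact: integrable_norm|exact: integrable_scale|].
    move=> x Dx; apply: hK => //.
    + move=> l; rewrite summxE; under eq_bigr do rewrite mxE.
      by apply: sumB => a; have [] := hBv a x Dx.
    + move=> l j; rewrite (cgrad_sum coreE _ Vv Dx) summxE.
      rewrite (eq_bigr (fun a => c 0 a * cgrad (v a) x l j)) => [|a _]; last by rewrite [LHS]mxE.
      by apply: sumB => a; have [] := hBv a x Dx.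
    + by move=> l; have [h _] := hBv i x Dx; rewrite (le_trans (h l))// lerDr !mulr_ge0.
    + by move=> l j; have [_ h] := hBv i x Dx; rewrite (le_trans (h l j))// lerDr !mulr_ge0.
  - move=> c d; rewrite (_ : (fun j : nat => _) = (fun j : nat => j.+1%:R *
      (\int[mu]_(x in D) fe u0 (fun x => U c x + j.+1%:R^-1 *: U d x) x - \int[mu]_(x in D) fe u0 (U c) x))).
      exact: (@step_derivative_cvg R m n Omega Th r oO bO p alpha eps delta lambda tau Wp Wm p1 eps0
        delta0 lambda0 tau0 cWp cWm dWp dWm g hg E coreE u0 (U c) (U d) V0 (VU c) (VU d)).
    apply/funext => j.
    have -> : U (c + j.+1%:R^-1 *: d) = (fun x => U c x + j.+1%:R^-1 *: U d x).
      by apply/funext => x; exact: Ucomb.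
    by [].
exists (U c) => // w Vw.
pose d : 'rV[R]_k := \row_a ip w (v a).
rewrite -(hc d); apply: eq_Rintegral => x /set_mem Dx.
(* The expansion holds on the closure only, which is enough because values and [cgrad] are used only
   on [D]. *)
have wU y : closure Omega y -> w y = U d y.
  by move=> cy; rewrite (span w Vw y cy); apply: eq_bigr => a _; rewrite mxE.
rewrite /fd (cgrad_eq coreE Dx wU) wU//.
by apply: subset_closure; exact: (core_sub coreE).
Qed.

(** Adding the gap inequalities from [u] to [w] and from [w] to [u] cancels the functional, and the
    derivatives vanish, so only the quadratic remainders are left and must be zero. *)
Lemma step_unique u0 u w : Vh u0 -> Vh u -> Vh w ->
  (forall v, Vh v -> \int[mu]_(x in D) fd u0 u v x = 0) ->
  (forall v, Vh v -> \int[mu]_(x in D) fd u0 w v x = 0) ->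
  forall x, closure Omega x -> w x = u x.
Proof.
move=> V0 Vu Vw su sw.
have Vs := fe_subP oO bO Vw Vu; have Vs' := fe_subP oO bO Vu Vw.
have h1 := @step_gap R m n Omega Th r oO bO p alpha eps delta lambda tau Wp Wm p1 eps0 delta0
  lambda0 tau0 cWp cWm dWp dWm g hg E coreE u0 u w V0 Vu Vw.
have h2 := @step_gap R m n Omega Th r oO bO p alpha eps delta lambda tau Wp Wm p1 eps0 delta0
  lambda0 tau0 cWp cWm dWp dWm g hg E coreE u0 w u V0 Vw Vu.
have ti : 0 < (2 * tau)^-1 by rewrite invr_gt0 mulr_gt0.
have g1 : 0 <= ip (fe_sub w u) (fe_sub w u) by apply: Rintegral_ge0 => x _; exact: mxdot_ge0.
have g2 : 0 <= ip (fe_sub u w) (fe_sub u w) by apply: Rintegral_ge0 => x _; exact: mxdot_ge0.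
have e1 := su _ Vs; have e2 := sw _ Vs'.
rewrite /fd in e1 e2; rewrite e1 add0r in h1; rewrite e2 add0r in h2.
have z0 : ip (fe_sub w u) (fe_sub w u) = 0.
  apply/eqP; rewrite eq_le g1 andbT -(pmulr_rle0 _ ti).
  have := mulr_ge0 (ltW ti) g2; move: h1 h2; rewrite -/D -/mu /ip; lra.
by move=> x cx; have := ip_eq0 Vs z0 cx; rewrite /fe_sub scaleN1r => /eqP; rewrite subr_eq0 => /eqP.
Qed.

End time_step.

(** * Well-posedness of the scheme and decay of the energy *)

Theorem theorem7p1 (R : realType) (m n : nat) (hm : (0 < m)%N) (hn : (0 < n)%N)
    (p alpha eps delta lambda T : R) (hp : 1 <= p) (halpha : 0 < alpha)
    (heps : 0 < eps) (hdelta : 0 < delta) (hlambda : 0 < lambda) (hT : 0 < T)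
    (Omega : set 'rV[R]_m) (hOmega : bounded_polytope_domain Omega)
    (g : 'rV[R]_m -> 'rV[R]_n) (hg : L2 Omega g)
    (Wp Wm : 'rV[R]_n -> R)
    (hWp : convex_function setT Wp) (hWm : convex_function setT Wm)
    (dWp : forall y : 'rV[R]_n, differentiable Wp y)
    (dWm : forall y : 'rV[R]_n, differentiable Wm y)
    (hF : forall y : 'rV[R]_n, potential y = Wp y - Wm y)
    (Th : seq 'M[R]_(m.+1, m)) (hTh : triangulation Omega Th)
    (kappa : R) (hkappa : 0 < kappa) (hqu : quasi_uniform kappa Th)
    (hh : 0 < mesh_size Th < 1)
    (r : nat) (hr : (0 < r)%N) (L : nat) (hL : (0 < L)%N) :
  let tau := T / L%:R in
  let Vh := @fe_space R m Omega Th r n in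
  let is_step := scheme Omega p alpha eps delta lambda tau g Vh Wp Wm in
  let J := energy Omega p alpha eps delta lambda g in
  (forall u_prev, Vh u_prev ->
     exists u, [/\ Vh u, is_step u_prev u &
       forall w, Vh w -> is_step u_prev w ->
         forall x, closure Omega x -> w x = u x]) /\
  (forall u : nat -> 'rV[R]_m -> 'rV[R]_n,
     Vh (u 0%N) ->
     (forall k, (1 <= k <= L)%N -> Vh (u k) /\ is_step (u k.-1) (u k)) ->
     forall l, (1 <= l <= L)%N ->
       tau / 2 * (\sum_(1 <= k < l.+1)
                    L2norm Omega (dt tau (u k.-1) (u k)) ^+ 2)
       + J (u l) <= J (u 0%N)).
Proof.
move=> tau Vh is_step J.
have [_ oO _ bO _] := hOmega; have [cover indep _] := hTh.
have tau0 : 0 < tau by rewrite divr_gt0// ltr0n.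
have [E coreE] := core_exists oO cover indep.
pose fd u0 u v x := @step_derivative R m n p alpha eps delta lambda tau Wp
  (u0 x) (g x) (gradient Wm (u0 x)) (u x) (cgrad u x) (v x) (cgrad v x).
pose mu := lebesgue_rv R m; pose D := \bigcup_k E k.
(* From here on the scheme is replaced by its form over the core, the vanishing of the derivative of
   the step functional. *)
have stepP u0 u : Vh u0 -> Vh u -> is_step u0 u <->
    forall v, Vh v -> \int[mu]_(x in D) fd u0 u v x = 0.
  move=> V0 Vu.
  have sE v : Vh v -> L2dot Omega (dt tau u0 u) v
      + L2dot Omega (flux Omega p alpha eps u) (grad Omega v)
      + lambda * L2dot Omega (fun x => u x - g x) v
      + delta^-1 * L2dot Omega (fun x => gradient Wp (u x)) v
      - delta^-1 * L2dot Omega (fun x => gradient Wm (u0 x)) v =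
      \int[mu]_(x in D) fd u0 u v x.
    by move=> Vv; apply: (@scheme_step R m n Omega Th r oO bO).
  split => h v Vv.
    by rewrite -(sE v Vv); apply/eqP; rewrite subr_eq0; apply/eqP; exact: h.
  by apply/eqP; rewrite -subr_eq0 (sE v Vv) h.
split.
  move=> u0 V0.
  have [u Vu su] := @step_exists R m n Omega Th r oO bO cover p alpha eps delta lambda tau Wp Wm
    hp heps hdelta hlambda tau0 hWp hWm dWp dWm g hg E coreE u0 V0.
  exists u; split => //; first exact/(stepP _ _ V0 Vu).
  move=> w Vw /(stepP _ _ V0 Vw) sw.
  exact: (@step_unique R m n Omega Th r oO bO p alpha eps delta lambda tau Wp Wm
    hp heps hdelta hlambda tau0 hWp hWm dWp dWm g hg E coreE u0 u w V0 Vu Vw su sw).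
move=> u V0 hu.
have Vu k : (k <= L)%N -> Vh (u k).
  by case: k => [//|k] kL; have [] := hu k.+1 kL.
have dec k : (k < L)%N -> tau / 2 * L2norm Omega (dt tau (u k) (u k.+1)) ^+ 2 + J (u k.+1) <= J (u k).
  move=> kL; have [_ sk] := hu k.+1 kL.
  have Vk := Vu k (ltnW kL); have Vk1 := Vu k.+1 kL.
  have := @energy_step R m n Omega Th r oO bO p alpha eps delta lambda tau Wp Wm
    hp heps hdelta hlambda tau0 hWp hWm dWp dWm hF g hg E coreE _ _ Vk Vk1 ((stepP _ _ Vk Vk1).1 sk).
  (* Half of the dissipation provided by [energy_step] is given up here. *)
  apply: le_trans; rewrite lerD2r ler_wpM2r ?sqr_ge0//.
  by rewrite ler_pdivrMr// ler_peMr ?(ltW tau0)// ler1n.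
(* The induction starts at 0, where the sum is empty, rather than at 1. *)
move=> l /andP[_]; elim: l => [|l IH] lL.
  by rewrite big_geq// mulr0 add0r.
rewrite big_nat_recr//= mulrDr -addrA (le_trans _ (IH (ltnW lL)))// lerD2l.
exact: dec.
Qed.
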